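(* Let $0 < p_1, p_2, \theta_1, \theta_2 < \infty$, $p_2 < p_1$, $\theta_1 \le p_2 < \theta_2$. Assume that $v_1, v_2 \in \mathcal{W}(\mathbb{R}^n)$, $\omega_1 \in {}^{\mathbf c}\Omega_{\theta_1}$ and $\omega_2 \in \Omega_{\theta_2}$. Suppose that $\widetilde V$ is admissible and $$\varphi_1(x) := \sup_{t\in(0,\infty)} \widetilde V(t)\, \mathcal{V}(x,t)\, \|\omega_1\|_{\theta_1,(0,t)}^{-1} \in Q_{\widetilde V^{\frac{1}{p_1\to p_2}}}.$$ Write $\|\mathrm{I}\|$ for $\|\mathrm{I}\|_{{}^{\mathbf c}LM_{p_1\theta_1,\omega_1}(\mathbb{R}^n,v_1)\to LM_{p_2\theta_2,\omega_2}(\mathbb{R}^n,v_2)}$. (i) If $p_1 \le \theta_2$, then $$\|\mathrm{I}\| \approx \sup_{x\in(0,\infty)} \varphi_1(x) \sup_{t\in(0,\infty)} \mathcal{V}(t,x)\, \|\omega_2\|_{\theta_2,(t,\infty)}.$$ (ii) If $\theta_2 < p_1$, then $$\|\mathrm{I}\| \approx \sup_{x\in(0,\infty)} \varphi_1(x) \left(\int_0^\infty \mathcal{V}(t,x)^{p_1\to\theta_2}\, d\Big(-\|\omega_2\|_{\theta_2,(t,\infty)}^{p_1\to\theta_2}\Big)\right)^{\frac{1}{p_1\to\theta_2}}.$$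
   Context: Let $n\ge 1$. For measurable $A$ (in $\mathbb{R}^n$ or $\mathbb{R}$), $\mathfrak{M}(A)$ is the set of measurable functions on $A$, $\mathfrak{M}^+(A)$ the non-negative ones, and $\mathcal{W}(A)$ the set of weights: measurable functions that are positive and finite a.e. on $A$. For $p\in(0,\infty]$, $\|f\|_{p,A}=(\int_A|f|^p)^{1/p}$ if $p<\infty$ and $\|f\|_{\infty,A}=\operatorname{ess\,sup}_A|f|$. For a non-negative measurable $w$, $\|f\|_{p,w,A}:=\|fw\|_{p,A}$ (the weight is inside the power). $B(0,t)$ is the open ball of radius $t$ centred at $0$ and ${}^{\mathbf c}B(0,t)=\mathbb{R}^n\setminus B(0,t)$. For $0<p,\theta\le\infty$, $\omega\in\mathfrak{M}^+(0,\infty)$, $v\in\mathcal{W}(\mathbb{R}^n)$: - $LM_{p\theta,\omega}(\mathbb{R}^n,v)$ is the set of $f\in L^{\rm loc}_{p,v}(\mathbb{R}^n)$ (i.e. $\|f\|_{p,v,K}<\infty$ for compact $K$) with $\|f\|_{LM_{p\theta,\omega}(\mathbb{R}^n,v)}:=\big\|\,t\mapsto\|f\|_{p,v,B(0,t)}\big\|_{\theta,\omega,(0,\infty)}<\infty$; - ${}^{\mathbf c}LM_{p\theta,\omega}(\mathbb{R}^n,v)$ is the set of $f\in\bigcap_{t>0}L_{p,v}({}^{\mathbf c}B(0,t))$ (i.e. $\|f\|_{p,v,{}^{\mathbf c}B(0,t)}<\infty$ for all $t>0$) with $\|f\|_{{}^{\mathbf c}LM_{p\theta,\omega}(\mathbb{R}^n,v)}:=\big\|\,t\mapsto\|f\|_{p,v,{}^{\mathbf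 c}B(0,t)}\big\|_{\theta,\omega,(0,\infty)}<\infty$. $\Omega_\theta=\{\omega\in\mathfrak{M}^+(0,\infty):0<\|\omega\|_{\theta,(t,\infty)}<\infty\ \forall t>0\}$ and ${}^{\mathbf c}\Omega_\theta=\{\omega\in\mathfrak{M}^+(0,\infty):0<\|\omega\|_{\theta,(0,t)}<\infty\ \forall t>0\}$. $\|\mathrm{I}\|_{X\to Y}\in[0,\infty]$ is the least constant $c$ with $\|f\|_Y\le c\|f\|_X$ for all $f\in X$ ($\infty$ if there is none). For $0<p,q\le\infty$, the symbol $p\to q$ used as an exponent denotes the number defined by $\frac1{p\to q}=\frac1q-\frac1p$ if $q<p$, and $p\to q=\infty$ if $q\ge p$. For $t,x>0$: $\widetilde V(x):=\|v_1^{-1}v_2\|_{p_1\to p_2,\,B(0,x)}$ and $\mathcal{V}(t,x):=\dfrac{\widetilde V(t)}{\widetilde V(t)+\widetilde V(x)}$. The value of a monotone function at an endpoint of its interval means its limit there. A function $U$ is admissible if it is continuous and strictly increasing on $[0,\infty)$, $U(0)=0$ and $\lim_{t\to\infty}U(t)=\infty$. For admissible $U$, a function $\varphi$ is $U$-quasiconcave if $\varphi$ is equivalent ($\approx$, pointwise on $(0,\infty)$) to an increasing function on $(0,\infty)$ and $\varphi/U$ is equivalent to a decreasing function on $(0,\infty)$. It is non-degenerate if $\lim_{t\to0+}\varphi(t)=\lim_{t\to\infty}\frac1{\varphi(t)}=\lim_{t\to\infty}\frac{\varphi(t)}{U(t)}=\lim_{t\to0+}\frac{U(t)}{\varphi(t)}=0$.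 $Q_U$ is the family of non-degenerate $U$-quasiconcave functions. Integrals $\int_0^\infty F(t)\,d(G(t))$ with $G$ non-decreasing are Lebesgue–Stieltjes integrals over $(0,\infty)$. $A\approx B$ means $\lambda^{-1}B\le A\le\lambda B$ with $\lambda\ge1$ depending only on inessential parameters; for the norm estimates this means on $n$ and the exponents $p_i,\theta_i$, but not on the weights (in particular one side is infinite iff the other is). Conventions: $0/0=0$, $0\cdot(\pm\infty)=0$, $1/(\pm\infty)=0$. *)

(* Defs.v *)
From HB Require Import structures.
From mathcomp Require Import all_boot all_order all_algebra.
From mathcomp Require Import all_classical all_reals all_analysis.
From mathcomp Require Import measurable_realfun.
Set Implicit Arguments.
Unset Strict Implicit.
Unset Printing Implicit Defensive.
Import Order.TTheory GRing.Theory Num.Theory.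
Import numFieldNormedType.Exports.
Local Open Scope classical_set_scope.
Local Open Scope ring_scope.

Section lebesgue_Rn.
Context {R : realType}.
Local Notation RR := (measurableTypeR R).

Section succ.
Variables (n : nat) (m : {sigma_finite_measure set (n.-tuple RR) -> \bar R}).

Definition tuple_cons (z : RR * n.-tuple RR) : n.+1.-tuple RR :=
  [the n.+1.-tuple RR of z.1 :: z.2].

Lemma measurable_tuple_cons : measurable_fun [set: RR * n.-tuple RR] tuple_cons.
Proof. exact: measurable_cons. Qed.

Definition lebesgue_succ : set (n.+1.-tuple RR) -> \bar R :=
  pushforward (@lebesgue_measure R \x m)%E tuple_cons.

Let succ0 : lebesgue_succ set0 = 0%E.
Proof. by rewrite /lebesgue_succ /pushforward preimage_set0 measure0. Qed.

Let succ_ge0 A : (0 <= lebesgue_succ A)%E.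
Proof. exact: (measure_ge0 (@lebesgue_measure R \x m)%E). Qed.

Let succ_sigma_additive : semi_sigma_additive lebesgue_succ.
Proof.
move=> F mF tF mUF; rewrite /lebesgue_succ /pushforward preimage_bigcup.
have mp A : measurable A -> measurable (tuple_cons @^-1` A).
  by move=> mA; rewrite -[X in measurable X]setTI; exact: measurable_tuple_cons.
apply: measure_semi_sigma_additive.
- by move=> k; exact: mp.
- apply/trivIsetP => /= i j _ _ ij; rewrite -preimage_setI.
  by move/trivIsetP : tF => /(_ _ _ _ _ ij) ->//; rewrite preimage_set0.
- by rewrite -preimage_bigcup; exact: mp.
Qed.

HB.instance Definition _ := isMeasure.Build _ _ _ lebesgue_succ
  succ0 succ_ge0 succ_sigma_additive.

Let succ_sigma_finite : sigma_finite setT lebesgue_succ.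
Proof.
have /sigma_finiteP[F [TF ndF Foo]] := sigma_finiteT (@lebesgue_measure R).
have /sigma_finiteP[G [TG ndG Goo]] := sigma_finiteT m.
pose u (t : n.+1.-tuple RR) : RR * n.-tuple RR :=
  (thead t, [tuple of behead t] : n.-tuple RR).
have uK : cancel tuple_cons u.
  by case=> a t; congr pair; apply/val_inj.
have Ku : cancel u tuple_cons.
  by move=> t; rewrite [RHS]tuple_eta; apply/val_inj.
have mu : measurable_fun setT u.
  by apply/measurable_fun_pairP; split;
    [exact: measurable_tnth | exact: measurable_behead].
exists (fun k => u @^-1` (F k `*` G k)).
  rewrite predeqE => t; split=> // _.
  have [i _ Fi] : (\bigcup_i F i) (u t).1 by rewrite -TF.
  have [j _ Gj] : (\bigcup_j G j) (u t).2 by rewrite -TG.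
  exists (maxn i j) => //; split.
  - by move: Fi; apply/subsetPset/ndF/leq_maxl.
  - by move: Gj; apply/subsetPset/ndG/leq_maxr.
move=> k; have [mF Fk] := Foo k; have [mG Gk] := Goo k.
have mFG : measurable (F k `*` G k) by exact: measurableX.
split; first by rewrite -[X in measurable X]setTI; exact: mu.
rewrite /lebesgue_succ /pushforward -comp_preimage.
have -> : u \o tuple_cons = id by exact/funext.
by rewrite preimage_id product_measure1E// lte_mul_pinfty// ge0_fin_numE.
Qed.

HB.instance Definition _ := @Measure_isSigmaFinite.Build _ _ _ lebesgue_succ
  succ_sigma_finite.

End succ.

Fixpoint borel_lebesgue (n : nat) :
    {sigma_finite_measure set (n.-tuple RR) -> \bar R} :=
  match n with
  | 0 => \d_([tuple] : 0.-tuple RR)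
  | k.+1 => lebesgue_succ (borel_lebesgue k)
  end.

Lemma borel_lebesgue_box n (A : 'I_n -> set RR) :
  (forall i, measurable (A i)) ->
  borel_lebesgue n [set x | forall i, A i (tnth x i)] =
  (\prod_(i < n) lebesgue_measure (A i))%E.
Proof.
elim: n A => [A _|n ih A mA].
  rewrite big_ord0 /= diracE mem_set//= => -[].
  by [].
rewrite big_ord_recl -ih//.
pose B : set (n.-tuple RR) := [set x | forall i, A (lift ord0 i) (tnth x i)].
have mB : measurable B.
  rewrite [B](_ : _ = \bigcap_(i in [set: 'I_n])
    ((fun x : n.-tuple RR => tnth x i) @^-1` A (lift ord0 i))); last first.
    by apply/seteqP; split=> x /= h i; [move=> _|]; exact: h.
  apply: fin_bigcap_measurable => //= i _.
  rewrite -[X in measurable X]setTI; exact: measurable_tnth.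
rewrite /= /lebesgue_succ /pushforward -product_measure1E//; congr product_measure1.
apply/seteqP; split=> -[a t] /= h.
  split; first by have := h ord0; rewrite (tnth_nth a).
  by move=> i; have := h (lift ord0 i); rewrite tnthS.
move=> i; case: (unliftP ord0 i) => [j ->|->].
  by rewrite tnthS; exact: h.2.
by rewrite (tnth_nth a); exact: h.1.
Qed.

End lebesgue_Rn.

Section euclidean_space.
Context {R : realType}.
Implicit Types (n : nat) (t : R).

(* R^n with its Lebesgue measurable sets, i.e. the completion of the Borel
   sigma-algebra; `leb_line` is the analogue provided by the library for R. *)
Definition leb_space n : measurableType _ :=
  caratheodory_type ((@borel_lebesgue R n)^*)%mu.

Definition lebesgue n : {measure set (leb_space n) -> \bar R} :=
  @completed_measure_extension _ _ _ (@borel_lebesgue R n).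

Definition leb_line : measurableType _ :=
  caratheodory_type ((wlength (@idfun R))^*)%mu.

Definition lebesgue1 : {measure set leb_line -> \bar R} :=
  @completed_lebesgue_measure R.

Definition euclidean_norm n (x : n.-tuple R) : R :=
  Num.sqrt (\sum_(i < n) tnth x i ^+ 2).

Definition B0 n t : set (leb_space n) := [set x | euclidean_norm x < t].

End euclidean_space.

Arguments leb_space R n : clear implicits.
Arguments lebesgue R n : clear implicits.
Arguments lebesgue1 R : clear implicits.
Arguments leb_line R : clear implicits.
Arguments B0 {R} n t.

Section weighted_norms.
Context {R : realType} {d : measure_display} {T : measurableType d}.
Variable mu : {measure set T -> \bar R}.
Implicit Types (p : \bar R) (A : set T) (f w : T -> \bar R).
Local Open Scope ereal_scope.

(* Functions take values in \bar R: weights are only a.e. positive and finite.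
   The library's product satisfies 0 * +oo = 0. *)
Definition norm_on A p f : \bar R := Lnorm mu p (f \_ A).

Definition wnorm A p w f : \bar R := norm_on A p (fun x => f x * w x).

Definition weight w : Prop :=
  measurable_fun setT w /\ {ae mu, forall x, 0 < w x < +oo}.

Definition nonneg_measurable A f : Prop :=
  measurable_fun A f /\ forall x, A x -> 0 <= f x.

End weighted_norms.

Section morrey.
Context {R : realType}.
Implicit Types (p q theta : \bar R) (omega : R -> \bar R).
Local Open Scope ereal_scope.

Definition LM_norm n p theta omega (v f : leb_space R n -> \bar R) : \bar R :=
  wnorm (lebesgue1 R) `]0%R, +oo[ theta omega
    (fun t : R => wnorm (lebesgue R n) (B0 n t) p v f).

Definition cLM_norm n p theta omega (v f : leb_space R n -> \bar R) : \bar R :=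
  wnorm (lebesgue1 R) `]0%R, +oo[ theta omega
    (fun t : R => wnorm (lebesgue R n) (~` B0 n t) p v f).

Definition cLM n p theta omega (v : leb_space R n -> \bar R) :
    set (leb_space R n -> \bar R) :=
  [set f | [/\ measurable_fun setT f,
    forall t : R, (0 < t)%R -> wnorm (lebesgue R n) (~` B0 n t) p v f < +oo &
    cLM_norm p theta omega v f < +oo]].

Definition Omega theta omega : Prop :=
  nonneg_measurable (`]0%R, +oo[ : set (leb_line R)) omega /\
  forall t : R, (0 < t)%R -> 0 < norm_on (lebesgue1 R) `]t, +oo[ theta omega < +oo.

Definition cOmega theta omega : Prop :=
  nonneg_measurable (`]0%R, +oo[ : set (leb_line R)) omega /\
  forall t : R, (0 < t)%R -> 0 < norm_on (lebesgue1 R) `]0%R, t[ theta omega < +oo.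

(* Norm of the identity from the set X with norm NX to the norm NY; it is +oo
   when no constant is suitable. *)
Definition norm_I (F : Type) (X : set F) (NX NY : F -> \bar R) : \bar R :=
  ereal_inf [set c%:E | c in
    [set c : R | (0 <= c)%R /\ forall f, X f -> NY f <= c%:E * NX f]].

Definition to_exp p q : \bar R :=
  if q < p then (q^-1 - p^-1)^-1 else +oo.

Definition Vtilde n p1 p2 (v1 v2 : leb_space R n -> \bar R) (x : R) : \bar R :=
  norm_on (lebesgue R n) (B0 n x) (to_exp p1 p2) (fun y => (v1 y)^-1 * v2 y).

Definition Vcal (V : R -> \bar R) (t x : R) : \bar R := V t / (V t + V x).

Definition phi1 (V : R -> \bar R) theta1 omega1 (x : R) : \bar R :=
  ereal_sup [set V t * Vcal V x t * (norm_on (lebesgue1 R) `]0%R, t[ theta1 omega1)^-1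
            | t in `]0%R, +oo[].

End morrey.

Section quasiconcave.
Context {R : realType}.
Implicit Types U phi f g : R -> \bar R.
Local Open Scope ereal_scope.

(* Strict monotonicity makes an admissible function finite on [0, +oo[. *)
Definition admissible U : Prop :=
  [/\ {within `[0%R, +oo[, continuous U},
      {in `[0%R, +oo[ &, {homo U : s t / (s < t)%R >-> s < t}},
      U 0%R = 0 & U t @[t --> +oo%R] --> +oo].

Definition eqv_upto (lambda : R) (a b : \bar R) : Prop :=
  (lambda^-1)%:E * b <= a <= lambda%:E * b.

Definition equivalent f g : Prop :=
  exists2 lambda : R, (1 <= lambda)%R &
    forall t : R, (0 < t)%R -> eqv_upto lambda (f t) (g t).

Definition quasiconcave U phi : Prop :=
  (exists2 g, {in `]0%R, +oo[ &, {homo g : s t / (s <= t)%R >-> s <= t}} &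
     equivalent phi g) /\
  (exists2 g, {in `]0%R, +oo[ &, {homo g : s t / (s <= t)%R >-> t <= s}} &
     equivalent (fun t => phi t / U t) g).

Definition nondegenerate_for U phi : Prop :=
  [/\ phi t @[t --> 0%R^'+] --> 0,
      (phi t)^-1 @[t --> +oo%R] --> 0,
      phi t / U t @[t --> +oo%R] --> 0 &
      U t / phi t @[t --> 0%R^'+] --> 0].

Definition Q_ U : set (R -> \bar R) :=
  [set phi | quasiconcave U phi /\ nondegenerate_for U phi].

End quasiconcave.

Section stieltjes.
Context {R : realType}.
Local Notation RR := (measurableTypeR R).
Implicit Types G : R -> \bar R.
Local Open Scope ereal_scope.

(* The library's lebesgue_stieltjes_measure needs a monotone function on the
   whole of R, whereas G is only defined on ]0, +oo[ and may tend to -oo at 0;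
   dG is therefore the measure with dG ]a, b] = G b - G a for 0 < a <= b, which
   exists by stieltjes_measureP and is unique on ]0, +oo[. *)
Definition is_stieltjes G (m : {measure set RR -> \bar R}) : Prop :=
  forall a b : R, (0 < a)%R -> (a <= b)%R -> m `]a, b]%classic = G b - G a.

Definition stieltjes_measure G : {measure set RR -> \bar R} :=
  if pselect (exists m, is_stieltjes G m) is left h then sval (cid h)
  else mzero.

Lemma lebesgue_stieltjes_itvoc (F : cumulative R R) (a b : R) : (a <= b)%R ->
  lebesgue_stieltjes_measure F `]a, b]%classic = (F b - F a)%:E.
Proof.
move=> ab; rewrite /lebesgue_stieltjes_measure /measure_extension.
by rewrite measurable_mu_extE/= ?wlength_itv_bnd//; exact: is_ocitv.
Qed.

Lemma stieltjes_measureP G :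
  (forall t : R, (0 < t)%R -> G t \is a fin_num) ->
  {in `]0%R, +oo[ &, {homo G : s t / (s <= t)%R >-> s <= t}} ->
  (forall t : R, (0 < t)%R -> G s @[s --> t^'+] --> G t) ->
  is_stieltjes G (stieltjes_measure G).
Proof.
move=> Gfin Gnd Grc; rewrite /stieltjes_measure.
case: pselect => [h|[]]; first by case: cid.
pose H (s : R) : R := fine (G (expR s)).
have Hnd : nondecreasing H.
  move=> s t st; rewrite /H fine_le ?Gfin ?expR_gt0//.
  by apply: Gnd; rewrite ?in_itv/= ?andbT ?expR_gt0// ler_expR.
have Hrc : right_continuous H.
  move=> s; apply: fine_cvg; rewrite /H fineK ?Gfin ?expR_gt0//.
  apply: (@cvg_trans _ (G u @[u --> (expR s)^'+])); last exact/Grc/expR_gt0.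
  move=> A [e /= e0 eA].
  have /cvgrPdist_lt/(_ _ e0)[e' /= e'0 eP] := @continuous_expR R s.
  exists e' => //= u /= su ltsu; apply: eA; last by rewrite /= ltr_expR.
  exact: eP.
pose HC := isCumulative.Build R _ R H Hnd Hrc.
pose F : cumulative R R := HB.pack H HC.
have mexp : measurable_fun [set: RR] (expR : RR -> RR) by exact: measurable_expR.
pose m : {measure set RR -> \bar R} :=
  measure_function_pushforward__canonical__measure_function_Measure
    (lebesgue_stieltjes_measure F) mexp.
exists m => a b a0 ab; have b0 := lt_le_trans a0 ab.
have -> : m `]a, b]%classic = lebesgue_stieltjes_measure F `]ln a, ln b]%classic.
  congr (lebesgue_stieltjes_measure F _); apply/seteqP.
  have la x : (ln a < x)%R = (a < expR x)%R by rewrite -ltr_expR lnK.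
  have lb x : (x <= ln b)%R = (expR x <= b)%R by rewrite -ler_expR lnK.
  by split=> x /=; rewrite !in_itv/= la lb.
rewrite lebesgue_stieltjes_itvoc ?ler_ln// /F/= /H EFinB.
by rewrite !lnK// !fineK// Gfin.
Qed.

End stieltjes.

(* Main.v *)
Require Import Defs.
From HB Require Import structures.
From mathcomp Require Import all_boot all_order all_algebra.
From mathcomp Require Import all_classical all_reals all_analysis.
From mathcomp Require Import measurable_realfun.
From mathcomp Require Import ring lra.

(* Write [W t] for the norm of omega_1 over ]0, t[ and [tl t] for that of omega_2
   over ]t, +oo[. Since V t * V x / (V t + V x) lies between min (V t) (V x) / 2 and
   min (V t) (V x), the right-hand sides are comparable with sup_s J(s) / W(s), where
   J(s) is sup_t (min (V t) (V s) * tl t) in case (i) and the L^rho norm of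
   t |-> min (V t) (V s) for the measure d(- tl^rho) in case (ii).

   Upper bound: choose radii x_0 > x_1 > ... at which W^theta1 halves. The norm of f
   outside balls controls the sum over the shells x_(j+1) <= |y| < x_j of the
   theta1-th powers of W(x_j) times the norm of f v_1 on the shell. By Hoelder's
   inequality on the shells, and along radii at which the integral of |f v_2|^p2 over
   the part of a shell inside a ball grows geometrically, the contribution of one
   shell is a discrete Hardy sum bounded by J(x_j). Jensen's inequality (p2 < theta2)
   and theta1 <= p2 allow the contributions of the shells to be added up.

   Lower bound: test functions that are constant, up to the profile giving equality in
   Hoelder's inequality, on shells at which V halves. In case (i) one shell is enough;
   in case (ii) the coefficients (V^(rho - r) * tl^rho)^(1/p1), r = p1 -> p2, recover
   the integral by Abel summation. *)

Set Implicit Arguments.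
Unset Strict Implicit.
Unset Printing Implicit Defensive.
Import Order.TTheory GRing.Theory Num.Theory.
Import numFieldNormedType.Exports.
Local Open Scope classical_set_scope.
Local Open Scope ring_scope.

(** * Monotone functions and Lebesgue measure on the line *)

(** A partition fixed in advance cannot see where [f] concentrates, so the upper bound uses two
    kinds of radii: those given by [omega1], which spend the hypothesis on [f], and, inside each
    shell, radii that depend on [f]. The discrete Hardy inequality is therefore needed along
    arbitrary decreasing radii. The embedding argument takes it as a hypothesis and is common to
    both ranges of [theta2]; only its derivation from J differs (c^e <= c for c <= 1 and e =
    [theta2 / p1] >= 1, or Hoelder's inequality with exponents [rho / theta2] and [p1 / theta2]).
    The weights in Jensen's inequality are N_j, the normalised shares of the shells in the norm of
    [f], of total at most 1. The Hardy bound on a shell is of order N_j^(theta2/theta1), hence at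
    most N_j^(theta2/p2) when [theta1 <= p2]; together with the factor N_j^(1 - theta2/p2) from
    Jensen's inequality this leaves N_j, which is summable. Balls enter only as a measurable
    increasing family of sets; the continuity of V replaces any statement about null spheres. *)

Lemma dyadic_sequence (R : realType) (g : R -> R) (T : R) : 0 < T ->
  (forall (t : R), 0 < t -> {for t, continuous g}) ->
  (forall (s t : R), 0 < s -> s <= t -> g s <= g t) ->
  (forall (e : R), 0 < e -> exists2 t : R, 0 < t & g t <= e) ->
  0 < g T ->
  exists x : nat -> R, [/\ x 0%N = T, forall k, 0 < x k,
    forall k, g (x k) = g T * 2^-1 ^+ k & forall k, x k.+1 <= x k].
Proof.
move=> T0 cg ndg g0 gT0.
have lev k : exists y, 0 < y /\ (y <= T /\ g y = g T * 2^-1 ^+ k).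
  have c0 : 0 < g T * 2^-1 ^+ k :> R by rewrite mulr_gt0// exprn_gt0// invr_gt0.
  have cT : g T * 2^-1 ^+ k <= g T :> R.
    by rewrite ler_piMr ?(ltW gT0)//; apply: exprn_ile1; rewrite ?invr_ge0// invf_le1// ler1n.
  have [t t0 gt] := g0 _ c0.
  (* When [t] lies beyond [T], monotonicity squeezes [g T] onto the required level, so [T] itself
     serves. *)
  have [tT|/ltW Tt] := leP t T; last first.
    exists T; split => //; split => //; apply/eqP; rewrite eq_le cT andbT.
    exact: le_trans (ndg _ _ T0 Tt) gt.
  have [||y] := @IVT R g t T (g T * 2^-1 ^+ k) tT.
  - apply: continuous_in_subspaceT => z; rewrite inE/= in_itv/= => /andP[tz _].
    by apply: cg; exact: lt_le_trans tz.
  - by rewrite ge_min gt/= le_max cT orbT.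
  rewrite in_itv/= => /andP[ty yT] gy; exists y; split => //.
  exact: lt_le_trans ty.
(* A level set may be a whole interval, so index 0 is assigned [T] by hand. For the same reason the
   order of the points is read off the strictly decreasing levels. *)
pose x k := if k is k'.+1 then sval (cid (lev k)) else T.
have xk k : 0 < x k /\ (x k <= T /\ g (x k) = g T * 2^-1 ^+ k).
  case: k => [|k]; first by rewrite /x expr0 mulr1.
  by rewrite /x; case: cid.
exists x; split => // k; [by case: (xk k)|by case: (xk k) => _ []|].
have [xk0 [_ gk]] := xk k; have [xk10 [_ gk1]] := xk k.+1.
rewrite leNgt; apply/negP => /ltW /(ndg _ _ xk0).
rewrite gk gk1 exprS mulrA ler_pM2r ?exprn_gt0 ?invr_gt0//.
by move=> h; lra.
Qed.

Section integral_extra.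
Context d (T : measurableType d) (R : realType).
Variable mu : {measure set T -> \bar R}.
Local Open Scope ereal_scope.

(** Continuity from below, phrased as the transfer of a bound, so that an exhaustion needs only a
    uniform estimate on its members. *)
Lemma integral_bigcup_le (F : (set T)^nat) (f : T -> \bar R) c :
  nondecreasing_seq F -> (forall i, measurable (F i)) ->
  measurable_fun (\bigcup_i F i) f -> (forall x, (\bigcup_i F i) x -> 0 <= f x) ->
  (forall i, \int[mu]_(x in F i) f x <= c) ->
  \int[mu]_(x in \bigcup_i F i) f x <= c.
Proof.
move=> ndF mF mf f0 Fc.
have h : \int[mu]_(x in F i) f x @[i --> \oo] --> \int[mu]_(x in \bigcup_i F i) f x.
  apply: ge0_nondecreasing_set_cvg_integral => //.
  - move=> i; apply: measurable_funS mf => //; first exact: bigcup_measurable.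
    exact: bigcup_sup.
  - by move=> i x Fx; apply: f0; exists i.
rewrite -(cvg_lim _ h)//; apply: lime_le; first by apply/cvg_ex; eexists; exact: h.
exact: nearW.
Qed.

End integral_extra.

Section leb_line.
Context {R : realType}.
Local Notation RR := (measurableTypeR R).
Local Notation LL := (leb_line R).
Local Open Scope ereal_scope.

Lemma borel_leb_line (A : set R) :
  measurable (A : set RR) -> measurable (A : set LL).
Proof. by move=> mA; exact: sub_caratheodory. Qed.

Lemma leb_line_interval (A : set R) : is_interval A -> measurable (A : set LL).
Proof. by move=> iA; apply: borel_leb_line; exact: is_interval_measurable. Qed.

Lemma leb_line_itv (i : interval R) : measurable ([set` i] : set LL).
Proof. by apply: leb_line_interval; exact: interval_is_interval. Qed.


(** Preimages of rays are intervals. The Borel version serves Stieltjes integrals, the completed one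
    serves the norms. *)
Lemma monotone_measurable (D : set R) (f : R -> \bar R) : is_interval D ->
  (forall s t, D s -> D t -> (s <= t)%R -> f s <= f t) \/
  (forall s t, D s -> D t -> (s <= t)%R -> f t <= f s) ->
  measurable_fun (D : set RR) f /\ measurable_fun (D : set LL) f.
Proof.
move=> iD mono.
have key x : is_interval (D `&` f @^-1` `]x%:E, +oo[).
  move=> s t [Ds /= fs] [Dt /= ft] z /andP[sz zt]; have Dz : D z.
    by apply: (iD s t) => //; rewrite sz zt.
  split => //=; move: fs ft; rewrite !in_itv/= !andbT => fs ft.
  case: mono => mono; first by rewrite (lt_le_trans fs)// mono.
  by rewrite (lt_le_trans ft)// mono.
split; apply: (measurability _ (ErealGenOInfty.measurableE R)) => _ [_ [x ->] <-].
  exact: is_interval_measurable.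
exact: leb_line_interval.
Qed.

Lemma lebesgue1_set1 (x : R) : lebesgue1 R [set x] = 0.
Proof. exact: (@lebesgue_measure_set1 R x). Qed.

End leb_line.

(** * Head and tail integrals *)

Section primitive.
Context {R : realType}.
Local Notation LL := (leb_line R).
Local Notation mu1 := (lebesgue1 R).
Local Open Scope ereal_scope.
Variable psi : R -> \bar R.
Hypothesis mpsi : measurable_fun (`]0%R, +oo[%classic : set LL) psi.
Hypothesis psi0 : forall (t : R), (0 < t)%R -> 0 <= psi t.

Let sub_itv (x y x' y' : itv_bound R) : (x' <= x)%O -> (y <= y')%O ->
  [set` Interval x y] `<=` [set` Interval x' y'].
Proof.
move=> xx yy t /=; rewrite !itv_boundlr => /andP[h1 h2].
by rewrite (le_trans xx)// (le_trans h2).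
Qed.

Let sub_pos (x y : itv_bound R) : (BRight 0%R <= x)%O ->
  [set` Interval x y] `<=` `]0%R, +oo[%classic.
Proof.
move=> x0 t /= txy; apply: (sub_itv _ _ txy) => //.
exact: (le_trans _ (bound_lex1 y)).
Qed.

Lemma measurable_itv_sub (x y : itv_bound R) : (BRight 0%R <= x)%O ->
  measurable_fun ([set` Interval x y] : set LL) psi.
Proof.
by move=> x0; apply: measurable_funS mpsi; [exact: leb_line_itv|exact: sub_pos].
Qed.

Lemma itv_sub_ge0 (x y : itv_bound R) t : (BRight 0%R <= x)%O ->
  t \in Interval x y -> 0 <= psi t.
Proof.
move=> x0 txy; apply: psi0.
by have /= := sub_pos x0 txy; rewrite in_itv/= andbT.
Qed.

Lemma integral_itv_split (x y z : itv_bound R) : (BRight 0%R <= x)%O ->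
  (x <= y)%O -> (y <= z)%O ->
  \int[mu1]_(t in [set` Interval x z]) psi t =
  \int[mu1]_(t in [set` Interval x y]) psi t +
  \int[mu1]_(t in [set` Interval y z]) psi t.
Proof.
move=> x0 xy yz; rewrite (itv_bndbnd_setU xy yz).
rewrite ge0_integral_setU//; try exact: leb_line_itv.
- by rewrite -itv_bndbnd_setU//; exact: measurable_itv_sub.
- by move=> t; rewrite -itv_bndbnd_setU//; exact: itv_sub_ge0.
- apply/disj_setPS => t [/= h1 h2].
  move: h1 h2; rewrite !itv_boundlr => /andP[_ h1] /andP[h2 _].
  by have := le_trans h1 h2; rewrite bnd_simp ltxx.
Qed.

Lemma integral_itv_le (x y x' y' : itv_bound R) : (BRight 0%R <= x')%O ->
  (x' <= x)%O -> (y <= y')%O ->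
  \int[mu1]_(t in [set` Interval x y]) psi t <=
  \int[mu1]_(t in [set` Interval x' y']) psi t.
Proof.
move=> x0 xx yy; apply: ge0_subset_integral; try exact: leb_line_itv.
- exact: measurable_itv_sub.
- by move=> t; exact: itv_sub_ge0.
- exact: sub_itv.
Qed.

Lemma integral_shrink_lefty (a : R) c : (0 <= a)%R ->
  (forall (a' : R), (a < a')%R -> \int[mu1]_(t in `[a', +oo[) psi t <= c) ->
  \int[mu1]_(t in `]a, +oo[) psi t <= c.
Proof.
move=> a0 h; rewrite itvoyEbigcup; apply: integral_bigcup_le.
- move=> m n mn; apply/subsetPset; apply: sub_itv => //.
  by rewrite bnd_simp lerD2l lef_pV2 ?posrE// ler_nat.
- by move=> i; exact: leb_line_itv.
- by rewrite -itvoyEbigcup; exact: measurable_itv_sub.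
- by move=> t; rewrite -itvoyEbigcup; exact: itv_sub_ge0.
- by move=> n; apply: h; rewrite ltrDl.
Qed.

Lemma integral_shrink_left (a b : R) c : (0 <= a)%R ->
  (forall (a' : R), (a < a')%R -> \int[mu1]_(t in `[a', b[) psi t <= c) ->
  \int[mu1]_(t in `]a, b[) psi t <= c.
Proof.
move=> a0 h; rewrite itv_open_bnd_bigcup; apply: integral_bigcup_le.
- move=> m n mn; apply/subsetPset; apply: sub_itv => //.
  by rewrite bnd_simp lerD2l lef_pV2 ?posrE// ler_nat.
- by move=> i; exact: leb_line_itv.
- by rewrite -itv_open_bnd_bigcup; exact: measurable_itv_sub.
- by move=> t; rewrite -itv_open_bnd_bigcup; exact: itv_sub_ge0.
- by move=> n; apply: h; rewrite ltrDl.
Qed.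

Lemma integral_shrink_right (b : R) c :
  (forall (b' : R), (b' < b)%R -> \int[mu1]_(t in `]0%R, b']) psi t <= c) ->
  \int[mu1]_(t in `]0%R, b[) psi t <= c.
Proof.
move=> h; rewrite itv_bnd_open_bigcup; apply: integral_bigcup_le.
- move=> m n mn; apply/subsetPset; apply: sub_itv => //.
  by rewrite bnd_simp lerD2l lerN2 lef_pV2 ?posrE// ler_nat.
- by move=> i; exact: leb_line_itv.
- by rewrite -itv_bnd_open_bigcup; exact: measurable_itv_sub.
- by move=> t; rewrite -itv_bnd_open_bigcup; exact: itv_sub_ge0.
- by move=> n; apply: h; rewrite ltrBlDr ltrDl.
Qed.

(** Points are null; this is what yields the right continuity of [head]. *)
Lemma integral_itv_cbnd (a b : R) : (0 < a)%R ->
  \int[mu1]_(t in `[a, b[) psi t <= \int[mu1]_(t in `]a, b[) psi t.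
Proof.
move=> a0; have [ab|ba] := ltP a b; last by rewrite !set_itv_ge// bnd_simp -?leNgt.
rewrite (@integral_itv_split (BLeft a) (BRight a))//; last first.
  by rewrite bnd_simp.
rewrite set_itv1 (_ : \int[mu1]_(t in [set a]) psi t = 0) ?add0e//.
have m1 : measurable ([set a] : set LL) by rewrite -set_itv1; exact: leb_line_itv.
have mp : measurable_fun ([set a] : set LL) psi.
  by rewrite -set_itv1; exact: measurable_itv_sub.
rewrite -(@integral_abs_eq0 _ _ _ mu1 _ _ m1 mp (lebesgue1_set1 a)).
by apply: eq_integral => t; rewrite inE => /= ->; rewrite gee0_abs// psi0.
Qed.

Section head.
Hypothesis head_fin : forall (t : R), (0 < t)%R -> \int[mu1]_(t in `]0%R, t[) psi t < +oo.

Definition head t := fine (\int[mu1]_(t in `]0%R, t[) psi t).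

Lemma headE (t : R) : (0 < t)%R -> \int[mu1]_(t in `]0%R, t[) psi t = (head t)%:E.
Proof.
move=> t0; rewrite fineK// ge0_fin_numE ?head_fin//.
by apply: integral_ge0 => u; exact: itv_sub_ge0.
Qed.

Lemma head_ge0 (t : R) : (0 <= head t)%R.
Proof. by rewrite fine_ge0//; apply: integral_ge0 => u; exact: itv_sub_ge0. Qed.

Lemma head_split (s t : R) : (0 < s)%R -> (s <= t)%R ->
  \int[mu1]_(t in `[s, t[) psi t = (head t - head s)%:E.
Proof.
move=> s0 st; have t0 := lt_le_trans s0 st.
have := @integral_itv_split (BRight 0%R) (BLeft s) (BLeft t).
rewrite !bnd_simp !headE// => /(_ isT s0 st) ht.
have : \int[mu1]_(t in `[s, t[) psi t <= (head t)%:E.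
  by rewrite ht leeDr// lee_fin head_ge0.
have : 0 <= \int[mu1]_(t in `[s, t[) psi t.
  by apply: integral_ge0 => u; apply: itv_sub_ge0; rewrite bnd_simp.
case: (\int[mu1]_(t in `[s, t[) psi t) ht => [r ht _ _|//|//].
by case: ht => ->; congr EFin; lra.
Qed.

Lemma head_nd (s t : R) : (0 < s)%R -> (s <= t)%R -> (head s <= head t)%R.
Proof.
move=> s0 st; rewrite -subr_ge0 -lee_fin -head_split//.
by apply: integral_ge0 => u; apply: itv_sub_ge0; rewrite bnd_simp.
Qed.

(** If [head] stayed above [e], each [[a, 1[] would carry at most [head 1 - e], and so would their
    union []0, 1[], whose integral is [head 1]. *)
Lemma head_small (e : R) : (0 < e)%R -> exists2 t : R, (0 < t)%R & (head t <= e)%R.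
Proof.
move=> e0; have l01 : (0 < 1 :> R)%R by [].
apply: contrapT => nex.
have h t : (0 < t)%R -> (e < head t)%R.
  by move=> t0; rewrite ltNge; apply/negP => te; apply: nex; exists t.
have := @integral_shrink_left 0 1 (head 1 - e)%:E (lexx _).
rewrite headE// lee_fin => H.
suff : (head 1 <= head 1 - e)%R by lra.
apply: H => a a0; have [a1|a1] := leP a 1%R.
  by rewrite head_split// lee_fin; have := h _ a0; lra.
rewrite (@set_itv_ge _ _ (BLeft a)) ?bnd_simp -?leNgt ?(ltW a1)// integral_set0 lee_fin.
by have := h _ l01; lra.
Qed.

(** Monotone convergence on []0, b]] as b increases to t gives one side, and on [[a, t + 1[] as a
    decreases to t the other. Continuity is what allows radii at which [head] halves exactly. *)
Lemma head_continuous (t : R) : (0 < t)%R -> {for t, continuous head}.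
Proof.
move=> t0; apply/cvgrPdist_le => /= e e0.
have [b [b0 bt hb]] : exists b, [/\ (0 < b)%R, (b < t)%R & (head t - e <= head b)%R].
  apply: contrapT => nex.
  have h b : (0 < b)%R -> (b < t)%R -> (head b < head t - e)%R.
    by move=> b0 bt; rewrite ltNge; apply/negP => te; apply: nex; exists b.
  have := @integral_shrink_right t (head t - e)%:E.
  rewrite headE// lee_fin => H.
  suff : (head t <= head t - e)%R by lra.
  (* The second entry keeps [c] positive, since [b] may be negative. *)
  apply: H => b bt; pose c := Num.max ((b + t) / 2)%R (t / 2)%R.
  have c0 : (0 < c)%R by rewrite lt_max; apply/orP; right; lra.
  have ct : (c < t)%R by rewrite gt_max; apply/andP; split; lra.
  apply: (@le_trans _ _ (head c)%:E); last by rewrite lee_fin ltW// h.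
  by rewrite -headE//; apply: integral_itv_le; rewrite ?bnd_simp// lt_max; apply/orP; left; lra.
have [a [ta ha]] : exists a, (t < a)%R /\ (head a <= head t + e)%R.
  apply: contrapT => nex.
  have h a : (t < a)%R -> (head t + e < head a)%R.
    by move=> ta; rewrite ltNge; apply/negP => te; apply: nex; exists a.
  have := @integral_shrink_left t (t + 1) (head (t + 1) - head t - e)%:E (ltW t0).
  have tt1 : (t < t + 1)%R by rewrite ltrDl.
  move=> H; suff : (head (t + 1) - head t <= head (t + 1) - head t - e)%R by lra.
  rewrite -lee_fin -head_split ?(ltW tt1)//.
  apply: (le_trans (integral_itv_cbnd _ t0)); apply: H => a ta.
  have [a1|a1] := leP a (t + 1)%R.
    rewrite head_split//; last exact: lt_trans ta.
    by rewrite lee_fin; have := h _ ta; lra.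
  rewrite (@set_itv_ge _ _ (BLeft a)) ?bnd_simp -?leNgt ?(ltW a1)// integral_set0 lee_fin.
  by have := h _ tt1; lra.
near=> s.
have bs : (b < s)%R by near: s; exact: lt_nbhsr.
have sa : (s < a)%R by near: s; exact: lt_nbhsl.
have h1 := head_nd b0 (ltW bs).
have h2 := head_nd (lt_trans b0 bs) (ltW sa).
by rewrite ler_norml; lra.
Unshelve. all: by end_near. Qed.

End head.

Section tail.
Hypothesis tail_fin : forall (t : R), (0 < t)%R -> \int[mu1]_(t in `]t, +oo[) psi t < +oo.

Definition tailr t := fine (\int[mu1]_(t in `]t, +oo[) psi t).

Lemma tailrE (t : R) : (0 < t)%R -> \int[mu1]_(t in `]t, +oo[) psi t = (tailr t)%:E.
Proof.
move=> t0; rewrite fineK// ge0_fin_numE ?tail_fin//.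
by apply: integral_ge0 => u; apply: itv_sub_ge0; rewrite bnd_simp ltW.
Qed.

Lemma tailr_ge0 (t : R) : (0 < t)%R -> (0 <= tailr t)%R.
Proof.
move=> t0; rewrite fine_ge0//; apply: integral_ge0 => u.
by apply: itv_sub_ge0; rewrite bnd_simp ltW.
Qed.

Lemma tailr_split (s t : R) : (0 < s)%R -> (s <= t)%R ->
  \int[mu1]_(t in `]s, t]) psi t = (tailr s - tailr t)%:E.
Proof.
move=> s0 st; have t0 := lt_le_trans s0 st.
have := @integral_itv_split (BRight s) (BRight t) +oo%O.
rewrite !bnd_simp !tailrE// => /(_ (ltW s0) st isT) ht.
have : \int[mu1]_(t in `]s, t]) psi t <= (tailr s)%:E.
  by rewrite ht leeDl// lee_fin tailr_ge0.
have : 0 <= \int[mu1]_(t in `]s, t]) psi t.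
  by apply: integral_ge0 => u; apply: itv_sub_ge0; rewrite bnd_simp ltW.
case: (\int[mu1]_(t in `]s, t]) psi t) ht => [r ht _ _|//|//].
by case: ht => ->; congr EFin; lra.
Qed.

Lemma tailr_ni (s t : R) : (0 < s)%R -> (s <= t)%R -> (tailr t <= tailr s)%R.
Proof.
move=> s0 st; rewrite -subr_ge0 -lee_fin -tailr_split//.
by apply: integral_ge0 => u; apply: itv_sub_ge0; rewrite bnd_simp ltW.
Qed.

(** One side is enough: right continuity is the regularity required for attaching a Stieltjes
    measure to minus a power of the tail. *)
Lemma tailr_right_continuous (t : R) : (0 < t)%R -> tailr s @[s --> t^'+] --> tailr t.
Proof.
move=> t0; apply/cvgrPdist_le => /= e e0.
have [a [ta ha]] : exists a, (t < a)%R /\ (tailr t - e <= tailr a)%R.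
  apply: contrapT => nex.
  have h a : (t < a)%R -> (tailr a < tailr t - e)%R.
    by move=> ta; rewrite ltNge; apply/negP => te; apply: nex; exists a.
  have := @integral_shrink_lefty t (tailr t - e)%:E (ltW t0).
  rewrite tailrE// lee_fin => H.
  suff : (tailr t <= tailr t - e)%R by lra.
  apply: H => a ta; have tta : (t < (t + a) / 2)%R by lra.
  apply: (@le_trans _ _ (tailr ((t + a) / 2))%:E); last by rewrite lee_fin ltW// h.
  rewrite -tailrE; last exact: lt_trans tta.
  by apply: integral_itv_le; rewrite ?bnd_simp; lra.
near=> s.
have ts : (t < s)%R by near: s; exact: nbhs_right_gt.
have sa : (s < a)%R by near: s; exact: nbhs_right_lt.
have h1 := tailr_ni t0 (ltW ts).
have h2 := tailr_ni (lt_trans t0 ts) (ltW sa).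
by rewrite ler_norml; lra.
Unshelve. all: by end_near. Qed.

End tail.
End primitive.

(** * Upper bound over shells *)

(** Young's inequality bounds g_k s^(q-1) by g_k^q / q + s^q / q', where s is the weighted sum;
    summing and absorbing the s^q term gives the claim. Total weight at most 1 suffices for the
    absorption. *)
Lemma jensen_powR (R : realType) (q : R) (n : nat) (w g : nat -> R) : 1 < q ->
  (forall k, 0 <= w k) -> (forall k, 0 <= g k) -> \sum_(k < n) w k <= 1 ->
  (\sum_(k < n) w k * g k) `^ q <= \sum_(k < n) w k * g k `^ q.
Proof.
move=> q1 w0 g0 sw; have q0 : 0 < q by rewrite (lt_trans _ q1).
set s := \sum_(k < n) w k * g k.
have s0 : 0 <= s by apply: sumr_ge0 => k _; rewrite mulr_ge0.
pose q' := q / (q - 1).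
have q'0 : 0 < q' by rewrite divr_gt0// subr_gt0.
have qq' : q^-1 + q'^-1 = 1.
  by rewrite /q' invf_div -{1}(div1r q) -mulrDl subrKC mulfV// gt_eqF.
have young k : w k * (g k * s `^ (q - 1)) <= w k * (g k `^ q / q) + w k * (s `^ q / q').
  rewrite -mulrDr; apply: ler_wpM2l => //.
  have -> : s `^ q = (s `^ (q - 1)) `^ q'.
    by rewrite -powRrM /q' mulrCA mulfV ?mulr1// gt_eqF// subr_gt0.
  by apply: conjugate_powR => //; rewrite powR_ge0.
have : s * s `^ (q - 1) <= (\sum_(k < n) w k * g k `^ q) / q + s `^ q / q'.
  rewrite {1}/s mulr_suml; under eq_bigr do rewrite -mulrA.
  apply: (@le_trans _ _ (\sum_(k < n) (w k * (g k `^ q / q) + w k * (s `^ q / q')))).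
    by apply: ler_sum => k _; exact: young.
  rewrite big_split/= -[X in _ + X <= _]mulr_suml; apply: lerD.
    by rewrite [leRHS]mulr_suml; apply: ler_sum => k _; rewrite mulrA.
  by rewrite ler_piMl// divr_ge0 ?powR_ge0// ltW.
rewrite mulr_powRB1// -lerBlDr -{1}(mulr1 (s `^ q)) -mulrBr.
have -> : 1 - q'^-1 = q^-1 by rewrite -qq' addrK.
by rewrite ler_pM2r ?invr_gt0.
Qed.

(** The factor may be infinite, as a value of [psi2] can be; integration against the counting
    measure covers this case. *)
Lemma nneseries_mulel (R : realType) (c : \bar R) (f : nat -> \bar R) :
  (0 <= c)%E -> (forall k, 0 <= f k)%E ->
  (\sum_(0 <= k <oo) c * f k = c * \sum_(0 <= k <oo) f k)%E.
Proof.
move=> c0 f0; rewrite -!ge0_integral_count//; last by move=> k; rewrite mule_ge0.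
exact: ge0_integralZl.
Qed.

Lemma ler_powR_base (R : realType) (r x y : R) : 0 <= r ->
  0 <= x -> x <= y -> x `^ r <= y `^ r.
Proof.
by move=> r0 x0 xy; apply: ge0_ler_powR => //; rewrite nnegrE// (le_trans x0).
Qed.

Lemma lee_poweR (R : realType) (r : R) (x y : \bar R) : 0 <= r ->
  (0 <= x -> x <= y -> x `^ r <= y `^ r)%E.
Proof.
move=> r0 x0 xy; apply: gt0_ler_poweR => //; rewrite in_itv/= leey andbT//.
exact: le_trans xy.
Qed.

Lemma continuous_powR (R : realType) (f : R -> R) (r t : R) : 0 < f t ->
  {for t, continuous f} -> (f s `^ r) @[s --> t] --> f t `^ r.
Proof.
move=> ft0 cf; have cp : {for f t, continuous (@powR R ^~ r)}.
  apply: differentiable_continuous; apply/derivable1_diffP.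
  by apply: derivable_powR; rewrite in_itv/= ft0.
exact: (@cvg_comp _ _ _ f (@powR R ^~ r) _ _ _ cf cp).
Qed.

(** * Masses carried by an increasing family of sets *)

Section ball_family.
Context d (S : measurableType d) (R : realType).
Variables (m : {measure set S -> \bar R}) (B : R -> set S).
Hypothesis mB : forall t, measurable (B t).
Hypothesis ndB : forall s t, s <= t -> B s `<=` B t.
Local Open Scope ereal_scope.

Section mass.
Variables (D : set S) (g : S -> \bar R).
Hypothesis mD : measurable D.
Hypothesis mg : measurable_fun setT g.
Hypothesis g0 : forall y, 0 <= g y.

Let mgE E : measurable_fun E g.
Proof. exact: measurable_funTS. Qed.

Lemma mass_split s t : (s <= t)%R ->
  \int[m]_(y in B t `&` D) g y =
  \int[m]_(y in B s `&` D) g y + \int[m]_(y in (B t `\` B s) `&` D) g y.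
Proof.
move=> st; rewrite -ge0_integral_setU//.
- congr (integral _ _ _); rewrite -setIUl; congr (_ `&` _).
  by rewrite setDUK//; exact: ndB.
- by apply: measurableI => //; exact: mB.
- by apply: measurableI => //; apply: measurableD; exact: mB.
- by apply/disj_setPS => y [[Bs _] [[_ nBs] _]].
Qed.

Hypothesis fin_g : \int[m]_(y in D) g y < +oo.

Definition mass t := fine (\int[m]_(y in B t `&` D) g y).

Lemma mass_lty E : measurable E -> E `<=` D -> \int[m]_(y in E) g y < +oo.
Proof. by move=> mE ED; apply: le_lt_trans fin_g; exact: ge0_subset_integral. Qed.

Lemma massE t : \int[m]_(y in B t `&` D) g y = (mass t)%:E.
Proof.
rewrite fineK// ge0_fin_numE ?integral_ge0//; apply: mass_lty; last exact: subIsetr.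
by apply: measurableI => //; exact: mB.
Qed.

Lemma mass_ge0 (t : R) : (0 <= mass t)%R.
Proof. by rewrite fine_ge0// integral_ge0. Qed.

Lemma mass_shell s t : (s <= t)%R ->
  \int[m]_(y in (B t `\` B s) `&` D) g y = (mass t - mass s)%:E.
Proof.
move=> /mass_split; rewrite !massE.
have : 0 <= \int[m]_(y in (B t `\` B s) `&` D) g y by rewrite integral_ge0.
have : \int[m]_(y in (B t `\` B s) `&` D) g y < +oo.
  apply: mass_lty; last exact: subIsetr.
  by apply: measurableI => //; apply: measurableD; exact: mB.
case: (\int[m]_(y in _) g y) => // z _ _ [->]; congr EFin; by rewrite addrAC subrr add0r.
Qed.

Lemma mass_nd s t : (s <= t)%R -> (mass s <= mass t)%R.
Proof.
by move=> st; rewrite -subr_ge0 -lee_fin -mass_shell// integral_ge0.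
Qed.

Lemma mass_le t : (mass t <= fine (\int[m]_(y in D) g y))%R.
Proof.
rewrite -lee_fin -massE fineK; last by rewrite ge0_fin_numE// integral_ge0.
by apply: ge0_subset_integral => //; apply: measurableI => //; exact: mB.
Qed.

End mass.
End ball_family.

(** * Hardy inequality on one shell *)

Section hardy_block.
Context d (S : measurableType d) (R : realType).
Variables (m : {measure set S -> \bar R}) (B : R -> set S).
Hypothesis mB : forall t, measurable (B t).
Hypothesis ndB : forall s t, s <= t -> B s `<=` B t.
(** In the application these are |f v1|^p1, |f v2|^p2 and |v2 / v1|^r with 1/r = 1/p2 - 1/p1, and
    the exponents are [al = p2 / r] and [be = p2 / p1]. *)
Variables (a b u : S -> \bar R).
Hypotheses (ma : measurable_fun setT a) (mb : measurable_fun setT b)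
  (mu : measurable_fun setT u).
Hypotheses (a0 : forall y, (0 <= a y)%E) (b0 : forall y, (0 <= b y)%E)
  (u0 : forall y, (0 <= u y)%E).
Variables (al be r : R).
Hypotheses (al0 : 0 < al) (be0 : 0 < be) (r0 : 0 < r).
Hypothesis hoelder_b : forall E, measurable E ->
  (\int[m]_(y in E) b y <=
   (\int[m]_(y in E) u y) `^ al * (\int[m]_(y in E) a y) `^ be)%E.
Variable V : R -> R.
Hypothesis VE : forall t : R, 0 < t -> (\int[m]_(y in B t) u y = (V t `^ r)%:E)%E.
Hypothesis V0 : forall t : R, 0 < t -> 0 < V t.
Hypothesis ndV : forall s t : R, 0 < s -> s <= t -> V s <= V t.
Hypothesis cV : forall t : R, 0 < t -> {for t, continuous V}.
Hypothesis V_small : forall e : R, 0 < e -> exists2 t : R, 0 < t & V t <= e.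

Lemma hoelder_le E (x y : R) : measurable E ->
  (\int[m]_(z in E) u z <= x%:E)%E -> (\int[m]_(z in E) a z <= y%:E)%E ->
  (\int[m]_(z in E) b z <= (x `^ al * y `^ be)%:E)%E.
Proof.
move=> mE ux ay; apply: (le_trans (hoelder_b mE)).
rewrite EFinM -!poweR_EFin; apply: lee_pmul; rewrite ?poweR_ge0//;
  by apply: lee_poweR; rewrite ?integral_ge0// ltW.
Qed.

Lemma volume_shell (s t : R) : 0 < s -> s <= t ->
  (\int[m]_(y in B t `\` B s) u y = (V t `^ r - V s `^ r)%:E)%E.
Proof.
move=> s0 st; have t0 := lt_le_trans s0 st.
have := mass_split m mB ndB measurableT mu u0 st.
rewrite !setIT !VE//.
have : (0 <= \int[m]_(y in B t `\` B s) u y)%E by rewrite integral_ge0.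
have : (\int[m]_(y in B t `\` B s) u y < +oo)%E.
  apply: (@le_lt_trans _ _ (\int[m]_(y in B t) u y)%E); last by rewrite VE ?ltry.
  by apply: ge0_subset_integral => //; [exact: measurableD|exact: measurable_funTS].
case: (\int[m]_(y in _) u y)%E => // z _ _ [->]; congr EFin; by rewrite addrAC subrr add0r.
Qed.

Section block.
Variables (D : set S) (x : R).
Hypothesis (mD : measurable D) (x0 : 0 < x) (Dx : D `<=` B x).
Variable A : R.
Hypothesis AE : (\int[m]_(y in D) a y = A%:E)%E.

Local Notation h := (mass m B D b).

Let A_ge0 : 0 <= A. Proof. by rewrite -lee_fin -AE integral_ge0. Qed.

Let sub_le (f : S -> \bar R) E F : measurable_fun setT f -> (forall y, 0 <= f y)%E ->
  measurable E -> measurable F -> E `<=` F ->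
  (\int[m]_(y in E) f y <= \int[m]_(y in F) f y)%E.
Proof.
by move=> mf f0 mE mF EF; apply: ge0_subset_integral => //; exact: measurable_funTS.
Qed.

Lemma block_lty : (\int[m]_(y in D) b y < +oo)%E.
Proof.
apply: (@le_lt_trans _ _ ((V x `^ r) `^ al * A `^ be)%:E); last by rewrite ltry.
by apply: hoelder_le; rewrite ?AE// -VE//; exact: sub_le.
Qed.

Let mBI t : measurable (B t `&` D).
Proof. by apply: measurableI => //; exact: mB. Qed.

Lemma block_mass_le (t : R) : 0 < t -> h t <= (V t `^ r) `^ al * A `^ be.
Proof.
move=> t0; rewrite -lee_fin -massE//; last exact: block_lty.
apply: hoelder_le => //; first by rewrite -VE//; exact: sub_le.
by rewrite -AE; exact: sub_le.
Qed.

Lemma block_mass_shell (s t : R) : 0 < s -> s <= t ->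
  h t - h s <= (V t `^ r - V s `^ r) `^ al * A `^ be.
Proof.
move=> s0 st; rewrite -lee_fin -mass_shell//; last exact: block_lty.
have mBD : measurable ((B t `\` B s) `&` D).
  by apply: measurableI => //; apply: measurableD; exact: mB.
apply: hoelder_le => //.
- by rewrite -volume_shell//; apply: sub_le => //; exact: measurableD.
- by rewrite -AE; exact: sub_le.
Qed.

Let modulus (e : R) : 0 < e ->
  exists2 c : R, 0 < c & forall z : R, 0 <= z <= c -> z `^ al * A `^ be <= e.
Proof.
(* The added 1 keeps the denominator positive when [A = 0]. *)
move=> e0; have A1 : 0 < A `^ be + 1 by rewrite ltr_wpDl// powR_ge0.
have c0 : 0 < e / (A `^ be + 1) by rewrite divr_gt0.
exists ((e / (A `^ be + 1)) `^ al^-1); first by rewrite powR_gt0.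
move=> z /andP[z0 zc]; apply: (@le_trans _ _ (e / (A `^ be + 1) * A `^ be)).
  rewrite ler_wpM2r ?powR_ge0//.
  apply: (le_trans (ler_powR_base (ltW al0) z0 zc)).
  by rewrite -powRrM mulVf ?gt_eqF// powRr1// ltW.
by rewrite mulrAC ler_pdivrMr// ler_pM2l// lerDl.
Qed.

(** Hoelder's inequality bounds increments of [h] by powers of increments of V^r, so [h] inherits
    the continuity of [V]. *)
Lemma block_mass_continuous (t : R) : 0 < t -> {for t, continuous h}.
Proof.
move=> t0; have bfin := block_lty.
apply/cvgrPdist_le => /= e e0.
have [e' e'0 he'] := modulus e0.
have key x1 y1 : 0 <= y1 - x1 <= e' -> (y1 - x1) `^ al * A `^ be <= e.
  exact: he'.
have cM := @continuous_powR _ V r t (V0 t0) (cV t0).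
have mM s s' : 0 < s -> s <= s' -> V s `^ r <= V s' `^ r.
  move=> s0 ss; have s'0 := lt_le_trans s0 ss.
  by apply: ler_powR_base; [exact: ltW|exact/ltW/V0|exact: ndV].
near=> s.
have s0 : 0 < s by near: s; exact: lt_nbhsr.
have Ms : `|V t `^ r - V s `^ r| <= e'.
  by near: s; move/cvgrPdist_le : cM; exact.
have [st|/ltW ts] := leP s t.
  rewrite ger0_norm ?subr_ge0 ?mass_nd//.
  apply: (le_trans (block_mass_shell s0 st)); apply: key.
  by rewrite subr_ge0 mM//= (le_trans _ Ms)// ler_norm.
rewrite distrC ger0_norm ?subr_ge0 ?mass_nd//.
apply: (le_trans (block_mass_shell t0 ts)); apply: key.
by rewrite subr_ge0 mM//= (le_trans _ Ms)// distrC ler_norm.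
Unshelve. all: by end_near. Qed.

Lemma block_mass_small (e : R) : 0 < e -> exists2 t : R, 0 < t & h t <= e.
Proof.
move=> e0; have [c c0 hc] := modulus e0.
have [|t t0 Vt] := @V_small (c `^ r^-1); first by rewrite powR_gt0.
exists t => //; apply: (le_trans (block_mass_le t0)); apply: hc.
rewrite powR_ge0/=; apply: (le_trans (ler_powR_base (ltW r0) (ltW (V0 t0)) Vt)).
by rewrite -powRrM mulVf ?gt_eqF// powRr1// ltW.
Qed.

(** The part of [D] between the two radii lies in [B t] and also in [B x]; the smaller of the two
    volumes produces the minimum. *)
Lemma block_mass_dyadic (s t : R) : 0 < s -> s <= t ->
  h t - h s <= (Num.min (V t) (V x) `^ r) `^ al *
    (mass m B D a t - mass m B D a s) `^ be.
Proof.
move=> s0 st; have t0 := lt_le_trans s0 st.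
have fina : (\int[m]_(y in D) a y < +oo)%E by rewrite AE ltry.
rewrite -lee_fin -mass_shell//; last exact: block_lty.
have mBs : measurable (B t `\` B s) by apply: measurableD; exact: mB.
have mBD : measurable ((B t `\` B s) `&` D) by apply: measurableI.
apply: hoelder_le => //; last by rewrite -mass_shell.
rewrite minEle; case: ifPn => _; rewrite -VE//; apply: sub_le => //.
- by move=> y [[]].
- by move=> y [_ Dy]; exact: Dx.
Qed.

Section weight.
Variable psi : R -> \bar R.
Hypothesis mpsi : measurable_fun (`]0%R, +oo[%classic : set (leb_line R)) psi.
Hypothesis psi0 : forall t : R, 0 < t -> (0 <= psi t)%E.
Hypothesis tail_fin : forall t : R, 0 < t ->
  (\int[lebesgue1 R]_(s in `]t, +oo[) psi s < +oo)%E.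
Variables (q T K : R).
Hypotheses (q0 : 0 < q) (xT : x <= T) (K0 : 0 <= K).
Local Notation tau := (tailr psi).

(* The shells carry masses [c k] of total at most one; [K] bounds the resulting
   discrete Hardy sums. *)
Hypothesis discrete_hardy : forall (t c : nat -> R) (N : nat),
  (forall k, 0 < t k) -> (forall k, t k.+1 <= t k) -> (forall k, 0 <= c k) ->
  \sum_(k < N) c k <= 1 ->
  \sum_(k < N) (tau (t k.+1) - tau (t k)) *
    (Num.min (V (t k.+1)) (V x) `^ (r * al * q) * c k `^ (be * q)) <= K.

Let f t := (psi t * (h t `^ q)%:E)%E.

Let bfin := block_lty.
Let h_nd := mass_nd mB ndB mD mb b0 bfin.
Let h0 (t : R) : 0 <= h t. Proof. exact: mass_ge0. Qed.

Let mf : measurable_fun (`]0%R, +oo[%classic : set (leb_line R)) f.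
Proof.
apply: emeasurable_funM; first exact: mpsi.
apply: (monotone_measurable _ _).2; first exact: interval_is_interval.
by left => s t _ _ st; rewrite lee_fin ler_powR_base ?(ltW q0) ?h0// h_nd.
Qed.

Let f0 (t : R) : 0 < t -> (0 <= f t)%E.
Proof. by move=> t0; rewrite mule_ge0 ?psi0// lee_fin powR_ge0. Qed.

Let step (s t : R) : 0 < s -> s <= t ->
  (\int[lebesgue1 R]_(z in `]s, t]) f z <=
   ((tau s - tau t) * h t `^ q)%:E)%E.
Proof.
move=> s0 st; have B0s : (BRight 0 <= BRight s)%O by rewrite bnd_simp ltW.
rewrite EFinM -(tailr_split mpsi psi0 tail_fin s0 st).
have mp := @measurable_itv_sub _ psi mpsi (BRight s) (BRight t) B0s.
have p0 z : `]s, t]%classic z -> (0 <= psi z)%E by exact: (itv_sub_ge0 psi0).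
have k0 : (0 <= (h t `^ q)%:E)%E by rewrite lee_fin powR_ge0.
rewrite -(@ge0_integralZr _ _ _ (lebesgue1 R) _ (leb_line_itv _) _ mp _ p0 k0).
apply: ge0_le_integral.
- exact: leb_line_itv.
- by move=> z; exact: (itv_sub_ge0 f0).
- exact: (measurable_itv_sub mf).
- exact: emeasurable_funM.
move=> z zst; apply: lee_wpmul2l; first exact: (itv_sub_ge0 psi0 _ zst).
rewrite lee_fin ler_powR_base ?(ltW q0) ?h0// h_nd//.
by move: zst; rewrite /= in_itv/= => /andP[].
Qed.

(** Take radii t_k, starting at [T], at which [h] halves. On []t_(k+1), t_k]] the function [h] is at
    most h(t_k), which is a multiple of the increment of [h] between t_(k+2) and t_(k+1). Hoelder's
    inequality applies to that increment, and [c k] is the fraction of [A] found there. *)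
Lemma hardy_block :
  (\int[lebesgue1 R]_(t in `]0%R, T]) (psi t * (h t `^ q)%:E) <=
   (4 `^ q * K * A `^ (be * q))%:E)%E.
Proof.
have T0 := lt_le_trans x0 xT.
have rhs0 : 0 <= 4 `^ q * K * A `^ (be * q) by rewrite !mulr_ge0 ?powR_ge0.
have [hT0|hT] := eqVneq (h T) 0.
  rewrite integral0_eq ?lee_fin// => t; rewrite /= in_itv/= => /andP[t0 tT].
  have -> : h t = 0 by apply/eqP; rewrite eq_le h0 -{1}hT0 h_nd.
  by rewrite powR0 ?gt_eqF// mule0.
have {}hT : 0 < h T by rewrite lt_neqAle eq_sym hT h0.
have A0 : 0 < A.
  rewrite lt_neqAle A_ge0 andbT; apply/eqP => A0; move: hT.
  by rewrite ltNge (le_trans (block_mass_le T0))// -A0 powR0 ?gt_eqF// mulr0.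
have [tk [tk0 tkpos htk tkS]] := dyadic_sequence T0 block_mass_continuous
  (fun s t _ => @h_nd s t) block_mass_small hT.
have tkT n : tk n <= T.
  by elim: n => [|n]; [rewrite tk0|exact: le_trans].
pose F n := `]tk n, T]%classic.
(* The radii need not tend to 0, because [h] may vanish near 0. What is left below all of them is a
   set on which [h] is 0. *)
pose U := \bigcup_n F n.
have mU : measurable (U : set (leb_line R)).
  by apply: bigcup_measurable => n _; exact: leb_line_itv.
have UT : `]0, T]%classic = U `|` (`]0, T]%classic `\` U).
  rewrite setDE setUIr setUCr setIT; apply/seteqP; split; first exact: subsetUr.
  move=> t [|//] [n _] /=; rewrite /F /= !in_itv/= => /andP[+ ->].
  by rewrite andbT; exact: lt_trans.
have mfT : measurable_fun (`]0, T]%classic : set (leb_line R)) f.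
  exact: (measurable_itv_sub mf).
have mUc : measurable (`]0, T]%classic `\` U : set (leb_line R)).
  by apply: measurableD; [exact: leb_line_itv|exact: mU].
have dUc : [disjoint U & `]0, T]%classic `\` U].
  by apply/disj_setPS => t [Ut [_]].
have f0T t : `]0, T]%classic t -> (0 <= f t)%E by exact: (itv_sub_ge0 f0).
rewrite UT in mfT f0T; rewrite [X in integral _ X]UT.
rewrite (ge0_integral_setU (lebesgue1 R) mU mUc mfT f0T dUc).
rewrite [X in (_ + X)%E](integral0_eq); last first.
  move=> t [/=]; rewrite in_itv/= => /andP[t0 tT] nU.
  suff ht : h t = 0 by rewrite /f ht powR0 ?gt_eqF// mule0.
  apply/eqP; rewrite eq_le h0 andbT; apply/ler_addgt0Pr => e e0; rewrite add0r.
  have /cvgrPdist_le/(_ _ e0)[N _ /(_ N (leqnn _))] :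
      (h T * 2^-1 ^+ n) @[n --> \oo] --> 0.
    rewrite -[X in _ --> X](mulr0 (h T)); apply: cvgMr.
    by apply: cvg_expr; rewrite ger0_norm ?invr_ge0// invf_lt1// ltr1n.
  rewrite sub0r normrN ger0_norm ?mulr_ge0 ?exprn_ge0 ?invr_ge0//.
  apply: le_trans; rewrite -htk; apply: h_nd; rewrite leNgt; apply/negP => tt.
  by apply: nU; exists N => //; rewrite /F /= in_itv/= tt.
rewrite adde0; apply: integral_bigcup_le.
- move=> i j ij; apply/subsetPset => t; rewrite /F /= !in_itv/= => /andP[+ ->].
  rewrite andbT; apply: le_lt_trans.
  by apply/nonincreasing_seqP: i j ij.
- by move=> n; exact: leb_line_itv.
- by apply: measurable_funS mfT; [rewrite -UT; exact: leb_line_itv|exact: subsetUl].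
- by move=> t Ut; apply: f0T; left.
move=> n.
apply: (@le_trans _ _ (\sum_(k < n) (tau (tk k.+1) - tau (tk k)) * h (tk k) `^ q)%:E).
  elim: n => [|n ih].
    by rewrite big_ord0 /F tk0 set_itvoc0 integral_set0.
  rewrite big_ord_recr/= EFinD addeC /F.
  rewrite (@integral_itv_split _ f mf f0 (BRight (tk n.+1)) (BRight (tk n)));
    rewrite ?bnd_simp ?(ltW (tkpos _))//.
  by apply: leeD => //; exact: step.
rewrite lee_fin.
pose ga := mass m B D a.
have fina : (\int[m]_(y in D) a y < +oo)%E by rewrite AE ltry.
have ga_nd := mass_nd mB ndB mD ma a0 fina.
pose c k := (ga (tk k.+1) - ga (tk k.+2)) / A.
have c0 k : 0 <= c k by rewrite divr_ge0// subr_ge0 ga_nd.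
have csum : \sum_(k < n) c k <= 1.
  rewrite -mulr_suml ler_pdivrMr// mul1r.
  have -> : \sum_(k < n) (ga (tk k.+1) - ga (tk k.+2)) = ga (tk 1%N) - ga (tk n.+1).
    elim: n => [|n ih]; first by rewrite big_ord0 subrr.
    by rewrite big_ord_recr/= ih addrA subrK.
  have : ga (tk 1%N) <= A by have := mass_le mB mD ma a0 fina (tk 1%N); rewrite AE.
  by apply: le_trans; rewrite gerBl// mass_ge0.
have := discrete_hardy tkpos tkS c0 csum.
move=> /(ler_wpM2l (mulr_ge0 (powR_ge0 4 q) (powR_ge0 A (be * q)))) H.
apply: (@le_trans _ _ (4 `^ q * A `^ (be * q) * K)); last first.
  by rewrite mulrAC.
apply: le_trans H; rewrite mulr_sumr; apply: ler_sum => k _.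
rewrite mulrCA; apply: ler_wpM2l.
  by rewrite subr_ge0; exact: (tailr_ni mpsi psi0 tail_fin).
(* The increment is taken one step lower than seems necessary. The increment between [tk k.+1] and
   [tk k] would bring in [V (tk k)], whereas the discrete sum pairs [tau (tk k.+1)] with
   [V (tk k.+1)]. The price is 4 instead of 2. *)
have -> : h (tk k) = 4 * (h (tk k.+1) - h (tk k.+2)).
  rewrite !htk -mulrBr mulrCA; congr (_ * _); rewrite !exprS; lra.
have Ak : ga (tk k.+1) - ga (tk k.+2) = c k * A by rewrite /c divfK ?gt_eqF.
have Vm : 0 <= Num.min (V (tk k.+1)) (V x) by rewrite le_min !ltW ?V0.
rewrite powRM ?subr_ge0 ?h_nd// -(mulrA (4 `^ q)); apply: ler_wpM2l; first exact: powR_ge0.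
have hk := block_mass_dyadic (tkpos k.+2) (tkS k.+1).
have hk0 : 0 <= h (tk k.+1) - h (tk k.+2) by rewrite subr_ge0 h_nd.
apply: (le_trans (ler_powR_base (ltW q0) hk0 hk)).
rewrite -/ga Ak powRM ?powR_ge0// -!powRrM powRM ?(ltW A0)//.
by rewrite (mulrA r) mulrA mulrC.
Qed.
End weight.

End block.

(** * Summation of the shell estimates *)

Section embedding.
(** In the application [psi1] and [psi2] are omega1^theta1 and omega2^theta2, with [q = theta2 / p2]
    and [e1 = theta1 / p1], so that [be * q / e1] is [theta2 / theta1]. *)
Variables (psi1 psi2 : R -> \bar R).
Hypothesis mpsi1 : measurable_fun (`]0%R, +oo[%classic : set (leb_line R)) psi1.
Hypothesis psi1_0 : forall t : R, 0 < t -> (0 <= psi1 t)%E.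
Hypothesis head_fin : forall t : R, 0 < t ->
  (\int[lebesgue1 R]_(s in `]0%R, t[) psi1 s < +oo)%E.
Hypothesis mpsi2 : measurable_fun (`]0%R, +oo[%classic : set (leb_line R)) psi2.
Hypothesis psi2_0 : forall t : R, 0 < t -> (0 <= psi2 t)%E.
Hypothesis tail_fin : forall t : R, 0 < t ->
  (\int[lebesgue1 R]_(s in `]t, +oo[) psi2 s < +oo)%E.
Local Notation w := (head psi1).
Local Notation tau := (tailr psi2).
Hypothesis w0 : forall t : R, 0 < t -> 0 < w t.
Variables (q e1 C : R).
Hypotheses (q1 : 1 < q) (e1_0 : 0 < e1) (e1_be : e1 <= be) (C0 : 0 <= C).
Hypothesis discrete_hardy : forall (x : R) (t c : nat -> R) (N : nat), 0 < x ->
  (forall k, 0 < t k) -> (forall k, t k.+1 <= t k) -> (forall k, 0 <= c k) ->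
  \sum_(k < N) c k <= 1 ->
  \sum_(k < N) (tau (t k.+1) - tau (t k)) *
    (Num.min (V (t k.+1)) (V x) `^ (r * al * q) * c k `^ (be * q)) <=
  C * w x `^ (be * q / e1).
Variable X : R.
Hypothesis X0 : 0 < X.
Local Notation F t := (\int[m]_(y in ~` B t) a y)%E.
Hypothesis Ffin : forall t : R, 0 < t -> (F t < +oo)%E.
Hypothesis FX : (\int[lebesgue1 R]_(t in `]0%R, +oo[) (psi1 t * F t `^ e1) <= X%:E)%E.

Let q0 : 0 < q. Proof. exact: lt_trans q1. Qed.

Let F0 t : (0 <= F t)%E. Proof. exact: integral_ge0. Qed.

Let F_ni (s t : R) : s <= t -> (F t <= F s)%E.
Proof.
move=> st; apply: ge0_subset_integral => //.
- by apply: measurableC; exact: mB.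
- by apply: measurableC; exact: mB.
- exact: measurable_funTS.
- by apply: subsetC; exact: ndB.
Qed.

Let f1 t := (psi1 t * F t `^ e1)%E.

Let mf1 : measurable_fun (`]0%R, +oo[%classic : set (leb_line R)) f1.
Proof.
apply: emeasurable_funM; first exact: mpsi1.
apply: (monotone_measurable _ _).2; first exact: interval_is_interval.
by right => s t _ _ st; apply: lee_poweR; [exact: ltW|exact: F0|exact: F_ni].
Qed.

Let f1_0 (t : R) : 0 < t -> (0 <= f1 t)%E.
Proof. by move=> t0; rewrite mule_ge0 ?psi1_0// poweR_ge0. Qed.

Section fixed_T.
Variable T : R.
Hypothesis T0 : 0 < T.
Variable x : nat -> R.
Hypotheses (xT : x 0%N = T) (x0 : forall k, 0 < x k)
  (wx : forall k, w (x k) = w T * 2^-1 ^+ k) (xS : forall k, x k.+1 <= x k).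

Let D j := B (x j) `\` B (x j.+1).
Let A j := fine (\int[m]_(y in D j) a y)%E.
(** Share of shell j in the bound [X], used as a weight in Jensen's inequality. The 4 is the loss
    incurred in [head_sum]. *)
Let N j := w (x j) * A j `^ e1 / (4 * X).
Let h j := mass m B (D j) b.

Let mD j : measurable (D j).
Proof. by apply: measurableD; exact: mB. Qed.

Let DB j : D j `<=` B (x j). Proof. exact: subDsetl. Qed.

Let AF j : (\int[m]_(y in D j) a y <= F (x j.+1))%E.
Proof.
apply: ge0_subset_integral => //; first by apply: measurableC; exact: mB.
- exact: measurable_funTS.
- by move=> y [].
Qed.

Let AE j : (\int[m]_(y in D j) a y = (A j)%:E)%E.
Proof.
by rewrite fineK// ge0_fin_numE ?integral_ge0// (le_lt_trans (AF j))// Ffin.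
Qed.

Let A0 j : 0 <= A j. Proof. by rewrite -lee_fin -AE integral_ge0. Qed.

Let N0 j : 0 <= N j.
Proof. by rewrite divr_ge0 ?mulr_ge0 ?powR_ge0 ?(ltW X0)// ltW// w0. Qed.

Let bfin j := block_lty (mD j) (x0 j) (@DB j) (AE j).

Let h0 j t : 0 <= h j t. Proof. exact: mass_ge0. Qed.

(** For t in [[x_(j+2), x_(j+1)[] the complement of [B t] contains all of [D j], and [psi1]
    integrates there to w(x_(j+1)) - w(x_(j+2)) = w(x_j) / 4. *)
Let head_sum n : ((\sum_(j < n) w (x j) * A j `^ e1 / 4)%:E <=
  \int[lebesgue1 R]_(t in `[x n.+1, x 1%N[) f1 t)%E.
Proof.
elim: n => [|n ih]; first by rewrite big_ord0 set_itvco0 integral_set0.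
have xn1 : x n.+1 <= x 1%N.
  by elim: n {ih} => // n; exact: le_trans (xS _).
rewrite big_ord_recr/= EFinD addeC.
rewrite (@integral_itv_split _ f1 mf1 f1_0 (BLeft (x n.+2)) (BLeft (x n.+1)));
  rewrite ?bnd_simp//.
apply: leeD => //.
have B0x : (BRight 0 <= BLeft (x n.+2))%O by rewrite bnd_simp.
have mp := @measurable_itv_sub _ psi1 mpsi1 _ (BLeft (x n.+1)) B0x.
have p0 z : `[x n.+2, x n.+1[%classic z -> (0 <= psi1 z)%E.
  exact: (itv_sub_ge0 psi1_0).
have k0 : (0 <= (A n `^ e1)%:E)%E by rewrite lee_fin powR_ge0.
apply: (@le_trans _ _
    (\int[lebesgue1 R]_(t in `[x n.+2, x n.+1[) (psi1 t * (A n `^ e1)%:E))%E).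
  rewrite (@ge0_integralZr _ _ _ (lebesgue1 R) _ (leb_line_itv _) _ mp _ p0 k0).
  rewrite (head_split mpsi1 psi1_0 head_fin)// -EFinM lee_fin !wx !exprS.
  set z := w T; set z2 := 2^-1 ^+ n; set z3 := A n `^ e1.
  by rewrite le_eqVlt; apply/orP; left; apply/eqP; field.
apply: ge0_le_integral.
- exact: leb_line_itv.
- by move=> z zx; apply: mule_ge0; [exact: p0|exact: k0].
- by apply: emeasurable_funM; [exact: mp|exact: measurable_cst].
- exact: (measurable_itv_sub mf1).
move=> z zx; apply: lee_wpmul2l; first exact: p0.
rewrite -poweR_EFin -AE; apply: lee_poweR; [exact: ltW|exact: integral_ge0|].
apply: (le_trans (AF n)); apply: F_ni.
by move: zx; rewrite /= in_itv/= => /andP[_ /ltW].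
Qed.

Let N_sum n : \sum_(j < n) N j <= 1.
Proof.
have : ((\sum_(j < n) w (x j) * A j `^ e1 / 4)%:E <= X%:E)%E.
  apply: (le_trans (head_sum n)); apply: le_trans FX.
  by apply: (@integral_itv_le _ f1 mf1 f1_0); rewrite ?bnd_simp.
rewrite lee_fin -mulr_suml ler_pdivrMr// mulrC => s4.
by rewrite /N -mulr_suml ler_pdivrMr ?mul1r// mulr_gt0.
Qed.

Let N_le1 j : N j <= 1.
Proof.
apply: le_trans (N_sum j.+1); rewrite big_ord_recr/= lerDr.
by apply: sumr_ge0 => k _; exact: N0.
Qed.

(** Makes [h j t / N j] harmless when the denominator is 0: the quotient is then 0 by convention,
    and [h j t] is 0 as well. *)
Let N_eq0 j t : 0 < t -> N j = 0 -> h j t = 0.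
Proof.
move=> t0 /eqP; rewrite /N mulf_eq0 invr_eq0 (gt_eqF (mulr_gt0 _ X0))// orbF.
rewrite mulf_eq0 (gt_eqF (w0 (x0 j)))//= powR_eq0 => /andP[/eqP Aj0 _].
apply/eqP; rewrite eq_le h0 andbT.
have := block_mass_le (mD j) (x0 j) (@DB j) (AE j) t0.
by rewrite Aj0 powR0 ?gt_eqF// mulr0.
Qed.

Let K := 4 `^ q * C * (4 * X) `^ (be * q / e1).

Let K0 : 0 <= K. Proof. by rewrite !mulr_ge0 ?powR_ge0. Qed.

(** Written in terms of [N j], the bound of [hardy_block] carries the exponent [be * q / e1], which
    is at least [q] as [e1 <= be]; since [N j <= 1] it may be lowered to [q]. *)
Let block j : (\int[lebesgue1 R]_(t in `]0%R, T]) (psi2 t * (h j t `^ q)%:E) <=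
  (K * N j `^ q)%:E)%E.
Proof.
have xjT : x j <= T.
  by elim: j => [|j]; [rewrite xT|exact: le_trans].
have wj0 := w0 (x0 j).
have Cw0 : 0 <= C * w (x j) `^ (be * q / e1) by rewrite mulr_ge0// powR_ge0.
apply: (le_trans (hardy_block (mD j) (x0 j) (@DB j) (AE j) mpsi2 psi2_0 tail_fin
  q0 xjT Cw0
  (fun t c n => @discrete_hardy (x j) t c n (x0 j)))).
rewrite lee_fin /K (mulrA (4 `^ q) C) -!(mulrA (4 `^ q * C)).
apply: ler_wpM2l; first by rewrite mulr_ge0// powR_ge0.
have -> : A j `^ (be * q) = (A j `^ e1) `^ (be * q / e1).
  by rewrite -powRrM [e1 * _]mulrCA mulfV ?mulr1// gt_eqF.
rewrite -powRM ?powR_ge0// ?(ltW wj0)//.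
have -> : w (x j) * A j `^ e1 = 4 * X * N j.
  by rewrite /N [RHS]mulrC divfK// gt_eqF// mulr_gt0.
rewrite powRM ?N0 ?mulr_ge0 ?(ltW X0)//; apply: ler_wpM2l; first exact: powR_ge0.
have [->|Nj] := eqVneq (N j) 0.
  by rewrite !powR0 ?gt_eqF// divr_gt0// mulr_gt0.
apply: ger_powR; first by rewrite N_le1 lt_neqAle eq_sym Nj N0.
by rewrite ler_pdivlMr// mulrC ler_pM2r.
Qed.

Let x_ni i j : (i <= j)%N -> x j <= x i.
Proof. by apply/nonincreasing_seqP: i j. Qed.

Let x_small (s : R) : 0 < s -> exists j, x j < s.
Proof.
move=> s0; have /cvgrPdist_lt/(_ _ (w0 s0))[n _ /(_ n (leqnn _))] :
    (w T * 2^-1 ^+ n) @[n --> \oo] --> 0.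
  rewrite -[X in _ --> X](mulr0 (w T)); apply: cvgMr.
  by apply: cvg_expr; rewrite ger0_norm ?invr_ge0// invf_lt1// ltr1n.
rewrite sub0r normrN ger0_norm ?mulr_ge0 ?exprn_ge0 ?invr_ge0 ?(ltW (w0 T0))//.
rewrite -wx => wxs; exists n; rewrite ltNge; apply/negP => sx.
by have := head_nd mpsi1 psi1_0 head_fin s0 sx; rewrite leNgt wxs.
Qed.

(** Inside [B t] the shells miss only points common to all [B (x j)]. There [u] has integral 0,
    because [V (x j)] tends to 0, and by Hoelder's inequality so has [b]. *)
Let sum_blocks (t : R) : 0 < t -> t <= T ->
  (\int[m]_(y in B t) b y <= \sum_(0 <= j <oo) (h j t)%:E)%E.
Proof.
move=> t0 tT; pose E j := B t `&` D j; pose U := \bigcup_j E j.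
have mE j : measurable (E j) by apply: measurableI; [exact: mB|exact: mD].
have mU : measurable U by apply: bigcup_measurable.
have mZ : measurable (B t `\` U) by apply: measurableD => //; exact: mB.
have BU : B t = U `|` (B t `\` U).
  rewrite setDE setUIr setUCr setIT; apply/seteqP; split; first exact: subsetUr.
  by move=> y [[j _ []]|].
have BZ j : B t `\` U `<=` B (x j).
  move=> y [Bt nU]; elim: j => [|j ih]; first by rewrite xT; exact: (ndB tT).
  by apply: contrapT => nB; apply: nU; exists j.
have tE : trivIset setT E.
  apply: ltn_trivIset => i j ij; rewrite predeqE => y; split => // -[[_ [Bj nBj]] [_ [Bi nBi]]].
  by apply: nBj; apply: (ndB _ Bi); exact: x_ni.
have uZ : (\int[m]_(y in B t `\` U) u y <= 0%:E)%E.
  apply/lee_addgt0Pr => e e0; rewrite add0e.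
  have [|s s0 Vs] := @V_small (e `^ r^-1); first by rewrite powR_gt0.
  have [j xjs] := x_small s0.
  apply: (@le_trans _ _ (\int[m]_(y in B (x j)) u y)%E).
    by apply: ge0_subset_integral => //; exact: measurable_funTS.
  rewrite VE// lee_fin.
  apply: (le_trans (ler_powR_base (ltW r0) (ltW (V0 (x0 j)))
    (le_trans (ndV (x0 j) (ltW xjs)) Vs))).
  by rewrite -powRrM mulVf ?gt_eqF// powRr1// ltW.
have bZ : (\int[m]_(y in B t `\` U) b y = 0)%E.
  apply/eqP; rewrite eq_le integral_ge0// andbT.
  apply: (le_trans (hoelder_b mZ)).
  have /eqP -> : (\int[m]_(y in B t `\` U) u y == 0)%E.
    by rewrite eq_le uZ/= integral_ge0.
  by rewrite poweR0r ?mul0e// gt_eqF.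
rewrite [X in integral _ X]BU ge0_integral_setU//; first last.
- by apply/disj_setPS => y [Uy [_]].
- exact: measurable_funTS.
rewrite bZ adde0 ge0_integral_bigcup//; last exact: measurable_funTS.
apply: lee_nneseries => [j *|j *]; first exact: integral_ge0.
by rewrite (massE mB (mD j) mb b0 (@bfin j)).
Qed.

Let jensen_blocks (t : R) : 0 < t -> t <= T ->
  ((\int[m]_(y in B t) b y) `^ q <=
   \sum_(0 <= j <oo) (N j `^ (1 - q) * h j t `^ q)%:E)%E.
Proof.
move=> t0 tT; have c0 j : (0 <= (N j `^ (1 - q) * h j t `^ q)%:E)%E.
  by rewrite lee_fin mulr_ge0// powR_ge0.
set Z := (\sum_(0 <= j <oo) _)%E.
have Z0 : (0 <= Z)%E by apply: nneseries_ge0 => j _ _; exact: c0.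
have qN0 : q != 0 by rewrite gt_eqF.
(* Moving the root to the right leaves a plain series on the left, so its limit can be bounded
   through partial sums, to which the finite Jensen inequality applies. *)
rewrite -[leRHS]poweRe1// -(mulVf qN0) poweRrM.
apply: lee_poweR; [exact: ltW|exact: integral_ge0|].
apply: (le_trans (sum_blocks t0 tT)).
apply: lime_le; first by apply: is_cvg_nneseries => j _ _; rewrite lee_fin.
apply: nearW => n; rewrite big_mkord sumEFin.
have s0 : 0 <= \sum_(j < n) h j t by apply: sumr_ge0 => j _; exact: h0.
have -> : ((\sum_(j < n) h j t)%:E = ((\sum_(j < n) h j t) `^ q)%:E `^ q^-1)%E.
  by rewrite -poweR_EFin -poweRrM mulfV ?gt_eqF// poweRe1.
apply: lee_poweR; [by rewrite invr_ge0 ltW|by rewrite lee_fin powR_ge0|].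
apply: (@le_trans _ _ (\sum_(j < n) N j `^ (1 - q) * h j t `^ q)%:E); last first.
  rewrite -sumEFin -(big_mkord xpredT (fun j => (N j `^ (1 - q) * h j t `^ q)%:E)).
  by apply: nneseries_lim_ge => j _ _; exact: c0.
rewrite lee_fin.
have hN j : h j t = N j * (h j t / N j).
  have [Nj|Nj] := eqVneq (N j) 0; first by rewrite Nj mul0r (N_eq0 t0 Nj).
  by rewrite mulrC divfK.
have NhN j : N j `^ (1 - q) * h j t `^ q = N j * (h j t / N j) `^ q.
  have [Nj|Nj] := eqVneq (N j) 0.
    by rewrite Nj mul0r (N_eq0 t0 Nj) [X in _ * X]powR0 ?mulr0// gt_eqF.
  have iN0 : 0 <= (N j)^-1 by rewrite invr_ge0 N0.
  rewrite (powRM q (h0 j t) iN0) -(powR_inv1 (N0 j)) -powRrM mulN1r.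
  rewrite [RHS]mulrCA [LHS]mulrC; congr (_ * _).
  by rewrite powRD ?(powRr1 (N0 j))// Nj implybT.
under eq_bigr do rewrite hN; under [leRHS]eq_bigr do rewrite NhN.
apply: (@jensen_powR _ q n N (fun j => h j t / N j) q1 N0 _ (N_sum n)).
by move=> k; rewrite divr_ge0 ?h0 ?N0.
Qed.

Let f2 t := (psi2 t * (\int[m]_(y in B t) b y) `^ q)%E.

(** Once integrated, shell j contributes at most N_j^(1-q) K N_j^q = K N_j, and the N_j add up to at
    most 1. *)
Lemma truncated_bound :
  (\int[lebesgue1 R]_(t in `]0%R, T]) f2 t <= K%:E)%E.
Proof.
have B00 : (BRight (0 : R) <= BRight 0)%O by [].
have mp2 := @measurable_itv_sub _ psi2 mpsi2 _ (BRight T) B00.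
have p20 z : `]0, T]%classic z -> (0 <= psi2 z)%E by exact: (itv_sub_ge0 psi2_0).
pose g j (t : R) := (psi2 t * (N j `^ (1 - q) * h j t `^ q)%:E)%E.
have mh j : measurable_fun (`]0, T]%classic : set (leb_line R))
    (fun t => (h j t `^ q)%:E).
  apply: (monotone_measurable _ _).2; first exact: interval_is_interval.
  left => s t _ _ st; rewrite lee_fin ler_powR_base ?(ltW q0) ?h0//.
  exact: (mass_nd mB ndB (mD j) mb b0 (@bfin j)).
have mg j : measurable_fun (`]0, T]%classic : set (leb_line R)) (g j).
  apply: emeasurable_funM; first exact: mp2.
  apply: (monotone_measurable _ _).2; first exact: interval_is_interval.
  left => s t _ _ st; rewrite lee_fin ler_wpM2l ?powR_ge0//.
  by rewrite ler_powR_base ?(ltW q0) ?h0//; exact: (mass_nd mB ndB (mD j) mb b0 (@bfin j)).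
have g0 j t : `]0, T]%classic t -> (0 <= g j t)%E.
  by move=> tT; apply: mule_ge0; [exact: p20|rewrite lee_fin mulr_ge0// powR_ge0].
apply: (@le_trans _ _
    (\int[lebesgue1 R]_(t in `]0%R, T]) \sum_(0 <= j <oo) g j t)%E).
  apply: ge0_le_integral.
  - exact: leb_line_itv.
  - by move=> t tT; apply: mule_ge0; [exact: p20|exact: poweR_ge0].
  - apply: emeasurable_funM; first exact: mp2.
    apply: (monotone_measurable _ _).2; first exact: interval_is_interval.
    left => s t _ _ st; apply: lee_poweR; [exact: ltW|exact: integral_ge0|].
    apply: ge0_subset_integral; [exact: mB|exact: mB|exact: measurable_funTS| |].
      by [].
    exact: ndB.
  - apply: ge0_emeasurable_sum; [by move=> j t tT _; exact: g0|].
    by move=> j _; exact: mg.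
  move=> t tT; rewrite nneseries_mulel; first last.
  - by move=> j; rewrite lee_fin mulr_ge0// powR_ge0.
  - exact: p20.
  apply: lee_wpmul2l; first exact: p20.
  by move: tT; rewrite /= in_itv/= => /andP[]; exact: jensen_blocks.
rewrite integral_nneseries; [|exact: leb_line_itv|exact: mg|exact: g0].
apply: lime_le.
  by apply: is_cvg_nneseries => j _ _; apply: integral_ge0; exact: g0.
apply: nearW => n; rewrite big_mkord.
apply: (@le_trans _ _ (\sum_(j < n) (K * N j)%:E)%E); last first.
  by rewrite sumEFin lee_fin -mulr_sumr ler_piMr// N_sum.
apply: lee_sum => j _.
have -> : (\int[lebesgue1 R]_(t in `]0%R, T]) g j t =
    (N j `^ (1 - q))%:E *
    \int[lebesgue1 R]_(t in `]0%R, T]) (psi2 t * (h j t `^ q)%:E))%E.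
  rewrite -ge0_integralZl; first last.
  - by rewrite lee_fin powR_ge0.
  - by move=> t tT; apply: mule_ge0; [exact: p20|rewrite lee_fin powR_ge0].
  - by apply: emeasurable_funM; [exact: mp2|exact: mh].
  - exact: leb_line_itv.
  by apply: eq_integral => t _; rewrite /g EFinM muleCA.
apply: (@le_trans _ _ ((N j `^ (1 - q))%:E * (K * N j `^ q)%:E)%E).
  by apply: lee_wpmul2l; [rewrite lee_fin powR_ge0|exact: block].
rewrite -EFinM lee_fin mulrCA; apply: ler_wpM2l => //.
have [->|Nj] := eqVneq (N j) 0; first by rewrite [X in _ * X]powR0 ?mulr0// gt_eqF.
by rewrite -powRD ?subrK ?powRr1//; apply/implyP.
Qed.

End fixed_T.

(** A halving sequence must start at some radius, which forces a truncation at [T]; the truncated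
    bound does not depend on [T], so T = n + 1 exhausts the half-line. *)
Theorem embedding_bound :
  (\int[lebesgue1 R]_(t in `]0%R, +oo[) (psi2 t * (\int[m]_(y in B t) b y) `^ q) <=
   (4 `^ q * C * (4 * X) `^ (be * q / e1))%:E)%E.
Proof.
have cup : `]0, +oo[%classic = \bigcup_n `]0, n.+1%:R]%classic :> set R.
  apply/seteqP; split => t /=; last first.
    by move=> [n _ /=]; rewrite !in_itv/= andbT => /andP[].
  rewrite in_itv/= andbT => t0; exists (Num.bound t) => //=.
  by rewrite in_itv/= t0/= (le_trans (ltW (archi_boundP (ltW t0))))// ler_nat.
rewrite cup; apply: integral_bigcup_le.
- move=> i j ij; apply/subsetPset => t; rewrite /= !in_itv/= => /andP[-> /le_trans]; apply.
  by rewrite ler_nat.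
- by move=> n; exact: leb_line_itv.
- rewrite -cup; apply: emeasurable_funM; first exact: mpsi2.
  apply: (monotone_measurable _ _).2; first exact: interval_is_interval.
  left => s t _ _ st; apply: lee_poweR; [exact: ltW|exact: integral_ge0|].
  apply: ge0_subset_integral; [exact: mB|exact: mB|exact: measurable_funTS| |].
    by [].
  exact: ndB.
- rewrite -cup => t; rewrite /= in_itv/= andbT => t0.
  by apply: mule_ge0; [exact: psi2_0|exact: poweR_ge0].
move=> n; have n0 : (0 : R) < n.+1%:R by [].
have [x [xT x0 wx xS]] := dyadic_sequence n0 (head_continuous mpsi1 psi1_0 head_fin)
  (head_nd mpsi1 psi1_0 head_fin) (head_small mpsi1 psi1_0 head_fin) (w0 n0).
apply: truncated_bound n0 x xT x0 wx xS.
Qed.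

End embedding.

End hardy_block.

(** * Discrete Hardy inequalities *)

(** After division by x^s this is z^s <= z for (x - y) / x and y / x, two numbers in [0, 1] with sum
    1. *)
Lemma powR_superadditive (R : realType) (s x y : R) : 1 <= s -> 0 <= y -> y <= x ->
  (x - y) `^ s <= x `^ s - y `^ s.
Proof.
move=> s1 y0 yx; have s0 : 0 < s by apply: lt_le_trans s1.
have [x0|xn0] := eqVneq x 0.
  have -> : y = 0 by apply/eqP; rewrite eq_le y0 andbT -x0.
  by rewrite x0 subrr powR0 ?gt_eqF// subrr.
have {xn0} x0 : 0 < x by rewrite lt_neqAle eq_sym xn0 (le_trans y0).
have small z : 0 <= z -> z <= 1 -> z `^ s <= z.
  move=> z0 z1; have [->|zn0] := eqVneq z 0; first by rewrite powR0// gt_eqF.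
  by apply: ge1r_powR => //; rewrite lt_neqAle eq_sym zn0 z0.
have h1 := small ((x - y) / x); have h2 := small (y / x).
have E z : 0 <= z -> z `^ s = (z / x) `^ s * x `^ s.
  by move=> z0; rewrite -powRM ?divr_ge0 ?(ltW x0)// divfK// gt_eqF.
rewrite lerBrDr (E (x - y)) ?subr_ge0// (E y)// -mulrDl.
rewrite -[leRHS]mul1r; apply: ler_wpM2r; first exact: powR_ge0.
have -> : 1 = (x - y) / x + y / x by rewrite -mulrDl subrK divff// gt_eqF.
apply: lerD; [apply: h1|apply: h2].
- by rewrite divr_ge0 ?subr_ge0// ltW.
- by rewrite ler_pdivrMr// mul1r gerBl.
- by rewrite divr_ge0// ltW.
- by rewrite ler_pdivrMr// mul1r.
Qed.

Lemma sum_powR_le_max (R : realType) (n : nat) (d c : nat -> R) (e K : R) :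
  1 <= e -> 0 <= K -> (forall k, d k <= K) -> (forall k, 0 <= c k) ->
  \sum_(k < n) c k <= 1 -> \sum_(k < n) d k * c k `^ e <= K.
Proof.
move=> e1 K0 dK c0 c1; have e0 : 0 < e by apply: lt_le_trans e1.
apply: (@le_trans _ _ (\sum_(k < n) K * c k)); last first.
  by rewrite -mulr_sumr ler_piMr.
apply: ler_sum => k _; apply: (@le_trans _ _ (K * c k `^ e)).
  by apply: ler_wpM2r; [exact: powR_ge0|exact: dK].
apply: ler_wpM2l => //; have [->|ck] := eqVneq (c k) 0.
  by rewrite powR0// gt_eqF.
apply: ge1r_powR => //; rewrite lt_neqAle eq_sym ck c0/=.
by apply: le_trans c1; rewrite (bigD1 k)//= lerDl; apply: sumr_ge0.
Qed.

(** Hoelder's inequality with exponents [s] and [1 / e], obtained from Young's inequality term by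
    term after normalisation by L^(1/s). *)
Lemma sum_powR_le_hoelder (R : realType) (n : nat) (x c : nat -> R) (s e L : R) :
  0 < s -> 0 < e -> s^-1 + e = 1 -> 0 < L ->
  (forall k, 0 <= x k) -> (forall k, 0 <= c k) ->
  \sum_(k < n) x k `^ s <= L -> \sum_(k < n) c k <= 1 ->
  \sum_(k < n) x k * c k `^ e <= L `^ s^-1.
Proof.
move=> s0 e0 se L0 x0 c0 xL c1.
have Ls : 0 < L `^ s^-1 by rewrite powR_gt0.
have young k : x k * c k `^ e <= L `^ s^-1 * (x k `^ s / (L * s) + c k * e).
  rewrite -ler_pdivrMl// mulrA.
  have := @conjugate_powR R ((L `^ s^-1)^-1 * x k) (c k `^ e) s e^-1.
  rewrite mulr_ge0 ?invr_ge0 ?powR_ge0// invrK se => /(_ isT isT s0).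
  rewrite invr_gt0 => /(_ e0 erefl) /le_trans; apply; apply: lerD.
    rewrite powRM ?invr_ge0 ?powR_ge0//.
    have -> : (L `^ s^-1)^-1 `^ s = L^-1.
      rewrite -powRN -powRrM mulNr mulVf ?gt_eqF//.
      by rewrite powR_inv1// ltW.
    by rewrite invfM mulrA (mulrC L^-1).
  by rewrite -powRrM mulfV ?gt_eqF// powRr1.
apply: (@le_trans _ _ (\sum_(k < n) L `^ s^-1 * (x k `^ s / (L * s) + c k * e))).
  by apply: ler_sum => k _; exact: young.
rewrite -mulr_sumr big_split/= -2!mulr_suml ler_piMr ?(ltW Ls)// -se; apply: lerD.
  by rewrite ler_pdivrMr ?mulr_gt0// mulrCA mulVf ?mulr1// gt_eqF.
by rewrite ler_piMl// ltW.
Qed.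

(** Abel summation moves the difference to the geometric factor a_k, where a_k - a_(k+1) = (1 -
    2^(-e)) a_k; the boundary term is only reduced. The conditional encodes t_(-1) = 0. *)
Lemma sum_geometric_abel (R : realType) (e v : R) (t : nat -> R) (n : nat) :
  0 < e -> 0 <= v -> (forall k, 0 <= t k) ->
  (1 - 2^-1 `^ e) * (\sum_(k < n) (v * 2^-1 ^+ k) `^ e * t k) <=
  \sum_(k < n) (v * 2^-1 ^+ k) `^ e * (t k - (if nat_of_ord k is j.+1 then t j else 0)).
Proof.
move=> e0 v0 t0; set a := fun k => (v * 2^-1 ^+ k) `^ e.
have aS k : a k.+1 = 2^-1 `^ e * a k.
  by rewrite /a -powRM ?mulr_ge0 ?exprn_ge0 ?invr_ge0// exprS mulrCA.
suff E : forall m, \sum_(k < m.+1) a k * (t k - (if nat_of_ord k is j.+1 then t j else 0)) =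
    (1 - 2^-1 `^ e) * (\sum_(k < m) a k * t k) + a m * t m.
  case: n => [|m]; first by rewrite !big_ord0 mulr0.
  rewrite E big_ord_recr/= mulrDr lerD2l ler_piMl ?mulr_ge0 ?(powR_ge0 _ e)//.
elim=> [|m ih]; first by rewrite big_ord_recr !big_ord0/= mulr0 !add0r subr0.
rewrite big_ord_recr/= ih [in RHS]big_ord_recr/= aS; ring.
Qed.

(** Young's inequality for x^(rho - th) y^th. It trades differences of [th]-th powers of the tail
    for differences of [rho]-th powers. *)
Lemma powR_weighted_sub (R : realType) (th rho x y : R) : 0 < th -> th < rho ->
  0 <= x -> 0 <= y ->
  th / rho * (x `^ rho - y `^ rho) <= x `^ (rho - th) * (x `^ th - y `^ th).
Proof.
move=> th0 thr x0 y0; have r0 := lt_trans th0 thr.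
have rt : 0 < rho - th by rewrite subr_gt0.
have := @conjugate_powR R (x `^ (rho - th)) (y `^ th) (rho / (rho - th)) (rho / th)
  (powR_ge0 _ _) (powR_ge0 _ _) (divr_gt0 r0 rt) (divr_gt0 r0 th0).
rewrite !invf_div -mulrDl subrK divff ?gt_eqF// => /(_ erefl).
rewrite -!powRrM (mulrCA (rho - th)) mulfV ?mulr1 ?gt_eqF//.
rewrite (mulrCA th) mulfV ?mulr1 ?gt_eqF// => h.
have E : x `^ (rho - th) * x `^ th = x `^ rho.
  by rewrite -powRD subrK// gt_eqF.
rewrite (mulrBr (x `^ _)) E.
have -> : th / rho * (x `^ rho - y `^ rho) =
    x `^ rho - (x `^ rho * ((rho - th) / rho) + y `^ rho * (th / rho)).
  by rewrite mulrBl divff ?gt_eqF//; ring.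
by rewrite lerD2l lerN2.
Qed.

Lemma half_powR_lt1 (R : realType) (e : R) : 0 < e -> 2^-1 `^ e < 1.
Proof.
move=> e0; suff : 2^-1 `^ e < 1 `^ e :> R by rewrite powR1.
apply: gt0_ltr_powR => //; first by rewrite nnegrE invr_ge0.
- by rewrite nnegrE.
- by rewrite invf_lt1// ltr1n.
Qed.

(** * Discrete inequalities and the conditions on the weights *)

Section discrete_conditions.
Context {R : realType}.
Variables (p1 p2 th2 r : R).
Hypotheses (p1_0 : 0 < p1) (p2_0 : 0 < p2) (th2_0 : 0 < th2).
Hypotheses (p21 : p2 < p1) (pth : p2 < th2) (r0 : 0 < r).
Hypothesis r12V : r^-1 + p1^-1 = p2^-1.
Variables (V tl W : R -> R).
Hypothesis V_gt0 : forall t : R, 0 < t -> 0 < V t.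
Hypothesis tl_gt0 : forall t : R, 0 < t -> 0 < tl t.
Hypothesis W_gt0 : forall t : R, 0 < t -> 0 < W t.
Hypothesis tl_ni : forall s t : R, 0 < s -> s <= t -> tl t <= tl s.

Let d_gt0 : 0 < 1 - 2^-1 `^ r.
Proof. by rewrite subr_gt0 half_powR_lt1. Qed.

(** Dropping the subtracted tail leaves coefficients bounded by the [th2]-th power of the
    hypothesis; the exponent of [c k] is at least 1 as [p1 <= th2]. *)
Lemma discrete_hardy_of_sup (C : R) : p1 <= th2 -> 0 <= C ->
  (forall t x : R, 0 < t -> 0 < x -> Num.min (V t) (V x) * tl t <= C * W x) ->
  forall (x : R) (t c : nat -> R) (N : nat), 0 < x ->
    (forall k, 0 < t k) -> (forall k, t k.+1 <= t k) -> (forall k, 0 <= c k) ->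
    \sum_(k < N) c k <= 1 ->
    \sum_(k < N) (tl (t k.+1) `^ th2 - tl (t k) `^ th2) *
      (Num.min (V (t k.+1)) (V x) `^ th2 * c k `^ (th2 / p1)) <=
    (C * W x) `^ th2.
Proof.
move=> pt C0 H x t c N x0 t0 tS c0 c1.
have CW0 : 0 <= C * W x by rewrite mulr_ge0// ltW// W_gt0.
under eq_bigr do rewrite mulrA.
apply: (@sum_powR_le_max _ N (fun k => (tl (t k.+1) `^ th2 - tl (t k) `^ th2) *
  Num.min (V (t k.+1)) (V x) `^ th2)) => //.
- by rewrite ler_pdivlMr// mul1r.
- exact: powR_ge0.
move=> k; have m0 : 0 <= Num.min (V (t k.+1)) (V x).
  by rewrite le_min !(ltW (V_gt0 _)).
apply: (@le_trans _ _ (tl (t k.+1) `^ th2 * Num.min (V (t k.+1)) (V x) `^ th2)).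
  by rewrite ler_wpM2r ?powR_ge0// gerBl powR_ge0.
have tl0 : 0 <= tl (t k.+1) by rewrite ltW// tl_gt0.
rewrite -powRM// (mulrC (tl _)).
by apply: ler_powR_base; [exact: ltW|exact: mulr_ge0|exact: H].
Qed.

(** The assumption is the test on a single shell across which [V] halves, D being its volume.
    Division by D^(th2/p1) leaves D^(th2/r), because 1/p2 - 1/p1 = 1/r. *)
Lemma sup_of_test (C x : R) : 0 <= C -> 0 < x ->
  ((1 - 2^-1 `^ r) * V x `^ r) `^ (th2 / p2) * tl x `^ th2 <=
    (C * W x) `^ th2 * ((1 - 2^-1 `^ r) * V x `^ r) `^ (th2 / p1) ->
  V x * tl x <= (1 - 2^-1 `^ r) `^ (- r^-1) * C * W x.
Proof.
move=> C0 x0; have V0 := V_gt0 x0.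
set D := (1 - 2^-1 `^ r) * V x `^ r.
have D0 : 0 < D by rewrite mulr_gt0// powR_gt0.
have E : D `^ (th2 / p2) = D `^ (th2 / r) * D `^ (th2 / p1).
  by rewrite -powRD -?mulrDr ?r12V// (gt_eqF D0) implybT.
rewrite E mulrAC ler_pM2r ?powR_gt0// => K.
have {}K : ((1 - 2^-1 `^ r) `^ r^-1 * (V x * tl x)) `^ th2 <= (C * W x) `^ th2.
  apply: le_trans K; rewrite le_eqVlt; apply/orP; left; apply/eqP.
  have -> : D `^ (th2 / r) = ((1 - 2^-1 `^ r) `^ r^-1 * V x) `^ th2.
    rewrite [th2 / r]mulrC powRrM; congr (_ `^ _).
    rewrite /D powRM ?powR_ge0 ?(ltW d_gt0)// -powRrM mulfV ?gt_eqF//.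
    by rewrite powRr1// ltW.
  by rewrite mulrA [LHS]powRM ?mulr_ge0 ?powR_ge0 ?(ltW V0)// ltW// tl_gt0.
have {}K : (1 - 2^-1 `^ r) `^ r^-1 * (V x * tl x) <= C * W x.
  have X0 : 0 <= (1 - 2^-1 `^ r) `^ r^-1 * (V x * tl x).
    by rewrite !mulr_ge0 ?powR_ge0 ?(ltW V0)// ltW// tl_gt0.
  have Y0 : 0 <= C * W x by rewrite mulr_ge0// ltW// W_gt0.
  rewrite leNgt; apply/negP => YX; move: K; rewrite leNgt => /negP; apply.
  by apply: gt0_ltr_powR; rewrite ?nnegrE.
rewrite powRN -mulrA ler_pdivlMl//; exact: powR_gt0.
Qed.

Section sum_condition.
Hypothesis th2p1 : th2 < p1.

Definition rho : R := (th2^-1 - p1^-1)^-1.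

Lemma rho_gt0 : 0 < rho.
Proof. by rewrite invr_gt0 subr_gt0 ltf_pV2. Qed.

Lemma rhoV : rho^-1 + p1^-1 = th2^-1.
Proof. by rewrite invrK subrK. Qed.

Lemma th2_lt_rho : th2 < rho.
Proof.
rewrite -ltf_pV2 ?posrE ?rho_gt0// /rho invrK.
by rewrite gtrBl invr_gt0.
Qed.

Let rho0 := rho_gt0.
Let rhot := th2_lt_rho.

(** The exponents [rho / th2] and [p1 / th2] are conjugate. Superadditivity of the power [rho / th2]
    turns powers of increments of tl^th2 into increments of tl^rho. *)
Lemma discrete_hardy_of_sum (C : R) : 0 < C ->
  (forall (x : R) (t : nat -> R) (N : nat), 0 < x ->
    (forall k, 0 < t k) -> (forall k, t k.+1 <= t k) ->
    \sum_(k < N) (tl (t k.+1) `^ rho - tl (t k) `^ rho) *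
      Num.min (V (t k.+1)) (V x) `^ rho <= (C * W x) `^ rho) ->
  forall (x : R) (t c : nat -> R) (N : nat), 0 < x ->
    (forall k, 0 < t k) -> (forall k, t k.+1 <= t k) -> (forall k, 0 <= c k) ->
    \sum_(k < N) c k <= 1 ->
    \sum_(k < N) (tl (t k.+1) `^ th2 - tl (t k) `^ th2) *
      (Num.min (V (t k.+1)) (V x) `^ th2 * c k `^ (th2 / p1)) <=
    (C * W x) `^ th2.
Proof.
move=> C0 H x t c N x0 t0 tS c0 c1.
have W0 : 0 < W x by exact: W_gt0.
have CW0 : 0 < C * W x by rewrite mulr_gt0.
have -> : (C * W x) `^ th2 = ((C * W x) `^ rho) `^ (rho / th2)^-1.
  by rewrite -powRrM invf_div mulrCA mulfV ?mulr1// gt_eqF.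
under eq_bigr do rewrite mulrA.
have m0 k : 0 <= Num.min (V (t k.+1)) (V x).
  by rewrite le_min !(ltW (V_gt0 _)).
have tl_S k : tl (t k) `^ th2 <= tl (t k.+1) `^ th2.
  by apply: ler_powR_base; [exact: ltW|exact/ltW/tl_gt0|exact: tl_ni].
apply: (@sum_powR_le_hoelder _ N (fun k => (tl (t k.+1) `^ th2 - tl (t k) `^ th2) *
  Num.min (V (t k.+1)) (V x) `^ th2)) => //.
- by rewrite divr_gt0.
- by rewrite divr_gt0.
- by rewrite invf_div -mulrDr rhoV mulfV// gt_eqF.
- exact: powR_gt0.
- by move=> k; rewrite mulr_ge0 ?powR_ge0// subr_ge0.
apply: le_trans (H x t N x0 t0 tS); apply: ler_sum => k _.
rewrite powRM ?powR_ge0 ?subr_ge0// -powRrM mulrCA mulfV ?gt_eqF// mulr1.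
apply: ler_wpM2r; first exact: powR_ge0.
have pK k' : tl (t k') `^ rho = (tl (t k') `^ th2) `^ (rho / th2).
  by rewrite -powRrM mulrCA mulfV ?mulr1// gt_eqF.
rewrite !pK; apply: powR_superadditive => //; last exact: powR_ge0.
by rewrite ler_pdivlMr// mul1r ltW.
Qed.

(** The factors in [r] come from the volumes of the shells, [th2 / rho] from Young's inequality,
    [1 - 2^-1 ^ rho] from Abel summation; the outer power undoes S^(th2/rho) in [sum_of_test]. *)
Definition lower_const : R :=
  ((1 - 2^-1 `^ r) `^ (th2 / p1) /
   ((1 - 2^-1 `^ r) `^ (th2 / p2) * (th2 / rho) * (1 - 2^-1 `^ rho))) `^ (rho / th2).

(** For the extremal coefficients both sides of the test are controlled by the same sum S, to the
    powers 1 and [th2 / p1]. Being finite, S can be cancelled, and the power [th2 / rho] remains. *)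
Lemma sum_of_test (C : R) (s : nat -> R) (N : nat) : 0 <= C ->
  (forall k, 0 < s k) -> (forall k, s k.+1 <= s k) ->
  (forall k, V (s k) = V (s 0%N) * 2^-1 ^+ k) ->
  (forall c : nat -> R, (forall k, 0 <= c k) ->
    \sum_(k < N) (c k `^ p2 * (V (s k) `^ r - V (s k.+1) `^ r)) `^ (th2 / p2) *
      (tl (s k) `^ th2 - (if nat_of_ord k is j.+1 then tl (s j) `^ th2 else 0)) <=
    (C * W (s 0%N)) `^ th2 *
      (\sum_(k < N) c k `^ p1 * (V (s k) `^ r - V (s k.+1) `^ r)) `^ (th2 / p1)) ->
  \sum_(k < N) (V (s k) * tl (s k)) `^ rho <= lower_const * (C * W (s 0%N)) `^ rho.
Proof.
move=> C0 s0 sS Vs H.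
have V0 k : 0 < V (s k) by exact: V_gt0.
have tl0 k : 0 < tl (s k) by exact: tl_gt0.
have dV k : V (s k) `^ r - V (s k.+1) `^ r = (1 - 2^-1 `^ r) * V (s k) `^ r.
  have -> : V (s k.+1) = 2^-1 * V (s k) by rewrite (Vs k.+1) exprS mulrCA -Vs.
  by rewrite powRM ?invr_ge0 ?(ltW (V0 _))// mulrBl mul1r.
set dl := 1 - 2^-1 `^ r in dV *.
have dl0 : 0 < dl := d_gt0.
(* Chosen so that c^p1 V^r = (V tl)^rho; then (c^p2 V^r)^(th2/p2) = V^rho tl^(rho - th2), the weight
   required by [powR_weighted_sub]. *)
pose c k := (V (s k) `^ (rho - r) * tl (s k) `^ rho) `^ p1^-1.
have c0 k : 0 <= c k by exact: powR_ge0.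
have := H c c0.
set S := \sum_(k < N) (V (s k) * tl (s k)) `^ rho.
have S0 : 0 <= S by apply: sumr_ge0 => k _; exact: powR_ge0.
have -> : \sum_(k < N) c k `^ p1 * (V (s k) `^ r - V (s k.+1) `^ r) = dl * S.
  rewrite mulr_sumr; apply: eq_bigr => k _; rewrite dV /c -powRrM mulVf ?gt_eqF//.
  rewrite powRr1 ?mulr_ge0 ?powR_ge0// mulrCA; congr (_ * _).
  rewrite powRM ?(ltW (V0 _)) ?(ltW (tl0 _))// mulrAC -powRD ?subrK//.
  by rewrite (gt_eqF (V0 _)) implybT.
have term k : (c k `^ p2 * (V (s k) `^ r - V (s k.+1) `^ r)) `^ (th2 / p2) =
    dl `^ (th2 / p2) * (V (s k) `^ rho * tl (s k) `^ (rho - th2)).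
  have cp : c k `^ p2 = V (s k) `^ ((rho - r) / p1 * p2) * tl (s k) `^ (rho / p1 * p2).
    by rewrite /c -powRrM powRM ?powR_ge0// -!powRrM !mulrA.
  have VV : V (s k) `^ ((rho - r) / p1 * p2) * V (s k) `^ r =
      V (s k) `^ ((rho - r) / p1 * p2 + r).
    by rewrite powRD// (gt_eqF (V0 _)) implybT.
  rewrite dV cp mulrCA [X in dl * X]mulrAC VV.
  rewrite (powRM _ (ltW dl0)) ?mulr_ge0 ?powR_ge0//; congr (_ * _).
  rewrite (powRM _ (powR_ge0 _ _) (powR_ge0 _ _)) -!powRrM.
  have h1 : rho / p1 * th2 = rho - th2.
    have -> : p1^-1 = th2^-1 - rho^-1 by rewrite -rhoV addrC addKr.
    by field; rewrite !gt_eqF.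
  have h2 : r / p2 = 1 + r / p1.
    by rewrite -r12V mulrDr mulfV// gt_eqF.
  congr (_ `^ _ * _ `^ _); last first.
    by rewrite -h1; field; rewrite !gt_eqF.
  have -> : ((rho - r) / p1 * p2 + r) * (th2 / p2) =
      rho / p1 * th2 - r / p1 * th2 + r / p2 * th2 by field; rewrite !gt_eqF.
  by rewrite h2 h1; ring.
under eq_bigr do rewrite term -mulrA.
rewrite -mulr_sumr => K.
have young k : th2 / rho * (V (s k) `^ rho *
      (tl (s k) `^ rho - (if k is j.+1 then tl (s j) `^ rho else 0))) <=
    V (s k) `^ rho * tl (s k) `^ (rho - th2) *
      (tl (s k) `^ th2 - (if k is j.+1 then tl (s j) `^ th2 else 0)).
  rewrite mulrCA -mulrA; apply: ler_wpM2l; first exact: powR_ge0.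
  have := @powR_weighted_sub R th2 rho (tl (s k))
    (if k is j.+1 then tl (s j) else 0) th2_0 rhot (ltW (tl0 k)).
  case: k => [|k]; last by apply; exact: ltW.
  by rewrite !powR0 ?gt_eqF// => /(_ (lexx _)).
have abel := @sum_geometric_abel R rho (V (s 0%N)) (fun k => tl (s k) `^ rho) N
  rho0 (ltW (V0 _)) (fun k => powR_ge0 _ _).
have {}K : dl `^ (th2 / p2) * (th2 / rho) * (1 - 2^-1 `^ rho) * S <=
    (C * W (s 0%N)) `^ th2 * (dl * S) `^ (th2 / p1).
  apply: le_trans K; rewrite -!mulrA; apply: ler_wpM2l; first exact: powR_ge0.
  apply: (@le_trans _ _ (th2 / rho * \sum_(k < N) (V (s k) `^ rho *
      (tl (s k) `^ rho - (if nat_of_ord k is j.+1 then tl (s j) `^ rho else 0))))).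
    rewrite -mulrA; apply: ler_wpM2l; first exact/ltW.
    apply: ler_wpM2l; first by rewrite invr_ge0 ltW.
    move: abel; under eq_bigr do rewrite -Vs -powRM ?(ltW (V0 _)) ?(ltW (tl0 _))//.
    by under [X in _ <= X -> _]eq_bigr do rewrite -Vs.
  rewrite mulr_sumr; apply: ler_sum => k _; exact: young.
have [S_0|Sn0] := eqVneq S 0.
  by rewrite S_0 mulr_ge0 ?powR_ge0.
have {}S0 : 0 < S by rewrite lt_neqAle eq_sym Sn0.
have g0 : 0 < 1 - 2^-1 `^ rho by rewrite subr_gt0 half_powR_lt1.
set kap := dl `^ (th2 / p2) * (th2 / rho) * (1 - 2^-1 `^ rho) in K.
have kap0 : 0 < kap.
  by apply: mulr_gt0 => //; apply: mulr_gt0; [exact: powR_gt0|exact: divr_gt0].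
have ex : th2 / rho + th2 / p1 = 1 by rewrite -mulrDr rhoV mulfV// gt_eqF.
have ES : S = S `^ (th2 / rho) * S `^ (th2 / p1).
  by rewrite -powRD ?ex ?powRr1 ?(ltW S0)// (gt_eqF S0) implybT.
have {}K : S `^ (th2 / rho) <= dl `^ (th2 / p1) / kap * (C * W (s 0%N)) `^ th2.
  rewrite mulrAC ler_pdivlMr// mulrC.
  rewrite -(ler_pM2r (powR_gt0 (th2 / p1) S0)) -mulrA -ES.
  apply: (le_trans K); rewrite (powRM (th2 / p1) (ltW dl0) (ltW S0)).
  rewrite le_eqVlt; apply/orP; left; apply/eqP; ring.
have -> : S = (S `^ (th2 / rho)) `^ (rho / th2).
  by rewrite -powRrM mulrA divfK ?gt_eqF// mulfV ?powRr1 ?(ltW S0)// gt_eqF.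
have R0 : 0 <= rho / th2 by rewrite divr_ge0// ltW.
apply: (le_trans (ler_powR_base R0 (powR_ge0 _ _) K)).
have CW0 : 0 <= C * W (s 0%N) by rewrite mulr_ge0// ltW// W_gt0.
have -> : (C * W (s 0%N)) `^ rho = ((C * W (s 0%N)) `^ th2) `^ (rho / th2).
  by rewrite -powRrM mulrCA mulfV ?mulr1// gt_eqF.
rewrite /lower_const -/dl -/kap.
by rewrite [leLHS]powRM ?powR_ge0 ?divr_ge0 ?powR_ge0 ?(ltW kap0).
Qed.

End sum_condition.
End discrete_conditions.

(** * Test functions *)

Section test_function.
Context d (S : measurableType d) (R : realType).
Variables (m : {measure set S -> \bar R}) (B : R -> set S).
Hypothesis mB : forall t, measurable (B t).
Hypothesis ndB : forall s t, s <= t -> B s `<=` B t.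
Variable u : S -> \bar R.
Hypothesis mu : measurable_fun setT u.
Hypothesis u0 : forall y, (0 <= u y)%E.
Variables (s c mass_ : nat -> R) (n : nat).
Hypothesis s0 : forall k, 0 < s k.
Hypothesis sS : forall k, s k.+1 <= s k.
Hypothesis c0 : forall k, 0 <= c k.

Let E k := B (s k) `\` B (s k.+1).

Hypothesis massE : forall k, (\int[m]_(y in E k) u y = (mass_ k)%:E)%E.

Definition step_fun (y : S) : R := \sum_(k < n) c k * \1_(E k) y.

Let s_ni i j : (i <= j)%N -> s j <= s i.
Proof. by apply/nonincreasing_seqP: i j. Qed.

Let mE k : measurable (E k).
Proof. by apply: measurableD; exact: mB. Qed.

Let mass0 k : 0 <= mass_ k.
Proof. by rewrite -lee_fin -massE integral_ge0. Qed.

Let E_disj i j y : E i y -> E j y -> i = j.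
Proof.
have key a b : (a < b)%N -> E a y -> E b y -> False.
  by move=> ab [_ nB] [Bb _]; apply: nB; apply: (ndB _ Bb); exact: s_ni.
by move=> Ei Ej; case: (ltngtP i j) => // ij; [case: (key i j)|case: (key j i)].
Qed.

Lemma step_fun_ge0 y : 0 <= step_fun y.
Proof. by apply: sumr_ge0 => k _; rewrite mulr_ge0. Qed.

Lemma measurable_step_fun : measurable_fun setT step_fun.
Proof.
apply: measurable_sum => k; apply: measurable_funM; first exact: measurable_cst.
by apply: measurable_indic; exact: mE.
Qed.

Let step_funE k y : (k < n)%N -> E k y -> step_fun y = c k.
Proof.
move=> kn Ek; rewrite /step_fun (bigD1 (Ordinal kn))//= indicE mem_set// mulr1.
rewrite big1 ?addr0// => i ik; rewrite indicE memNset ?mulr0// => Ei.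
by move/eqP: ik; apply; apply/val_inj => /=; exact: E_disj Ei Ek.
Qed.

Let step_fun_out y : (forall k, (k < n)%N -> ~ E k y) -> step_fun y = 0.
Proof.
move=> nE; rewrite /step_fun big1// => k _.
by rewrite indicE memNset ?mulr0//; exact: nE.
Qed.

Section power.
Variable p : R.
Hypothesis p0 : 0 < p.

Local Notation g := (fun y => (step_fun y `^ p)%:E * u y)%E.

Lemma measurable_step_weight : measurable_fun setT g.
Proof.
apply: emeasurable_funM => //; apply/measurable_EFinP.
exact: (measurableT_comp (measurable_powR p) measurable_step_fun).
Qed.

Lemma step_weight_ge0 y : (0 <= g y)%E.
Proof. by rewrite mule_ge0// lee_fin powR_ge0. Qed.

Lemma step_weight_le A : measurable A ->
  (\int[m]_(y in A) g y <= (\sum_(k < n) c k `^ p * mass_ k)%:E)%E.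
Proof.
move=> mA; have mg := measurable_step_weight.
apply: (@le_trans _ _ (\int[m]_y g y)%E).
  by apply: ge0_subset_integral => // y _; exact: step_weight_ge0.
pose f k y := ((c k `^ p)%:E * (u \_ (E k)) y)%E.
have mf k : measurable_fun setT (f k).
  apply: emeasurable_funM; first exact: measurable_cst.
  by apply/(measurable_restrictT _ (mE k)).1/measurable_funTS.
have f0 k y : (0 <= f k y)%E.
  by rewrite mule_ge0 ?lee_fin ?powR_ge0// erestrict_ge0.
apply: (@le_trans _ _ (\int[m]_y \sum_(k < n) f k y)%E).
  apply: ge0_le_integral => //.
  - by move=> y _; exact: step_weight_ge0.
  - by apply: emeasurable_sum => k; exact: mf.
  move=> y _; have [[k [kn Ek]]|nE] := pselect (exists k, (k < n)%N /\ E k y).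
    rewrite (step_funE kn Ek) (bigD1 (Ordinal kn))//= {1}/f patchE mem_set//.
    by rewrite leeDl// sume_ge0// => i _; exact: f0.
  rewrite step_fun_out; last by move=> k kn Ek; apply: nE; exists k.
  by rewrite powR0 ?gt_eqF// mul0e sume_ge0.
rewrite ge0_integral_sum//= -sumEFin; apply: lee_sum => k _.
rewrite ge0_integralZl//; first last.
- by rewrite lee_fin powR_ge0.
- by move=> y _; exact: erestrict_ge0.
- by apply/(measurable_restrictT _ (mE k)).1/measurable_funTS.
by rewrite -integral_mkcond massE EFinM.
Qed.

Lemma step_weight_ball k t : (k < n)%N -> s k <= t ->
  ((c k `^ p * mass_ k)%:E <= \int[m]_(y in B t) g y)%E.
Proof.
move=> kn st; have -> : ((c k `^ p * mass_ k)%:E =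
    \int[m]_(y in E k) ((c k `^ p)%:E * u y))%E.
  rewrite ge0_integralZl ?massE//; first exact: measurable_funTS.
  by rewrite lee_fin powR_ge0.
apply: (@le_trans _ _ (\int[m]_(y in E k) g y)%E).
  apply: ge0_le_integral => //.
  - by move=> y _; rewrite mule_ge0// lee_fin powR_ge0.
  - by apply: emeasurable_funM; [exact: measurable_cst|exact: measurable_funTS].
  - exact: (measurable_funTS measurable_step_weight).
  by move=> y Ek; rewrite (step_funE kn Ek).
apply: ge0_subset_integral => //.
- exact: (measurable_funTS measurable_step_weight).
- by move=> y _; exact: step_weight_ge0.
- by move=> y [By _]; exact: (ndB st).
Qed.

Lemma step_weight_outside t : s 0%N <= t -> (\int[m]_(y in ~` B t) g y = 0)%E.
Proof.
move=> st; apply: integral0_eq => y nB; rewrite step_fun_out.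
  by rewrite powR0 ?gt_eqF// mul0e.
move=> k _ [Bk _]; apply: nB; apply: (ndB _ Bk).
by apply: le_trans st; exact: s_ni.
Qed.

End power.

Variables (psi1 psi2 : R -> \bar R).
Hypothesis mpsi1 : measurable_fun (`]0%R, +oo[%classic : set (leb_line R)) psi1.
Hypothesis psi1_0 : forall t : R, 0 < t -> (0 <= psi1 t)%E.
Hypothesis head_fin : forall t : R, 0 < t ->
  (\int[lebesgue1 R]_(s in `]0%R, t[) psi1 s < +oo)%E.
Hypothesis mpsi2 : measurable_fun (`]0%R, +oo[%classic : set (leb_line R)) psi2.
Hypothesis psi2_0 : forall t : R, 0 < t -> (0 <= psi2 t)%E.
Hypothesis tail_fin : forall t : R, 0 < t ->
  (\int[lebesgue1 R]_(s in `]t, +oo[) psi2 s < +oo)%E.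
Local Notation w := (head psi1).
Local Notation tau := (tailr psi2).

Variables (p1 p2 e q : R).
Hypotheses (p1_0 : 0 < p1) (p2_0 : 0 < p2) (e0 : 0 < e) (q0 : 0 < q).

Let f1 t := (psi1 t * (\int[m]_(y in ~` B t) ((step_fun y `^ p1)%:E * u y)) `^ e)%E.

Let mf1 : measurable_fun (`]0%R, +oo[%classic : set (leb_line R)) f1.
Proof.
apply: emeasurable_funM; first exact: mpsi1.
apply: (monotone_measurable _ _).2; first exact: interval_is_interval.
right => t t' _ _ tt; apply: lee_poweR; first exact: ltW.
  by apply: integral_ge0 => y _; exact: step_weight_ge0.
apply: ge0_subset_integral.
- by apply: measurableC; exact: mB.
- by apply: measurableC; exact: mB.
- exact: (measurable_funTS (measurable_step_weight _)).
- by move=> y _; exact: step_weight_ge0.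
- by apply: subsetC; exact: ndB.
Qed.

Let f1_0 (t : R) : 0 < t -> (0 <= f1 t)%E.
Proof. by move=> t0; rewrite mule_ge0 ?psi1_0// poweR_ge0. Qed.

(** The function vanishes outside [B (s 0)], so only t < s_0 counts; for such t the integral outside
    the ball is at most the total. *)
Lemma step_outer_norm_le :
  (\int[lebesgue1 R]_(t in `]0%R, +oo[) f1 t <=
   (w (s 0%N) * (\sum_(k < n) c k `^ p1 * mass_ k) `^ e)%:E)%E.
Proof.
set A := \sum_(k < n) _.
rewrite (@integral_itv_split _ f1 mf1 f1_0 _ (BLeft (s 0%N))) ?bnd_simp//.
rewrite [X in (_ + X)%E]integral0_eq ?adde0; last first.
  move=> t; rewrite /= in_itv/= andbT => st.
  by rewrite /f1 (step_weight_outside p1_0 st) poweR0r ?mule0// gt_eqF.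
rewrite EFinM -(headE psi1_0 head_fin (s0 0%N)).
have B00 : (BRight (0 : R) <= BRight 0)%O by [].
have mp := @measurable_itv_sub _ psi1 mpsi1 _ (BLeft (s 0%N)) B00.
have p0 z : `]0, s 0%N[%classic z -> (0 <= psi1 z)%E by exact: (itv_sub_ge0 psi1_0).
have k0 : (0 <= (A `^ e)%:E)%E by rewrite lee_fin powR_ge0.
rewrite -(@ge0_integralZr _ _ _ (lebesgue1 R) _ (leb_line_itv _) _ mp _ p0 k0).
apply: ge0_le_integral.
- exact: leb_line_itv.
- by move=> z zs; apply: (itv_sub_ge0 f1_0 B00 zs).
- exact: (measurable_itv_sub mf1).
- by apply: emeasurable_funM; [exact: mp|exact: measurable_cst].
move=> z zs; apply: lee_wpmul2l; first exact: p0.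
rewrite -poweR_EFin; apply: lee_poweR; first exact: ltW.
  by apply: integral_ge0 => y _; exact: step_weight_ge0.
by apply: (step_weight_le p1_0); apply: measurableC; exact: mB.
Qed.

Let f2 t := (psi2 t * (\int[m]_(y in B t) ((step_fun y `^ p2)%:E * u y)) `^ q)%E.

Let mf2 : measurable_fun (`]0%R, +oo[%classic : set (leb_line R)) f2.
Proof.
apply: emeasurable_funM; first exact: mpsi2.
apply: (monotone_measurable _ _).2; first exact: interval_is_interval.
left => t t' _ _ tt; apply: lee_poweR; first exact: ltW.
  by apply: integral_ge0 => y _; exact: step_weight_ge0.
apply: ge0_subset_integral; [exact: mB|exact: mB| | |exact: ndB].
- exact: (measurable_funTS (measurable_step_weight _)).
- by move=> y _; exact: step_weight_ge0.
Qed.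

Let f2_0 (t : R) : 0 < t -> (0 <= f2 t)%E.
Proof. by move=> t0; rewrite mule_ge0 ?psi2_0// poweR_ge0. Qed.

Let piece (k : nat) (y : itv_bound R) : (k < n)%N ->
  (((c k `^ p2 * mass_ k) `^ q)%:E *
     \int[lebesgue1 R]_(t in [set` Interval (BRight (s k)) y]) psi2 t <=
   \int[lebesgue1 R]_(t in [set` Interval (BRight (s k)) y]) f2 t)%E.
Proof.
move=> kn; have B0k : (BRight 0 <= BRight (s k))%O by rewrite bnd_simp ltW.
have mp := @measurable_itv_sub _ psi2 mpsi2 _ y B0k.
have p0 z : [set` Interval (BRight (s k)) y] z -> (0 <= psi2 z)%E.
  exact: (itv_sub_ge0 psi2_0).
have k0 : (0 <= ((c k `^ p2 * mass_ k) `^ q)%:E)%E by rewrite lee_fin powR_ge0.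
rewrite muleC.
rewrite -(@ge0_integralZr _ _ _ (lebesgue1 R) _ (leb_line_itv _) _ mp _ p0 k0).
apply: ge0_le_integral.
- exact: leb_line_itv.
- by move=> z zs; apply: mule_ge0; [exact: p0|exact: k0].
- by apply: emeasurable_funM; [exact: mp|exact: measurable_cst].
- exact: (measurable_itv_sub mf2).
move=> z zs; apply: lee_wpmul2l; first exact: p0.
rewrite -poweR_EFin; apply: lee_poweR; first exact: ltW.
  by rewrite lee_fin mulr_ge0// powR_ge0.
apply: step_weight_ball => //.
by move: zs; rewrite /= itv_boundlr => /andP[]; rewrite bnd_simp => /ltW.
Qed.

(** For t in []s_k, s_(k-1)]] the set [B t] contains the whole k-th shell. The outermost piece is
    []s_0, +oo[], from which no tail is subtracted; hence the value 0 at index 0. *)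
Lemma step_inner_norm_ge :
  ((\sum_(k < n) (c k `^ p2 * mass_ k) `^ q *
     (tau (s k) - (if nat_of_ord k is j.+1 then tau (s j) else 0)))%:E <=
   \int[lebesgue1 R]_(t in `]0%R, +oo[) f2 t)%E.
Proof.
(* The induction proceeds inwards and [y] is the left end reached so far. Before the first shell it
   is an arbitrary positive number. *)
suff H : forall l, (l <= n)%N -> exists2 y : R, 0 < y /\ (forall j, l = j.+1 -> y = s j) &
    ((\sum_(k < l) (c k `^ p2 * mass_ k) `^ q *
     (tau (s k) - (if nat_of_ord k is j.+1 then tau (s j) else 0)))%:E <=
    \int[lebesgue1 R]_(t in `]y, +oo[) f2 t)%E.
  have [y [y0 _] /le_trans] := H _ (leqnn n); apply.
  by apply: (@integral_itv_le _ f2 mf2 f2_0) => //; rewrite bnd_simp ltW.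
elim=> [_|l ih ln].
  exists 1; first by split.
  rewrite big_ord0; apply: integral_ge0 => t; rewrite /= in_itv/= andbT => t1.
  by apply: f2_0; apply: lt_trans t1.
exists (s l); first by split => // j [->].
rewrite big_ord_recr/=; case: l ih ln => [_|l ih] ln.
  rewrite big_ord0 add0r subr0 EFinM -(tailrE psi2_0 tail_fin (s0 0%N)).
  exact: piece.
have [y [_ ys]] := ih (ltnW ln); rewrite (ys l erefl) => hy.
rewrite EFinD addeC EFinM -(tailr_split mpsi2 psi2_0 tail_fin (s0 l.+1) (sS l)).
rewrite (@integral_itv_split _ f2 mf2 f2_0 (BRight (s l.+1)) (BRight (s l)));
  rewrite ?bnd_simp ?(ltW (s0 _))//.
by apply: leeD => //; exact: piece.
Qed.

End test_function.

(** * Hoelder inequality and weighted norms *)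

Lemma weighted_young (R : realType) (al be x y : R) : 0 < al -> 0 < be ->
  al + be = 1 -> 0 <= x -> 0 <= y -> x `^ al * y `^ be <= al * x + be * y.
Proof.
move=> al0 be0 ab x0 y0.
have := @conjugate_powR R (x `^ al) (y `^ be) al^-1 be^-1.
rewrite !powR_ge0 !invr_gt0 !invrK -!powRrM !mulfV ?gt_eqF// !powRr1//.
by move=> /(_ isT isT al0 be0 ab); rewrite mulrC (mulrC y) [_ * al]mulrC mulrC.
Qed.

Section integral_hoelder.
Context d (T : measurableType d) (R : realType).
Variable mu : {measure set T -> \bar R}.
Local Open Scope ereal_scope.

(** Young's inequality after normalising both integrals. A vanishing integral is treated first: as 0
    times [+oo] is 0 the left side must vanish too, and it does because [b] is 0 almost everywhere
    where that factor is 0. *)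
Lemma integral_hoelder (E : set T) (u a b : T -> \bar R) (al be : R) :
  measurable E -> measurable_fun E u -> measurable_fun E a -> measurable_fun E b ->
  (forall y, 0 <= u y) -> (forall y, 0 <= a y) -> (forall y, 0 <= b y) ->
  (0 < al)%R -> (0 < be)%R -> (al + be = 1)%R ->
  {ae mu, forall y, b y <= u y `^ al * a y `^ be} ->
  \int[mu]_(y in E) b y <=
    (\int[mu]_(y in E) u y) `^ al * (\int[mu]_(y in E) a y) `^ be.
Proof.
move=> mE mu_ ma mb u0 a0 b0 al0 be0 ab bua.
have zero (f : T -> \bar R) : measurable_fun E f -> (forall y, 0 <= f y) ->
    {ae mu, forall y, f y = 0 -> b y = 0} ->
    \int[mu]_(y in E) f y = 0 -> \int[mu]_(y in E) b y <= 0.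
  move=> mf f0 fb If; rewrite -(integral0 mu E).
  have fae : ae_eq mu E f (cst 0).
    apply/(ae_eq_integral_abs mu mE mf); rewrite -If.
    by apply: eq_integral => y _; rewrite gee0_abs.
  apply: ae_ge0_le_integral => //.
  by move: fae fb; apply: filterS2 => y /= fy + Ey => ->//; exact: fy.
have U0 : 0 <= \int[mu]_(y in E) u y by exact: integral_ge0.
have A0 : 0 <= \int[mu]_(y in E) a y by exact: integral_ge0.
have rhs0 : 0 <= (\int[mu]_(y in E) u y) `^ al * (\int[mu]_(y in E) a y) `^ be.
  by rewrite mule_ge0// poweR_ge0.
have [Ue|Un] := eqVneq (\int[mu]_(y in E) u y) 0.
  apply: (le_trans _ rhs0); apply: (zero _ mu_ u0 _ Ue).
  apply: filterS bua => y + uy; rewrite uy poweR0r ?gt_eqF// mul0e => by0.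
  by apply/eqP; rewrite eq_le by0 b0.
have [Ae|An] := eqVneq (\int[mu]_(y in E) a y) 0.
  apply: (le_trans _ rhs0); apply: (zero _ ma a0 _ Ae).
  apply: filterS bua => y + ay; rewrite ay [X in _ * X]poweR0r ?gt_eqF// mule0 => by0.
  by apply/eqP; rewrite eq_le by0 b0.
have Ugt : 0 < \int[mu]_(y in E) u y by rewrite lt_neqAle eq_sym Un.
have Agt : 0 < \int[mu]_(y in E) a y by rewrite lt_neqAle eq_sym An.
have [Uy|Uy] := eqVneq (\int[mu]_(y in E) u y) +oo.
  by rewrite Uy poweRyr ?gt_eqF// gt0_mulye ?leey// poweR_gt0.
have [Ay|Ay] := eqVneq (\int[mu]_(y in E) a y) +oo.
  by rewrite Ay [X in _ * X]poweRyr ?gt_eqF// gt0_muley ?leey// poweR_gt0.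
have [U UE] : exists U, \int[mu]_(y in E) u y = U%:E.
  by exists (fine (\int[mu]_(y in E) u y)); rewrite fineK// ge0_fin_numE// ltey.
have [A AE] : exists A, \int[mu]_(y in E) a y = A%:E.
  by exists (fine (\int[mu]_(y in E) a y)); rewrite fineK// ge0_fin_numE// ltey.
move: Ugt Agt; rewrite UE AE !lte_fin !poweR_EFin -EFinM => Ugt Agt.
have [c cE c_gt0] : exists2 c, (U `^ al * A `^ be)%R = c & (0 < c)%R.
  by eexists; first reflexivity; rewrite mulr_gt0// powR_gt0.
have c0 := ltW c_gt0; rewrite cE.
have k1 : (0 <= c * al / U)%R by rewrite !mulr_ge0 ?invr_ge0 ?(ltW al0) ?(ltW Ugt).
have k2 : (0 <= c * be / A)%R by rewrite !mulr_ge0 ?invr_ge0 ?(ltW be0) ?(ltW Agt).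
have mku : measurable_fun E (fun y => (c * al / U)%:E * u y).
  by apply: emeasurable_funM; [exact: measurable_cst|].
have mka : measurable_fun E (fun y => (c * be / A)%:E * a y).
  by apply: emeasurable_funM; [exact: measurable_cst|].
have young y : u y `^ al * a y `^ be <=
    (c * al / U)%:E * u y + (c * be / A)%:E * a y.
  have cal : (0 < c * al / U)%R by rewrite !mulr_gt0 ?invr_gt0.
  have cbe : (0 < c * be / A)%R by rewrite !mulr_gt0 ?invr_gt0.
  move: (u0 y) (a0 y); case: (u y) => [r1| |] // r10; last first.
    move=> ay0; rewrite [X in _ <= X + _]gt0_muley ?lte_fin//.
    by rewrite addye ?leey// gt_eqF// (lt_le_trans ltNy0)// mule_ge0.
  case: (a y) => [r2| |] // r20; last first.
    by rewrite [X in _ <= _ + X]gt0_muley ?lte_fin// addey ?leey.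
  rewrite !poweR_EFin -!EFinM -EFinD lee_fin.
  have E1 : (r1 `^ al = U `^ al * (r1 / U) `^ al)%R.
    by rewrite -powRM ?divr_ge0 ?(ltW Ugt)// mulrC divfK// gt_eqF.
  have E2 : (r2 `^ be = A `^ be * (r2 / A) `^ be)%R.
    by rewrite -powRM ?divr_ge0 ?(ltW Agt)// mulrC divfK// gt_eqF.
  rewrite E1 E2 mulrACA cE.
  have -> : (c * al / U * r1 + c * be / A * r2 = c * (al * (r1 / U) + be * (r2 / A)))%R.
    by ring.
  by apply: ler_wpM2l => //; apply: weighted_young => //; rewrite divr_ge0// ltW.
apply: (@le_trans _ _ (\int[mu]_(y in E)
    ((c * al / U)%:E * u y + (c * be / A)%:E * a y))).
  apply: ae_ge0_le_integral => //.
  - by move=> y _; rewrite adde_ge0// mule_ge0.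
  - exact: emeasurable_funD.
  - by apply: filterS bua => y by_ _; apply: (le_trans by_).
rewrite ge0_integralD//; try by move=> y _; rewrite mule_ge0.
rewrite !ge0_integralZl// UE AE -!EFinM -EFinD lee_fin.
rewrite !divfK ?gt_eqF// -mulrDr ab mulr1//.
Qed.

End integral_hoelder.

Section measurability.
Context {R : realType}.
Local Open Scope ereal_scope.

(** The inverse of 0 is [+oo], so 0 belongs to the preimage of every ray. For c >= 0 the preimage is
    [0, 1/c[; for c < 0 it is [0, +oo] together with the numbers below 1/c, without [-oo]. *)
Lemma measurable_inve : measurable_fun [set: \bar R] (fun x => x^-1).
Proof.
apply: (measurability _ (ErealGenOInfty.measurableE R)) => _ [_ [c ->] <-].
rewrite setTI; have [c0|c0] := leP 0%R c.
  rewrite (_ : _ @^-1` _ = `[0, (c%:E)^-1[%classic); first exact: emeasurable_itv.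
  apply/seteqP; split => -[r| |] /=; rewrite !in_itv/= ?andbT ?lee_fin.
  - have [->|rn0] := eqVneq r 0%R.
      move=> _; rewrite lexx lt_neqAle inve_ge0 lee_fin c0 andbT eq_sym.
      by rewrite inve_eq0.
    rewrite inver (negbTE rn0) lte_fin => cr.
    have r0 : (0 < r)%R by rewrite -invr_gt0 (le_lt_trans c0).
    rewrite (ltW r0) inver; case: ifPn => [_|cn0]; first by rewrite ltry.
    have c_gt0 : (0 < c)%R by rewrite lt_neqAle eq_sym cn0.
    by rewrite lte_fin -(invrK r) ltf_pV2 ?posrE// invr_gt0.
  - by rewrite invey lte_fin ltNge c0.
  - by rewrite ?inveNy.
  - rewrite inver; case: ifPn => [/eqP ->|cn0]; rewrite ?lte_fin => /andP[r0 rc].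
      rewrite inver; case: ifPn => [_|rn0]; first by rewrite ltry.
      by rewrite lte_fin invr_gt0 lt_neqAle eq_sym rn0.
    rewrite inver; case: ifPn => [_|rn0]; first by rewrite ltry.
    rewrite lte_fin -ltf_pV2 ?invrK ?posrE// ?invr_gt0 lt_neqAle eq_sym ?cn0 ?rn0//.
  - by move=> /andP[_]; rewrite ltNge leey.
  - by [].
rewrite (_ : _ @^-1` _ = `[0, +oo]%classic `|` [set` Interval (BRight -oo) (BLeft (c^-1)%:E)]).
  by apply: measurableU; exact: emeasurable_itv.
apply/seteqP; split => -[r| |] /=; rewrite !in_itv/= ?andbT ?lee_fin.
- have [r0|r0] := leP 0%R r; first by left; rewrite leey.
  rewrite inver lt_eqF// lte_fin => cr; right; rewrite ?ltNyr/= lte_fin.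
  by rewrite -ltf_nV2 ?invrK// ?negrE ?invr_lt0.
- by left; rewrite ?le0y ?lexx ?leey.
- by rewrite ?inveNy.
- case=> [/andP[r0 _]|/andP[_ rc]].
    rewrite inver; case: ifPn => [_|rn0]; first by rewrite ltry.
    by rewrite lte_fin (lt_le_trans c0)// invr_ge0.
  move: rc; rewrite lte_fin => rc.
  have r0 : (r < 0)%R by rewrite (lt_trans rc)// invr_lt0.
  by rewrite inver lt_eqF// lte_fin -ltf_nV2 ?invrK// ?negrE ?invr_lt0.
- by rewrite invey lte_fin.
- by case=> // /andP[].
Qed.

Lemma measurable_euclidean_norm n :
  measurable_fun [set: n.-tuple (measurableTypeR R)] (@euclidean_norm R n).
Proof.
apply: (@measurableT_comp _ _ _ _ _ _ (@Num.sqrt R)).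
  by apply: continuous_measurable_fun => x; exact: sqrt_continuous.
apply: measurable_sum => i; apply: measurable_funX; exact: measurable_tnth.
Qed.

Lemma measurable_B0 n (t : R) : measurable (B0 n t : set (leb_space R n)).
Proof.
apply: caratheodory_measurable_mu_ext.
rewrite (_ : B0 n t = [set: n.-tuple (measurableTypeR R)] `&`
    (@euclidean_norm R n) @^-1` `]-oo, t[%classic).
  by apply: measurable_euclidean_norm => //; exact: measurable_itv.
by rewrite setTI; apply/seteqP; split => y /=; rewrite in_itv.
Qed.

Lemma B0_nd n (s t : R) : (s <= t)%R -> @B0 R n s `<=` B0 n t.
Proof. by move=> st y; rewrite /B0 /= => /lt_le_trans; apply. Qed.

Lemma norm_onE d (T : measurableType d) (mu : {measure set T -> \bar R})
    (A : set T) (p : R) (f : T -> \bar R) : p != 0%R ->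
  norm_on mu A p%:E f = (\int[mu]_(x in A) `|f x| `^ p) `^ p^-1.
Proof.
move=> p0; rewrite /norm_on unlock; congr (_ `^ _).
rewrite [RHS]integral_mkcond; apply: eq_integral => x _; rewrite !patchE.
by case: ifPn => // _; rewrite abse0 poweR0r.
Qed.

End measurability.

(** * Stieltjes integrals *)

Section stieltjes_sums.
Context {R : realType}.
Local Notation RR := (measurableTypeR R).
Variables (m : {measure set RR -> \bar R}) (rho : R) (V tl : R -> R).
Hypothesis rho0 : 0 < rho.
Hypothesis V_gt0 : forall t : R, 0 < t -> 0 < V t.
Hypothesis V_nd : forall s t : R, 0 < s -> s <= t -> V s <= V t.
Hypothesis tl_gt0 : forall t : R, 0 < t -> 0 < tl t.
Hypothesis tl_ni : forall s t : R, 0 < s -> s <= t -> tl t <= tl s.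
Hypothesis mE : forall a b : R, 0 < a -> a <= b ->
  m `]a, b]%classic = (tl a `^ rho - tl b `^ rho)%:E.

Let f x t := (Num.min (V t) (V x) `^ rho)%:E.

Definition min_integral x := (\int[m]_(t in `]0%R, +oo[) f x t)%E.

Let f0 x t : (0 <= f x t)%E.
Proof. by rewrite lee_fin powR_ge0. Qed.

Let min_ge0 (t x : R) : 0 < t -> 0 < x -> 0 <= Num.min (V t) (V x).
Proof. by move=> t0 x0; rewrite le_min !ltW// V_gt0. Qed.

Lemma measurable_min_powR (x : R) : 0 < x ->
  measurable_fun (`]0%R, +oo[%classic : set RR)
    (fun t : RR => (Num.min (V t) (V x) `^ rho)%:E).
Proof.
move=> x0; apply: (monotone_measurable _ _).1; first exact: interval_is_interval.
left => s t; rewrite /= !in_itv/= !andbT => s0 t0 st; rewrite lee_fin.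
apply: ler_powR_base; [exact: ltW|exact: min_ge0|].
by rewrite le_min !ge_min V_nd//= lexx orbT.
Qed.

Let mf := measurable_min_powR.

Let mfS (x : R) (i : interval R) : 0 < x -> [set` i] `<=` `]0%R, +oo[%classic ->
  measurable_fun ([set` i] : set RR) (f x).
Proof. by move=> x0 i0; apply: measurable_funS (mf x0). Qed.

Let pos (s t : R) : 0 < s -> `]s, t]%classic `<=` `]0%R, +oo[%classic.
Proof. by move=> s0 z /=; rewrite !in_itv/= andbT => /andP[sz _]; exact: lt_trans sz. Qed.

Let split_oc (x s t z : R) : 0 < x -> 0 < s -> s <= t -> t <= z ->
  (\int[m]_(y in `]s, z]) f x y =
   \int[m]_(y in `]s, t]) f x y + \int[m]_(y in `]t, z]) f x y)%E.
Proof.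
move=> x0 s0 st tz.
have E : `]s, z]%classic = `]s, t]%classic `|` `]t, z]%classic.
  by rewrite -itv_bndbnd_setU// bnd_simp.
rewrite E ge0_integral_setU//.
- by rewrite -E; apply: mfS => //; exact: pos.
- apply/disj_setPS => y [/=]; rewrite !in_itv/= => /andP[_ yt] /andP[ty _].
  by move: (lt_le_trans ty yt); rewrite ltxx.
Qed.

Let piece_le (x s t c : R) : 0 < x -> 0 < s -> s <= t -> 0 <= c ->
  (forall y, s < y -> y <= t -> Num.min (V y) (V x) <= c) ->
  (\int[m]_(y in `]s, t]) f x y <= (c `^ rho * (tl s `^ rho - tl t `^ rho))%:E)%E.
Proof.
move=> x0 s0 st c0 hc; rewrite EFinM -mE// -integral_cst//.
apply: ge0_le_integral => //; first by apply: mfS => //; exact: pos.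
move=> y /=; rewrite in_itv/= => /andP[sy yt]; rewrite lee_fin.
apply: ler_powR_base; [exact: ltW|apply: min_ge0 => //; exact: lt_trans sy|].
exact: hc.
Qed.

Let piece_ge (x s t c : R) : 0 < x -> 0 < s -> s <= t -> 0 <= c ->
  (forall y, s < y -> y <= t -> c <= Num.min (V y) (V x)) ->
  ((c `^ rho * (tl s `^ rho - tl t `^ rho))%:E <= \int[m]_(y in `]s, t]) f x y)%E.
Proof.
move=> x0 s0 st c0 hc; rewrite EFinM -mE// -integral_cst//.
apply: ge0_le_integral => //.
- by move=> y _; rewrite lee_fin powR_ge0.
- by apply: mfS => //; exact: pos.
move=> y /=; rewrite in_itv/= => /andP[sy yt]; rewrite lee_fin.
by apply: ler_powR_base; [exact: ltW| |exact: hc].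
Qed.

(** A lower sum: on []t_(k+1), t_k]] the integrand is at least its value at the left end. *)
Lemma sum_le_min_integral (x : R) (t : nat -> R) (N : nat) : 0 < x ->
  (forall k, 0 < t k) -> (forall k, t k.+1 <= t k) ->
  ((\sum_(k < N) (tl (t k.+1) `^ rho - tl (t k) `^ rho) *
      Num.min (V (t k.+1)) (V x) `^ rho)%:E <= min_integral x)%E.
Proof.
move=> x0 t0 tS.
apply: (@le_trans _ _ (\int[m]_(y in `]t N, t 0%N]) f x y)%E); last first.
  apply: ge0_subset_integral => //; [exact: mf|exact: pos].
elim: N => [|N ih]; first by rewrite big_ord0 set_itvoc0 integral_set0.
have tN : t N <= t 0%N by elim: N {ih} => // N; exact: le_trans.
rewrite big_ord_recr/= EFinD addeC (split_oc x0 (t0 N.+1) (tS N) tN).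
apply: leeD => //; rewrite mulrC; apply: piece_ge => //; first exact: min_ge0.
move=> y ty _; have y0 : 0 < y := lt_trans (t0 _) ty.
by rewrite le_min !ge_min V_nd ?(ltW ty)//= lexx orbT.
Qed.

(** Beyond x = s_0 the integrand is at most V(x)^rho and the measure at most tl(x)^rho, which gives
    the 1. On []s_(k+1), s_k]] one has V <= V(s_k) = 2 V(s_(k+1)) and measure at most
    tl(s_(k+1))^rho, which gives 2^rho. *)
Lemma min_integral_le (s : nat -> R) (K : R) :
  (forall k, 0 < s k) -> (forall k, s k.+1 <= s k) ->
  (forall k, V (s k) = V (s 0%N) * 2^-1 ^+ k) ->
  (forall N : nat, \sum_(k < N) (V (s k) * tl (s k)) `^ rho <= K) ->
  (min_integral (s 0%N) <= ((1 + 2 `^ rho) * K)%:E)%E.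
Proof.
move=> s0 sS Vs SK; set x := s 0%N.
have x0 : 0 < x by exact: s0.
have Vx := V_gt0 x0.
have s_ni i j : (i <= j)%N -> s j <= s i by apply/nonincreasing_seqP: i j.
have cup : `]0%R, +oo[%classic = \bigcup_n `]s n, x + n%:R]%classic :> set R.
  apply/seteqP; split => y /=; last first.
    by move=> [n _ /=]; rewrite !in_itv/= andbT => /andP[+ _]; exact: lt_trans.
  rewrite in_itv/= andbT => y0.
  have /cvgrPdist_lt/(_ _ (V_gt0 y0))[n _ hn] : (V x * 2^-1 ^+ k) @[k --> \oo] --> 0.
    rewrite -[X in _ --> X](mulr0 (V x)); apply: cvgMr.
    by apply: cvg_expr; rewrite ger0_norm ?invr_ge0// invf_lt1// ltr1n.
  exists (maxn n (Num.bound y)) => //=; rewrite in_itv/=; apply/andP; split.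
    rewrite ltNge; apply/negP => ys; have := V_nd y0 ys.
    rewrite Vs leNgt => /negP; apply.
    have := hn (maxn n (Num.bound y)) (leq_maxl _ _).
    by rewrite sub0r normrN ger0_norm// mulr_ge0 ?exprn_ge0 ?invr_ge0// ltW.
  rewrite (le_trans (ltW (archi_boundP (ltW y0))))// (@le_trans _ _ (maxn n (Num.bound y))%:R)//.
    by rewrite ler_nat leq_maxr.
  by rewrite lerDr ltW.
rewrite /min_integral cup; apply: integral_bigcup_le => //.
- move=> i j ij; apply/subsetPset => y; rewrite /= !in_itv/= => /andP[sy yx].
  by rewrite (le_lt_trans (s_ni _ _ ij) sy) (le_trans yx)// lerD2l ler_nat.
- by rewrite -cup; exact: mf.
move=> n; have xn : x <= x + n%:R by rewrite lerDl.
rewrite (split_oc x0 (s0 n) (s_ni 0%N n (leq0n n)) xn).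
rewrite mulrDl mul1r EFinD addeC; apply: leeD.
  apply: (@le_trans _ _ (V x `^ rho * (tl x `^ rho - tl (x + n%:R) `^ rho))%:E).
    by apply: piece_le => //; [exact: ltW|move=> y _ _; rewrite ge_min lexx orbT].
  rewrite lee_fin; apply: (@le_trans _ _ (V x `^ rho * tl x `^ rho)).
    by rewrite ler_wpM2l ?powR_ge0// gerBl powR_ge0.
  have := SK 1%N; rewrite big_ord_recr big_ord0/= add0r powRM//; first exact: ltW.
  exact/ltW/tl_gt0.
apply: (@le_trans _ _ (\sum_(k < n) V (s k) `^ rho *
    (tl (s k.+1) `^ rho - tl (s k) `^ rho))%:E).
  elim: n {xn} => [|n ih]; first by rewrite big_ord0 set_itvoc0 integral_set0.
  rewrite big_ord_recr/= EFinD addeC.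
  rewrite (split_oc x0 (s0 n.+1) (sS n) (s_ni 0%N n (leq0n n))).
  apply: leeD => //; apply: piece_le => //; first exact/ltW/V_gt0.
  by move=> y sy yt; rewrite ge_min V_nd//; exact: lt_trans sy.
rewrite lee_fin; apply: (@le_trans _ _ (2 `^ rho * \sum_(k < n.+1) (V (s k) * tl (s k)) `^ rho));
    last by rewrite ler_wpM2l ?powR_ge0.
rewrite big_ord_recl/= mulrDr ler_wpDl ?mulr_ge0 ?powR_ge0// mulr_sumr.
apply: ler_sum => k _; apply: (@le_trans _ _ (V (s k) `^ rho * tl (s k.+1) `^ rho)).
  by rewrite ler_wpM2l ?powR_ge0// gerBl powR_ge0.
have Vk : V (s k) = 2 * V (s k.+1).
  have -> : V (s k.+1) = 2^-1 * V (s k) by rewrite (Vs k.+1) exprS mulrCA -Vs.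
  by rewrite mulrA mulfV// mul1r.
rewrite Vk /bump/= !add1n -!powRM ?mulr_ge0 ?(ltW (V_gt0 _)) ?(ltW (tl_gt0 _))//.
by rewrite mulrA.
Qed.

End stieltjes_sums.

(** * Reduction of the product of suprema to J / W *)

Section two_sided_sup.
Context {R : realType}.
Local Open Scope ereal_scope.

(** The positive element of [A] excludes an infinite [i]; a finite positive [i] is divided out. *)
Lemma ereal_sup_mul_le (A : set \bar R) (i : \bar R) (K : R) :
  0 <= i -> (0 <= K)%R -> (exists2 a, A a & 0 < a) -> (forall a, A a -> a * i <= K%:E) ->
  ereal_sup A * i <= K%:E.
Proof.
move=> i0 K0 [a Aa a0] AK.
have [->|in0] := eqVneq i 0; first by rewrite mule0.
have [iy|iy] := eqVneq i +oo.
  by have := AK _ Aa; rewrite iy gt0_muley// leye_eq.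
have [r rE] : exists r, i = r%:E by exists (fine i); rewrite fineK// ge0_fin_numE// ltey.
have r0 : (0 < r)%R by rewrite -lte_fin -rE lt_neqAle eq_sym in0.
rewrite rE -lee_pdivlMr//; apply: ge_ereal_sup => b Ab.
by rewrite lee_pdivlMr// -rE AK.
Qed.

Variables (V W : R -> R) (I J : R -> \bar R).
Hypothesis V_gt0 : forall t : R, (0 < t)%R -> (0 < V t)%R.
Hypothesis W_gt0 : forall t : R, (0 < t)%R -> (0 < W t)%R.
Hypothesis I_ge0 : forall x : R, (0 < x)%R -> 0 <= I x.
Hypothesis IJ : forall s x : R, (0 < s)%R -> (0 < x)%R ->
  (V s * (V x / (V x + V s)))%:E * I x <= J s.
Hypothesis JI : forall s : R, (0 < s)%R -> J s <= (2 * V s)%:E * I s.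

(** [phi1] in real terms. The first factor is half the harmonic mean of V(t) and V(x). *)
Definition harmonic_sup (x : R) : \bar R :=
  ereal_sup [set (V t * (V x / (V x + V t)) * (W t)^-1)%:E | t in `]0%R, +oo[].

Lemma sup_product_le (K : R) : (0 <= K)%R ->
  (forall s : R, (0 < s)%R -> J s <= (K * W s)%:E) ->
  ereal_sup [set harmonic_sup x * I x | x in `]0%R, +oo[] <= K%:E.
Proof.
move=> K0 JK; apply: ge_ereal_sup => _ [x /= x0 <-].
move: x0; rewrite in_itv/= andbT => x0.
apply: ereal_sup_mul_le => //; first exact: I_ge0.
  exists (V x * (V x / (V x + V x)) * (W x)^-1)%:E.
    by exists x; rewrite //= in_itv/= x0.
  by rewrite lte_fin !mulr_gt0 ?invr_gt0 ?addr_gt0 ?V_gt0 ?W_gt0.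
move=> _ [t /= + <-]; rewrite in_itv/= andbT => t0.
rewrite mulrC EFinM -muleA; have W0 := W_gt0 t0.
rewrite lee_pdivrMl// (le_trans (IJ t0 x0))// (le_trans (JK t t0))//.
by rewrite -EFinM lee_fin mulrC.
Qed.

Lemma sup_product_ge0 : 0 <= ereal_sup [set harmonic_sup x * I x | x in `]0%R, +oo[].
Proof.
have pos : (`]0%R, +oo[%classic : set R) 1%R by rewrite /= in_itv/= ltr01.
apply: le_trans (ereal_sup_ubound (imageP _ pos)); apply: mule_ge0; last exact: I_ge0.
apply: le_trans (ereal_sup_ubound (imageP _ pos)).
by rewrite lee_fin ltW// !mulr_gt0 ?invr_gt0 ?addr_gt0 ?V_gt0 ?W_gt0.
Qed.

(** Only the diagonal x = t = s is used, where the harmonic factor is V(s) / 2. This half and the 2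
    in [JI] make up the 4. *)
Lemma sup_product_ge (C : R) :
  ereal_sup [set harmonic_sup x * I x | x in `]0%R, +oo[] <= C%:E ->
  forall s : R, (0 < s)%R -> J s <= (4 * C * W s)%:E.
Proof.
move=> SC s s0; have W0 := W_gt0 s0; have V0 := V_gt0 s0.
have : (V s * (V s / (V s + V s)) * (W s)^-1)%:E * I s <= C%:E.
  apply: le_trans SC; apply: (@le_trans _ _ (harmonic_sup s * I s)).
    apply: lee_wpmul2r; first exact: I_ge0.
    by apply: ereal_sup_ubound; exists s; rewrite //= in_itv/= s0.
  by apply: ereal_sup_ubound; exists s; rewrite //= in_itv/= s0.
have -> : (V s * (V s / (V s + V s)) * (W s)^-1 = (4 * W s)^-1 * (2 * V s))%R.
  by field; rewrite !gt_eqF// addr_gt0.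
rewrite EFinM -muleA lee_pdivrMl ?mulr_gt0// => h.
by apply: (le_trans (JI s0)); apply: (le_trans h); rewrite -EFinM lee_fin mulrAC.
Qed.

End two_sided_sup.

(** The upper bound is assumed only against real constants; for [b = +oo] it is trivial because
    [lambda] is positive. *)
Lemma eqv_upto_of_bounds (R : realType) (lambda K k : R) (a b : \bar R) :
  1 <= lambda -> K <= lambda -> k <= lambda -> (0 <= a)%E -> (0 <= b)%E ->
  (forall C : R, 0 <= C -> (b <= C%:E)%E -> (a <= (K * C)%:E)%E) ->
  (b <= k%:E * a)%E -> eqv_upto lambda a b.
Proof.
move=> l1 Kl kl a0 b0 H bk; have l0 : 0 < lambda by exact: lt_le_trans l1.
apply/andP; split.
  by rewrite lee_pdivrMl// (le_trans bk)// lee_wpmul2r// lee_fin.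
have [->|bfin] := eqVneq b +oo%E; first by rewrite gt0_muley ?lte_fin// leey.
have bE : b = (fine b)%:E by rewrite fineK// ge0_fin_numE// ltey.
have fb : 0 <= fine b by exact: fine_ge0.
rewrite bE -EFinM (le_trans (H _ fb _)) -?bE// lee_fin.
exact: ler_wpM2r.
Qed.

(** * Weighted Morrey norms *)

Lemma measurable_abse_poweR d (T : measurableType d) (R : realType) (D : set T)
    (f : T -> \bar R) (p : R) : measurable_fun D f ->
  measurable_fun D (fun x => (`|f x| `^ p)%E).
Proof.
move=> mf; apply: (measurableT_comp (measurable_poweR _)).
exact: measurableT_comp.
Qed.

Section norms.
Context {R : realType}.
Local Open Scope ereal_scope.

Lemma morrey_normE n (p th : R) (omega : R -> \bar R) (v f : leb_space R n -> \bar R)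
    (A : R -> set (leb_space R n)) : (0 < p)%R -> (0 < th)%R ->
  wnorm (lebesgue1 R) `]0%R, +oo[ th%:E omega
    (fun t : R => wnorm (lebesgue R n) (A t) p%:E v f) =
  (\int[lebesgue1 R]_(t in `]0%R, +oo[) (`|omega t| `^ th *
     (\int[lebesgue R n]_(y in A t) `|f y * v y| `^ p) `^ (th / p))) `^ th^-1.
Proof.
move=> p0 th0; rewrite /wnorm norm_onE ?gt_eqF//; congr (_ `^ _).
apply: eq_integral => t _; rewrite norm_onE ?gt_eqF//.
rewrite abseM poweRM ?abse_ge0// muleC; congr (_ * _).
by rewrite gee0_abs ?poweR_ge0// -poweRrM mulrC.
Qed.

Lemma to_expE (p q : R) : (0 < q)%R -> (q < p)%R ->
  to_exp p%:E q%:E = ((q^-1 - p^-1)^-1)%:E.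
Proof.
move=> q0 qp; have p0 := lt_trans q0 qp.
rewrite /to_exp lte_fin qp !inver !gt_eqF// -EFinB inver gt_eqF//.
by rewrite subr_gt0 ltf_pV2.
Qed.

Lemma poweRK (x : \bar R) (p : R) : (0 < p)%R -> 0 <= x -> (x `^ p^-1) `^ p = x.
Proof. by move=> p0 x0; rewrite -poweRrM mulVf ?gt_eqF// poweRe1. Qed.

End norms.

(** * Application to the weighted Morrey norms *)

Section weights.
Context {R : realType} (n : nat).
Variables (p1 p2 th1 th2 : R).
Hypotheses (p1_0 : 0 < p1) (p2_0 : 0 < p2) (th1_0 : 0 < th1) (th2_0 : 0 < th2).
Hypotheses (p21 : p2 < p1) (th12 : th1 <= p2) (pth : p2 < th2).
Variables (v1 v2 : leb_space R n -> \bar R) (omega1 omega2 : R -> \bar R).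
Hypotheses (wv1 : weight (lebesgue R n) v1) (wv2 : weight (lebesgue R n) v2).
Hypotheses (Oomega1 : cOmega th1%:E omega1) (Oomega2 : Omega th2%:E omega2).
Local Notation V := (Vtilde p1%:E p2%:E v1 v2).
Hypothesis Vadm : admissible V.
Local Notation leb := (lebesgue R n).
Local Notation B := (@B0 R n).

Definition r12 : R := (p2^-1 - p1^-1)^-1.
Local Notation r := r12.

Lemma r12_gt0 : 0 < r.
Proof. by rewrite invr_gt0 subr_gt0 ltf_pV2. Qed.

Lemma r12V : r^-1 + p1^-1 = p2^-1.
Proof. by rewrite invrK subrK. Qed.

Definition density (y : leb_space R n) : \bar R :=
  (`|(v1 y)^-1 * v2 y| `^ r)%E.

Lemma density_ge0 y : (0 <= density y)%E.
Proof. exact: poweR_ge0. Qed.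

Lemma measurable_density : measurable_fun setT density.
Proof.
have [mv1 _] := wv1; have [mv2 _] := wv2; apply: measurable_abse_poweR.
by apply: emeasurable_funM; [exact: (measurableT_comp measurable_inve)|exact: mv2].
Qed.

Lemma VtildeE t : V t = ((\int[leb]_(y in B t) density y) `^ r^-1)%E.
Proof. by rewrite /Vtilde to_expE// norm_onE// gt_eqF// r12_gt0. Qed.

Definition Vr t : R := fine (V t).

Let Vmono (s t : R) : 0 <= s -> s < t -> (V s < V t)%E.
Proof.
case: Vadm => _ h _ _ s0 st; apply: h => //; rewrite in_itv/= andbT//.
exact: le_trans (ltW st).
Qed.

Lemma VrE (t : R) : 0 <= t -> V t = (Vr t)%:E.
Proof.
move=> t0; rewrite fineK// ge0_fin_numE; last by rewrite VtildeE poweR_ge0.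
by apply: (@lt_le_trans _ _ (V (t + 1))); [apply: Vmono => //; rewrite ltrDl|rewrite leey].
Qed.

Lemma Vr_gt0 (t : R) : 0 < t -> 0 < Vr t.
Proof.
move=> t0; have := Vmono (lexx _) t0; case: Vadm => _ _ -> _.
by rewrite VrE ?(ltW t0)// lte_fin.
Qed.

Lemma Vr_nd (s t : R) : 0 < s -> s <= t -> Vr s <= Vr t.
Proof.
move=> s0; rewrite le_eqVlt => /orP[/eqP->//|st]; have t0 := lt_trans s0 st.
by rewrite -lee_fin -!VrE ?(ltW s0) ?(ltW t0)// ltW// Vmono// ltW.
Qed.

Let V_within (t : R) : 0 <= t ->
  Vr x @[x --> within `[0, +oo[%classic (nbhs t)] --> Vr t.
Proof.
move=> t0; case: Vadm => /subspace_continuousP /(_ t) cV _ _ _.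
by apply: fine_cvg; rewrite -VrE//; apply: cV; rewrite /= in_itv/= t0.
Qed.

Lemma Vr_continuous (t : R) : 0 < t -> {for t, continuous Vr}.
Proof.
move=> t0; apply/cvgrPdist_le => /= e e0.
have /cvgrPdist_le/(_ _ e0) := V_within (ltW t0).
rewrite near_withinE => h.
apply: filterS2 h (lt_nbhsr t0) => s h s0; apply: h.
by rewrite /= in_itv/= ltW.
Qed.

Lemma Vr_small (e : R) : 0 < e -> exists2 t : R, 0 < t & Vr t <= e.
Proof.
move=> e0; have /cvgrPdist_le/(_ _ e0) := V_within (lexx 0).
have -> : Vr 0 = 0 by rewrite /Vr; case: Vadm => _ _ -> _.
rewrite near_withinE => /nbhs_ballP[d /= d0 hd].
exists (d / 2); first by rewrite divr_gt0.
have := hd (d / 2); rewrite /ball/= !sub0r !normrN in_itv/= andbT.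
rewrite !ger0_norm ?divr_ge0 ?(ltW d0)//; first last.
  by apply/ltW/Vr_gt0; rewrite divr_gt0.
by move=> /(_ _ isT); apply; rewrite ltr_pdivrMr// ltr_pMr// ltr1n.
Qed.

Lemma int_density (t : R) : 0 < t ->
  (\int[leb]_(y in B t) density y = (Vr t `^ r)%:E)%E.
Proof.
move=> t0; rewrite -poweR_EFin -VrE ?(ltW t0)// VtildeE poweRK ?r12_gt0//.
by apply: integral_ge0 => y _; exact: density_ge0.
Qed.

(** Almost everywhere f v2 = (v2 / v1) (f v1), as [v1] is positive and finite there, and p2/r +
    p2/p1 = 1. *)
Lemma density_hoelder (f : leb_space R n -> \bar R) E :
  measurable_fun setT f -> measurable E ->
  (\int[leb]_(y in E) (`|f y * v2 y| `^ p2) <=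
   (\int[leb]_(y in E) density y) `^ (p2 / r) *
   (\int[leb]_(y in E) (`|f y * v1 y| `^ p1)) `^ (p2 / p1))%E.
Proof.
move=> mf mE; have [mv1 av1] := wv1; have [mv2 av2] := wv2.
have mp (p : R) v : measurable_fun setT v ->
    measurable_fun E (fun y => (`|f y * v y| `^ p)%E).
  move=> mv; apply: measurable_funTS; apply: measurable_abse_poweR.
  exact: emeasurable_funM.
apply: integral_hoelder.
- exact: mE.
- exact: (measurable_funTS measurable_density).
- exact: mp.
- exact: mp.
- exact: density_ge0.
- by move=> y; exact: poweR_ge0.
- by move=> y; exact: poweR_ge0.
- by rewrite divr_gt0// r12_gt0.
- by rewrite divr_gt0.
- by rewrite -mulrDr r12V mulfV// gt_eqF.
move: av1 av2; apply: filterS2 => y; rewrite /density.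
case: (v1 y) => [x| |]; rewrite ?ltxx ?andbF// lte_fin ltry andbT => x0.
move=> _; rewrite -!poweRrM.
have -> : r * (p2 / r) = p2 by rewrite mulrC divfK// gt_eqF// r12_gt0.
have -> : p1 * (p2 / p1) = p2 by rewrite mulrC divfK// gt_eqF.
rewrite -poweRM ?abse_ge0// -abseM inver gt_eqF//.
suff -> : ((x^-1)%:E * v2 y * (f y * x%:E) = f y * v2 y)%E by [].
rewrite muleC -muleA (muleA x%:E) -EFinM mulfV ?gt_eqF// mul1e.
by [].
Qed.

Definition psi1 (t : R) : \bar R := (`|omega1 t| `^ th1)%E.
Definition psi2 (t : R) : \bar R := (`|omega2 t| `^ th2)%E.

Lemma psi1_ge0 t : (0 <= psi1 t)%E. Proof. exact: poweR_ge0. Qed.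
Lemma psi2_ge0 t : (0 <= psi2 t)%E. Proof. exact: poweR_ge0. Qed.

Lemma measurable_psi1 : measurable_fun (`]0%R, +oo[%classic : set (leb_line R)) psi1.
Proof.
by case: Oomega1 => -[mo _] _; exact: measurable_abse_poweR.
Qed.

Lemma measurable_psi2 : measurable_fun (`]0%R, +oo[%classic : set (leb_line R)) psi2.
Proof.
by case: Oomega2 => -[mo _] _; exact: measurable_abse_poweR.
Qed.

Let th1V : 0 < th1^-1. Proof. by rewrite invr_gt0. Qed.
Let th2V : 0 < th2^-1. Proof. by rewrite invr_gt0. Qed.

Lemma psi1_head_fin (t : R) : 0 < t ->
  (\int[lebesgue1 R]_(s in `]0%R, t[) psi1 s < +oo)%E.
Proof.
move=> t0; case: Oomega1 => _ /(_ t t0); rewrite norm_onE ?gt_eqF// => /andP[_].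
by apply: lty_poweRy; rewrite gt_eqF.
Qed.

Lemma psi2_tail_fin (t : R) : 0 < t ->
  (\int[lebesgue1 R]_(s in `]t, +oo[) psi2 s < +oo)%E.
Proof.
move=> t0; case: Oomega2 => _ /(_ t t0); rewrite norm_onE ?gt_eqF// => /andP[_].
by apply: lty_poweRy; rewrite gt_eqF.
Qed.

Local Notation w := (head psi1).
Local Notation tau := (tailr psi2).

Lemma psi1_head_gt0 (t : R) : 0 < t -> 0 < w t.
Proof.
move=> t0; case: Oomega1 => _ /(_ t t0); rewrite norm_onE ?gt_eqF// => /andP[h _].
rewrite -lte_fin -(headE (fun s _ => psi1_ge0 s) psi1_head_fin t0).
by apply: gt0_poweR h => //; apply: integral_ge0 => s _; exact: psi1_ge0.
Qed.

Lemma psi2_tail_gt0 (t : R) : 0 < t -> 0 < tau t.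
Proof.
move=> t0; case: Oomega2 => _ /(_ t t0); rewrite norm_onE ?gt_eqF// => /andP[h _].
rewrite -lte_fin -(tailrE (fun s _ => psi2_ge0 s) psi2_tail_fin t0).
by apply: gt0_poweR h => //; apply: integral_ge0 => s _; exact: psi2_ge0.
Qed.

Lemma norm_omega1E (t : R) : 0 < t ->
  norm_on (lebesgue1 R) `]0%R, t[ th1%:E omega1 = (w t `^ th1^-1)%:E.
Proof.
move=> t0; rewrite norm_onE ?gt_eqF// -poweR_EFin.
by rewrite -(headE (fun s _ => psi1_ge0 s) psi1_head_fin t0).
Qed.

Lemma norm_omega2E (t : R) : 0 < t ->
  norm_on (lebesgue1 R) `]t, +oo[ th2%:E omega2 = (tau t `^ th2^-1)%:E.
Proof.
move=> t0; rewrite norm_onE ?gt_eqF// -poweR_EFin.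
by rewrite -(tailrE (fun s _ => psi2_ge0 s) psi2_tail_fin t0).
Qed.

Local Notation LM := (LM_norm p2%:E th2%:E omega2 v2).
Local Notation CLM := (cLM_norm p1%:E th1%:E omega1 v1).

(** The embedding requires a positive bound on the norm of [f], which may be 0; hence [X + eps],
    with [eps] removed at the end. The constants are the [th2]-th roots of 4^(th2/p2) and
    4^(th2/th1). *)
Lemma norm_upper_bound (C : R) : 0 <= C ->
  (forall (x : R) (t c : nat -> R) (N : nat), 0 < x ->
    (forall k, 0 < t k) -> (forall k, t k.+1 <= t k) -> (forall k, 0 <= c k) ->
    \sum_(k < N) c k <= 1 ->
    \sum_(k < N) (tau (t k.+1) - tau (t k)) *
      (Num.min (Vr (t k.+1)) (Vr x) `^ th2 * c k `^ (th2 / p1)) <=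
    C `^ th2 * w x `^ (th2 / th1)) ->
  forall f, cLM p1%:E th1%:E omega1 v1 f ->
    (LM f <= (4 `^ p2^-1 * 4 `^ th1^-1 * C)%:E * CLM f)%E.
Proof.
move=> C0 DH f [mf fout fX].
have r0 := r12_gt0.
pose X := fine (CLM f).
have X0 : (0 <= CLM f)%E by rewrite /cLM_norm morrey_normE// poweR_ge0.
have XE : CLM f = X%:E by rewrite fineK// ge0_fin_numE.
have X_ge0 : 0 <= X by rewrite -lee_fin -XE.
pose a y := (`|f y * v1 y| `^ p1)%E.
pose b y := (`|f y * v2 y| `^ p2)%E.
have mp (p : R) v : measurable_fun setT v ->
    measurable_fun setT (fun y => (`|f y * v y| `^ p)%E).
  by move=> mv; apply: measurable_abse_poweR; exact: emeasurable_funM.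
have ma : measurable_fun setT a by apply: mp; case: wv1.
have mb : measurable_fun setT b by apply: mp; case: wv2.
have a0 y : (0 <= a y)%E by exact: poweR_ge0.
have b0 y : (0 <= b y)%E by exact: poweR_ge0.
have Ffin (t : R) : 0 < t -> (\int[leb]_(y in ~` B t) a y < +oo)%E.
  move=> /fout; rewrite /wnorm norm_onE ?gt_eqF// => h.
  by apply: lty_poweRy h; rewrite gt_eqF// invr_gt0.
have exps : (p2 / p1) * (th2 / p2) / (th1 / p1) = th2 / th1.
  by field; rewrite !gt_eqF.
have key (eps : R) : 0 < eps ->
    (LM f <= (4 `^ p2^-1 * 4 `^ th1^-1 * C * (X + eps))%:E)%E.
  move=> e0; have Xe : 0 < X + eps by rewrite ltr_wpDl.
  have FX : (\int[lebesgue1 R]_(t in `]0%R, +oo[)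
      (psi1 t * (\int[leb]_(y in ~` B t) a y) `^ (th1 / p1)) <=
      ((X + eps) `^ th1)%:E)%E.
    have -> : (\int[lebesgue1 R]_(t in `]0%R, +oo[)
        (psi1 t * (\int[leb]_(y in ~` B t) a y) `^ (th1 / p1)) =
        (CLM f) `^ th1)%E.
      rewrite /cLM_norm morrey_normE// poweRK// integral_ge0// => t _.
      by rewrite mule_ge0 ?poweR_ge0.
    by rewrite XE poweR_EFin lee_fin ler_powR_base ?lerDl// ltW.
  have := @embedding_bound _ _ _ leb B (@measurable_B0 R n) (@B0_nd R n) a b density
    ma mb measurable_density a0 b0 density_ge0 (p2 / r) (p2 / p1) r
    (divr_gt0 p2_0 r0) (divr_gt0 p2_0 p1_0) r0
    (fun E => @density_hoelder f E mf) Vr int_density Vr_gt0 Vr_nd Vr_continuous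
    Vr_small psi1 psi2 measurable_psi1 (fun t _ => psi1_ge0 t) psi1_head_fin
    measurable_psi2 (fun t _ => psi2_ge0 t) psi2_tail_fin psi1_head_gt0
    (th2 / p2) (th1 / p1) (C `^ th2).
  rewrite exps.
  have -> : r * (p2 / r) * (th2 / p2) = th2.
    by field; rewrite !gt_eqF.
  have -> : p2 / p1 * (th2 / p2) = th2 / p1 by field; rewrite !gt_eqF.
  move=> /(_ _ _ _ (powR_ge0 _ _) DH _ (powR_gt0 th1 Xe) Ffin FX) H.
  rewrite /LM_norm morrey_normE//.
  have rhsK (z : R) : 0 <= z -> z%:E = ((z%:E `^ th2) `^ th2^-1)%E.
    by move=> z0; rewrite -poweRrM mulfV ?gt_eqF// poweRe1.
  rewrite [leRHS]rhsK; last by rewrite !mulr_ge0 ?powR_ge0// ltW.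
  apply: lee_poweR; first exact: ltW.
    by apply: integral_ge0 => t _; rewrite mule_ge0 ?poweR_ge0.
  apply: (le_trans (H _ _ _)).
  - by rewrite ltr_pdivlMr// mul1r.
  - by rewrite divr_gt0.
  - by rewrite ler_pM2r// invr_gt0.
  rewrite poweR_EFin lee_fin.
  rewrite !powRM ?mulr_ge0 ?powR_ge0 ?(ltW Xe)// -!powRrM.
  rewrite (mulrC th1^-1) (mulrC p2^-1) le_eqVlt; apply/orP; left; apply/eqP.
  rewrite (_ : th1 * (th2 / th1) = th2); last by field; rewrite gt_eqF.
  by rewrite -!mulrA; congr (_ * _); rewrite mulrCA.
rewrite XE -EFinM; apply/lee_addgt0Pr => e e0.
set L := 4 `^ p2^-1 * 4 `^ th1^-1 * C in key *.
have L0 : 0 <= L by rewrite !mulr_ge0// powR_ge0.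
have L1 : 0 < L + 1 by rewrite ltr_wpDl.
apply: (le_trans (key _ (divr_gt0 e0 L1))); rewrite -EFinD lee_fin mulrDr lerD2l.
by rewrite mulrA ler_pdivrMr// mulrC ler_pM2l// lerDl.
Qed.

Section test_norms.
Variables (s c : nat -> R) (N : nat).
Hypotheses (s0 : forall k, 0 < s k) (sS : forall k, s k.+1 <= s k).
Hypothesis c0 : forall k, 0 <= c k.

Local Notation G := (step_fun B s c N).
Let volume k : R := Vr (s k) `^ r - Vr (s k.+1) `^ r.

Let volumeE k : (\int[leb]_(y in B (s k) `\` B (s k.+1)) density y = (volume k)%:E)%E.
Proof.
exact: (volume_shell (@measurable_B0 R n) (@B0_nd R n) measurable_density
  density_ge0 int_density).
Qed.

Let mG : measurable_fun setT (fun y => (G y)%:E).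
Proof. by apply/measurable_EFinP; exact: measurable_step_fun (@measurable_B0 R n) _ _ _. Qed.

(* With this profile both weighted powers of the test function have the common
   density [density], the case of equality in Hoelder's inequality. *)
Definition test_fun y : \bar R := ((G y)%:E * ((v1 y)^-1 * density y `^ p1^-1))%E.

Lemma measurable_test_fun : measurable_fun setT test_fun.
Proof.
have [mv1 _] := wv1; apply: emeasurable_funM; first exact: mG.
apply: emeasurable_funM; first exact: (measurableT_comp measurable_inve).
exact: (measurableT_comp (measurable_poweR _) measurable_density).
Qed.

(** With z = v2 / v1, the function times [v1] is G z^(r/p1), and times [v2] it is G z^(1 + r/p1) = G
    z^(r/p2). *)
Let test_density : {ae leb, forall y,
  (`|test_fun y * v1 y| `^ p1 = (G y `^ p1)%:E * density y /\
   `|test_fun y * v2 y| `^ p2 = (G y `^ p2)%:E * density y)%E}.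
Proof.
have [_ av1] := wv1; have [_ av2] := wv2.
move: av1 av2; apply: filterS2 => y; rewrite /test_fun /density.
case: (v1 y) => [x| |]; rewrite ?ltxx ?andbF// lte_fin ltry andbT => x0.
case: (v2 y) => [z| |]; rewrite ?ltxx ?andbF// lte_fin ltry andbT => z0.
have G0 : 0 <= G y := step_fun_ge0 B s N c0 y.
rewrite inver gt_eqF// -!EFinM !abse_EFin !poweR_EFin -?EFinM.
have q0 : 0 < x^-1 * z by rewrite mulr_gt0// invr_gt0.
rewrite !(ger0_norm (ltW q0)) -powRrM; have D0 := powR_gt0 (r / p1) q0.
split.
  have -> : G y * (x^-1 * (x^-1 * z) `^ (r / p1)) * x = G y * (x^-1 * z) `^ (r / p1).
    by rewrite -mulrA mulrAC mulVf ?mul1r// gt_eqF.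
  rewrite ger0_norm ?mulr_ge0 ?(ltW D0)// powRM ?(ltW D0)//.
  by rewrite -powRrM divfK// gt_eqF.
have -> : G y * (x^-1 * (x^-1 * z) `^ (r / p1)) * z = G y * (x^-1 * z) `^ (1 + r / p1).
  rewrite powRD; last by rewrite (gt_eqF q0) implybT.
  by rewrite (powRr1 (ltW q0)) -!mulrA; congr (_ * (_ * _)); rewrite mulrC.
rewrite ger0_norm ?mulr_ge0 ?powR_ge0// powRM ?powR_ge0// -powRrM.
congr (_ * _ `^ _)%:E.
have -> : 1 + r / p1 = r * p2^-1.
  by rewrite -r12V mulrDr mulfV// gt_eqF// r12_gt0.
by rewrite divfK// gt_eqF.
Qed.

Let test_int (p : R) (v : leb_space R n -> \bar R) E : measurable E ->
  measurable_fun setT v ->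
  {ae leb, forall y, (`|test_fun y * v y| `^ p = (G y `^ p)%:E * density y)%E} ->
  (\int[leb]_(y in E) (`|test_fun y * v y| `^ p) =
   \int[leb]_(y in E) ((G y `^ p)%:E * density y))%E.
Proof.
move=> mE mv ae; apply: ge0_ae_eq_integral.
- exact: mE.
- apply: measurable_funTS; apply: measurable_abse_poweR.
  by apply: emeasurable_funM; [exact: measurable_test_fun|exact: mv].
- apply: measurable_funTS.
  exact: (measurable_step_weight (@measurable_B0 R n) measurable_density).
- by move=> y _; exact: poweR_ge0.
- by move=> y _; apply: mule_ge0; [rewrite lee_fin powR_ge0|exact: density_ge0].
- by apply: filterS ae => y + _.
Qed.

Let test_int1 E : measurable E ->
  (\int[leb]_(y in E) (`|test_fun y * v1 y| `^ p1) =
   \int[leb]_(y in E) ((G y `^ p1)%:E * density y))%E.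
Proof.
move=> mE; apply: (test_int mE (proj1 wv1)).
by apply: filterS test_density => y [].
Qed.

Let test_int2 E : measurable E ->
  (\int[leb]_(y in E) (`|test_fun y * v2 y| `^ p2) =
   \int[leb]_(y in E) ((G y `^ p2)%:E * density y))%E.
Proof.
move=> mE; apply: (test_int mE (proj1 wv2)).
by apply: filterS test_density => y [].
Qed.

Let A := \sum_(k < N) c k `^ p1 * volume k.

Let mCB t : measurable (~` B t).
Proof. by apply: measurableC; exact: measurable_B0. Qed.

Lemma test_fun_outer_norm :
  (CLM test_fun <= (w (s 0%N) `^ th1^-1 * A `^ p1^-1)%:E)%E.
Proof.
have th10 : th1 != 0 by rewrite gt_eqF.
have e0 : 0 < th1 / p1 by rewrite divr_gt0.
rewrite /cLM_norm morrey_normE//.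
have -> : (\int[lebesgue1 R]_(t in `]0%R, +oo[) (`|omega1 t| `^ th1 *
      (\int[leb]_(y in ~` B t) `|test_fun y * v1 y| `^ p1) `^ (th1 / p1)) =
    \int[lebesgue1 R]_(t in `]0%R, +oo[) (psi1 t *
      (\int[leb]_(y in ~` B t) ((G y `^ p1)%:E * density y)) `^ (th1 / p1)))%E.
  apply: eq_integral; by move=> t _; rewrite test_int1//; exact: mCB.
have H := @step_outer_norm_le _ _ _ leb B (@measurable_B0 R n) (@B0_nd R n) density
  measurable_density density_ge0 s c volume N s0 sS volumeE psi1 measurable_psi1
  (fun t _ => psi1_ge0 t) psi1_head_fin p1 (th1 / p1) p1_0 e0.
apply: (le_trans (lee_poweR _ _ H)); first exact: ltW.
  apply: integral_ge0 => t _; apply: mule_ge0; first exact: psi1_ge0.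
  exact: poweR_ge0.
rewrite poweR_EFin lee_fin powRM ?powR_ge0//; last exact/ltW/psi1_head_gt0.
by rewrite -powRrM mulrAC mulfV// mul1r.
Qed.

Lemma test_fun_cLM : cLM p1%:E th1%:E omega1 v1 test_fun.
Proof.
split; first exact: measurable_test_fun.
  move=> t t0; rewrite /wnorm norm_onE ?gt_eqF// test_int1//.
  apply: poweR_lty.
  apply: (@le_lt_trans _ _ (\sum_(k < N) c k `^ p1 * volume k)%:E); last exact: ltry.
  exact: (step_weight_le (@measurable_B0 R n) (@B0_nd R n) measurable_density
    density_ge0 c N sS volumeE p1_0 (mCB t)).
by apply: (le_lt_trans test_fun_outer_norm); exact: ltry.
Qed.

Lemma test_fun_inner_norm :
  ((\sum_(k < N) (c k `^ p2 * volume k) `^ (th2 / p2) *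
     (tau (s k) - (if nat_of_ord k is j.+1 then tau (s j) else 0)))%:E <=
   LM test_fun `^ th2)%E.
Proof.
have e0 : 0 < th2 / p2 by rewrite divr_gt0.
rewrite /LM_norm morrey_normE// poweRK//; last first.
  apply: integral_ge0 => t _; apply: mule_ge0; first exact: psi2_ge0.
  exact: poweR_ge0.
have -> : (\int[lebesgue1 R]_(t in `]0%R, +oo[) (`|omega2 t| `^ th2 *
      (\int[leb]_(y in B t) `|test_fun y * v2 y| `^ p2) `^ (th2 / p2)) =
    \int[lebesgue1 R]_(t in `]0%R, +oo[) (psi2 t *
      (\int[leb]_(y in B t) ((G y `^ p2)%:E * density y)) `^ (th2 / p2)))%E.
  apply: eq_integral; by move=> t _; rewrite test_int2//; exact: measurable_B0.
exact: (step_inner_norm_ge (@measurable_B0 R n) (@B0_nd R n) measurable_density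
  density_ge0 c N s0 sS volumeE measurable_psi2 (fun t _ => psi2_ge0 t) psi2_tail_fin
  p2 e0).
Qed.

Lemma norm_lower_bound (C : R) : 0 <= C ->
  (forall f, cLM p1%:E th1%:E omega1 v1 f -> (LM f <= C%:E * CLM f)%E) ->
  \sum_(k < N) (c k `^ p2 * volume k) `^ (th2 / p2) *
     (tau (s k) - (if nat_of_ord k is j.+1 then tau (s j) else 0)) <=
  C `^ th2 * (w (s 0%N) `^ (th2 / th1) * A `^ (th2 / p1)).
Proof.
move=> C0 /(_ _ test_fun_cLM) H; rewrite -lee_fin.
apply: (le_trans test_fun_inner_norm).
apply: (@le_trans _ _ ((C * (w (s 0%N) `^ th1^-1 * A `^ p1^-1))%:E `^ th2)%E).
  apply: lee_poweR; first exact: ltW.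
    by rewrite /LM_norm morrey_normE// poweR_ge0.
  apply: (le_trans H); rewrite EFinM; apply: lee_wpmul2l => //.
  exact: test_fun_outer_norm.
rewrite poweR_EFin lee_fin !powRM ?mulr_ge0 ?powR_ge0// -!powRrM.
by rewrite (mulrC th1^-1) (mulrC p1^-1).
Qed.

End test_norms.
Definition Wr t : R := w t `^ th1^-1.
Definition tlr t : R := tau t `^ th2^-1.

Lemma Wr_gt0 (t : R) : 0 < t -> 0 < Wr t.
Proof. by move=> t0; rewrite powR_gt0// psi1_head_gt0. Qed.

Lemma tlr_gt0 (t : R) : 0 < t -> 0 < tlr t.
Proof. by move=> t0; rewrite powR_gt0// psi2_tail_gt0. Qed.

Lemma tlr_ni (s t : R) : 0 < s -> s <= t -> tlr t <= tlr s.
Proof.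
move=> s0 st; apply: ler_powR_base; first exact: ltW.
  by apply/ltW/psi2_tail_gt0; exact: lt_le_trans st.
exact: (tailr_ni measurable_psi2 (fun t _ => psi2_ge0 t) psi2_tail_fin).
Qed.

Lemma tlrK (t : R) : 0 < t -> tau t = tlr t `^ th2.
Proof.
move=> t0; rewrite /tlr -powRrM mulVf ?gt_eqF// powRr1//.
exact/ltW/psi2_tail_gt0.
Qed.

Lemma WrK (C x : R) : 0 <= C -> (C * Wr x) `^ th2 = C `^ th2 * w x `^ (th2 / th1).
Proof. by move=> C0; rewrite powRM ?powR_ge0// -powRrM (mulrC th1^-1). Qed.

Let r0 := r12_gt0.
Local Notation upper_const := (4 `^ p2^-1 * 4 `^ th1^-1).

Let upper (C : R) : 0 <= C ->
  (forall (x : R) (t c : nat -> R) (N : nat), 0 < x ->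
    (forall k, 0 < t k) -> (forall k, t k.+1 <= t k) -> (forall k, 0 <= c k) ->
    \sum_(k < N) c k <= 1 ->
    \sum_(k < N) (tlr (t k.+1) `^ th2 - tlr (t k) `^ th2) *
      (Num.min (Vr (t k.+1)) (Vr x) `^ th2 * c k `^ (th2 / p1)) <=
    (C * Wr x) `^ th2) ->
  forall f, cLM p1%:E th1%:E omega1 v1 f -> (LM f <= (upper_const * C)%:E * CLM f)%E.
Proof.
move=> C0 H; apply: norm_upper_bound; first exact: C0.
move=> x t c N x0 t0 tS c0 c1; rewrite -WrK//; apply: le_trans (H x t c N x0 t0 tS c0 c1).
by apply: ler_sum => k _; rewrite (tlrK (t0 k)) (tlrK (t0 k.+1)).
Qed.

Lemma norm_le_of_sup (C : R) : p1 <= th2 -> 0 <= C ->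
  (forall t x : R, 0 < t -> 0 < x -> Num.min (Vr t) (Vr x) * tlr t <= C * Wr x) ->
  forall f, cLM p1%:E th1%:E omega1 v1 f -> (LM f <= (upper_const * C)%:E * CLM f)%E.
Proof.
move=> pt C0 H; apply: upper => //.
exact: (discrete_hardy_of_sup p1_0 th2_0 Vr_gt0 tlr_gt0 Wr_gt0 pt C0 H).
Qed.

Lemma norm_le_of_sum (C : R) : th2 < p1 -> 0 < C ->
  (forall (x : R) (t : nat -> R) (N : nat), 0 < x ->
    (forall k, 0 < t k) -> (forall k, t k.+1 <= t k) ->
    \sum_(k < N) (tlr (t k.+1) `^ rho p1 th2 - tlr (t k) `^ rho p1 th2) *
      Num.min (Vr (t k.+1)) (Vr x) `^ rho p1 th2 <= (C * Wr x) `^ rho p1 th2) ->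
  forall f, cLM p1%:E th1%:E omega1 v1 f -> (LM f <= (upper_const * C)%:E * CLM f)%E.
Proof.
move=> tp C0 H; apply: upper; first exact: ltW.
exact: (discrete_hardy_of_sum p1_0 th2_0 Vr_gt0 tlr_gt0 Wr_gt0 tlr_ni tp C0 H).
Qed.

Let test (s c : nat -> R) (N : nat) (C : R) : (forall k, 0 < s k) ->
  (forall k, s k.+1 <= s k) -> (forall k, 0 <= c k) -> 0 <= C ->
  (forall f, cLM p1%:E th1%:E omega1 v1 f -> (LM f <= C%:E * CLM f)%E) ->
  \sum_(k < N) (c k `^ p2 * (Vr (s k) `^ r - Vr (s k.+1) `^ r)) `^ (th2 / p2) *
     (tlr (s k) `^ th2 - (if nat_of_ord k is j.+1 then tlr (s j) `^ th2 else 0)) <=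
  (C * Wr (s 0%N)) `^ th2 *
    (\sum_(k < N) c k `^ p1 * (Vr (s k) `^ r - Vr (s k.+1) `^ r)) `^ (th2 / p1).
Proof.
move=> s0 sS c0 C0 H; rewrite WrK// -mulrA.
apply: le_trans (norm_lower_bound N s0 sS c0 C0 H); apply: ler_sum => k _.
rewrite le_eqVlt; apply/orP; left; apply/eqP; congr (_ * (_ - _)).
  exact: (esym (tlrK (s0 k))).
by case: (nat_of_ord k) => [//|j]; exact: (esym (tlrK (s0 j))).
Qed.

Lemma dyadic_volume (x : R) : 0 < x -> exists s : nat -> R, [/\ s 0%N = x,
  forall k, 0 < s k, forall k, s k.+1 <= s k &
  forall k, Vr (s k) = Vr (s 0%N) * 2^-1 ^+ k].
Proof.
move=> x0; have [s [s0 sp Vs sS]] := dyadic_sequence x0 Vr_continuous Vr_nd Vr_small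
  (Vr_gt0 x0).
by exists s; split => // k; rewrite s0.
Qed.

(** Test with one shell, from [x] down to the radius where [Vr] is half of [Vr x], and coefficient
    1. *)
Lemma sup_le_of_norm (C x : R) : 0 <= C -> 0 < x ->
  (forall f, cLM p1%:E th1%:E omega1 v1 f -> (LM f <= C%:E * CLM f)%E) ->
  Vr x * tlr x <= (1 - 2^-1 `^ r) `^ (- r^-1) * C * Wr x.
Proof.
move=> C0 x0 H; have [s [sx s0 sS Vs]] := dyadic_volume x0.
apply: (sup_of_test th2_0 r0 r12V Vr_gt0 tlr_gt0 Wr_gt0 C0 x0).
have := @test s (fun=> 1) 1 C s0 sS (fun=> ler01) C0 H.
rewrite !big_ord_recr !big_ord0/= !add0r !powR1 !mul1r subr0.
have -> : Vr (s 1%N) = 2^-1 * Vr (s 0%N) by rewrite Vs expr1 mulrC.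
rewrite sx (@powRM _ 2^-1 (Vr x)) ?invr_ge0 ?(ltW (Vr_gt0 x0))//.
by rewrite mulrBl mul1r.
Qed.

Lemma sum_le_of_norm (C : R) (s : nat -> R) (N : nat) : th2 < p1 -> 0 <= C ->
  (forall k, 0 < s k) -> (forall k, s k.+1 <= s k) ->
  (forall k, Vr (s k) = Vr (s 0%N) * 2^-1 ^+ k) ->
  (forall f, cLM p1%:E th1%:E omega1 v1 f -> (LM f <= C%:E * CLM f)%E) ->
  \sum_(k < N) (Vr (s k) * tlr (s k)) `^ rho p1 th2 <=
  lower_const p1 p2 th2 r * (C * Wr (s 0%N)) `^ rho p1 th2.
Proof.
move=> tp C0 s0 sS Vs H.
apply: (sum_of_test p1_0 p2_0 th2_0 r0 r12V Vr_gt0 tlr_gt0 Wr_gt0 tp C0 s0 sS Vs).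
by move=> c c0; exact: test.
Qed.

Lemma phi1E (x : R) : 0 < x -> phi1 V th1%:E omega1 x = harmonic_sup Vr Wr x.
Proof.
move=> x0; rewrite /phi1 /harmonic_sup; congr ereal_sup; apply/seteqP.
have E (t : R) : 0 < t ->
    (V t * Vcal V x t * (norm_on (lebesgue1 R) `]0%R, t[ th1%:E omega1)^-1 =
     (Vr t * (Vr x / (Vr x + Vr t)) * (Wr t)^-1)%:E)%E.
  move=> t0; rewrite /Vcal !VrE ?ltW// norm_omega1E// -EFinD !inver.
  by rewrite !gt_eqF ?Wr_gt0// addr_gt0// Vr_gt0.
by split=> _ [t /= t0 <-]; exists t => //; move: t0; rewrite in_itv/= andbT => t0;
  rewrite E.
Qed.

Lemma VcalE (t x : R) : 0 < t -> 0 < x -> Vcal V t x = (Vr t / (Vr t + Vr x))%:E.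
Proof.
move=> t0 x0; rewrite /Vcal !VrE ?ltW// -EFinD inver gt_eqF//.
by rewrite addr_gt0// Vr_gt0.
Qed.

Local Notation normI := (norm_I (cLM p1%:E th1%:E omega1 v1) CLM LM).

Lemma norm_I_le (C : R) : 0 <= C ->
  (forall f, cLM p1%:E th1%:E omega1 v1 f -> (LM f <= C%:E * CLM f)%E) ->
  (normI <= C%:E)%E.
Proof. by move=> C0 H; apply: ereal_inf_lbound; exists C. Qed.

Lemma norm_I_ge (M : \bar R) :
  (forall C : R, 0 <= C ->
    (forall f, cLM p1%:E th1%:E omega1 v1 f -> (LM f <= C%:E * CLM f)%E) ->
    (M <= C%:E)%E) ->
  (M <= normI)%E.
Proof. by move=> H; apply: le_ereal_inf_tmp => _ [C [C0 HC] <-]; exact: H. Qed.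

Lemma norm_I_ge0 : (0 <= normI)%E.
Proof. by apply: norm_I_ge => C C0 _; rewrite lee_fin. Qed.

(** Adding the constants of all bounds gives one that serves both cases. The summands are
    nonnegative whatever the order of [p1] and [th2]. *)
Definition equiv_const : R := 1 + upper_const * 4 + (1 - 2^-1 `^ r) `^ (- r^-1) +
  ((1 + 2 `^ rho p1 th2) * lower_const p1 p2 th2 r) `^ (rho p1 th2)^-1.

Lemma equiv_const_ge1 : 1 <= equiv_const.
Proof. by rewrite /equiv_const -!addrA lerDl !addr_ge0 ?mulr_ge0 ?powR_ge0. Qed.

Let upper_const_le : upper_const * 4 <= equiv_const.
Proof.
rewrite /equiv_const addrAC (addrC 1) -!addrA lerDl.
by rewrite !addr_ge0 ?powR_ge0.
Qed.

(** The product can be regrouped with [Vr t] or with [Vr s] in front; the other two factors are then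
    at most 1. *)
Let harm_min (s t x : R) : 0 < s -> 0 < t -> 0 < x ->
  Vr s * (Vr x / (Vr x + Vr s)) * (Vr t / (Vr t + Vr x)) <= Num.min (Vr t) (Vr s).
Proof.
move=> s0 t0 x0; have := Vr_gt0 s0; have := Vr_gt0 t0; have := Vr_gt0 x0.
move: (Vr s) (Vr t) (Vr x) => a b c c0 b0 a0.
have h1 : c / (c + a) <= 1 by rewrite ler_pdivrMr ?addr_gt0// mul1r lerDl ltW.
have h2 : b / (b + c) <= 1 by rewrite ler_pdivrMr ?addr_gt0// mul1r lerDl ltW.
have h3 : a / (c + a) <= 1 by rewrite ler_pdivrMr ?addr_gt0// mul1r lerDr ltW.
have h4 : c / (b + c) <= 1 by rewrite ler_pdivrMr ?addr_gt0// mul1r lerDr ltW.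
have p (h k : R) : 0 < h -> 0 < k -> 0 <= h / k by move=> h0 k0; rewrite ltW// divr_gt0.
have q1 := p _ _ c0 (addr_gt0 c0 a0); have q2 := p _ _ b0 (addr_gt0 b0 c0).
have q3 := p _ _ a0 (addr_gt0 c0 a0); have q4 := p _ _ c0 (addr_gt0 b0 c0).
rewrite le_min; apply/andP; split.
  have -> : a * (c / (c + a)) * (b / (b + c)) = b * ((a / (c + a)) * (c / (b + c))).
    by ring.
  by rewrite ler_piMr ?(ltW b0)// mulr_ile1.
by rewrite -mulrA ler_piMr ?(ltW a0)// mulr_ile1.
Qed.

Let min_harm (s t : R) : 0 < s -> 0 < t ->
  Num.min (Vr t) (Vr s) <= 2 * Vr s * (Vr t / (Vr t + Vr s)).
Proof.
move=> s0 t0; have := Vr_gt0 s0; have := Vr_gt0 t0.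
move: (Vr s) (Vr t) => a b b0 a0.
rewrite mulrA ler_pdivlMr ?addr_gt0//; have [ab|ba] := leP b a.
  rewrite (_ : 2 * a * b = b * (2 * a)); last by ring.
  by rewrite ler_wpM2l ?(ltW b0)// mulr_natl mulr2n lerD2r.
rewrite (_ : 2 * a * b = a * (2 * b)); last by ring.
by rewrite ler_wpM2l ?(ltW a0)// mulr_natl mulr2n lerD2l ltW.
Qed.

(** * The case [p1 <= theta2] *)

Section case_sup.
Hypothesis p1_th2 : p1 <= th2.

Local Notation tail := (fun t => norm_on (lebesgue1 R) `]t, +oo[ th2%:E omega2).
Local Notation I := (fun x => ereal_sup [set Vcal V t x * tail t | t in `]0%R, +oo[])%E.
Let J (s : R) := ereal_sup [set (Num.min (Vr t) (Vr s) * tlr t)%:E | t in `]0%R, +oo[].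

Let tailE (t : R) : 0 < t -> tail t = (tlr t)%:E.
Proof. exact: norm_omega2E. Qed.

Let I_ge0 (x : R) : 0 < x -> (0 <= I x)%E.
Proof.
move=> x0; apply: (@le_trans _ _ (Vcal V x x * tail x)%E).
  rewrite VcalE// tailE// lee_fin.
  by rewrite mulr_ge0 ?divr_ge0 ?addr_ge0 ?(ltW (tlr_gt0 x0)) ?(ltW (Vr_gt0 x0)).
by apply: ereal_sup_ubound; exists x; rewrite //= in_itv/= x0.
Qed.

Let IJ (s x : R) : 0 < s -> 0 < x ->
  ((Vr s * (Vr x / (Vr x + Vr s)))%:E * I x <= J s)%E.
Proof.
move=> s0 x0; set c := Vr s * _.
have c0 : 0 < c by rewrite mulr_gt0 ?divr_gt0 ?addr_gt0 ?Vr_gt0.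
rewrite muleC -lee_pdivlMr//; apply: ge_ereal_sup => _ [t /= + <-].
rewrite in_itv/= andbT => t0; rewrite lee_pdivlMr//.
apply: (@le_trans _ _ (Num.min (Vr t) (Vr s) * tlr t)%:E); last first.
  by apply: ereal_sup_ubound; exists t; rewrite //= in_itv/= t0.
rewrite VcalE// tailE// -!EFinM lee_fin mulrC mulrA.
by rewrite ler_wpM2r ?(ltW (tlr_gt0 t0))//; exact: harm_min.
Qed.

Let JI (s : R) : 0 < s -> (J s <= (2 * Vr s)%:E * I s)%E.
Proof.
move=> s0; apply: ge_ereal_sup => _ [t /= + <-]; rewrite in_itv/= andbT => t0.
have V2 : 0 <= 2 * Vr s by rewrite mulr_ge0// ltW// Vr_gt0.
apply: (@le_trans _ _ ((2 * Vr s)%:E * (Vcal V t s * tail t))%E); last first.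
  apply: lee_wpmul2l; first by rewrite lee_fin.
  by apply: ereal_sup_ubound; exists t; rewrite //= in_itv/= t0.
rewrite VcalE// tailE// -!EFinM lee_fin mulrA.
by rewrite ler_wpM2r ?(ltW (tlr_gt0 t0))//; exact: min_harm.
Qed.

Let Q := ereal_sup [set harmonic_sup Vr Wr x * I x | x in `]0%R, +oo[]%E.

Let norm_I_le_sup (C : R) : 0 <= C -> (Q <= C%:E)%E ->
  (normI <= (upper_const * 4 * C)%:E)%E.
Proof.
rewrite -(mulrA upper_const); move=> C0 QC; have C4 : 0 <= 4 * C by rewrite mulr_ge0.
apply: norm_I_le; first by rewrite !mulr_ge0 ?powR_ge0.
apply: norm_le_of_sup; [exact: p1_th2|exact: C4|move=> t x t0 x0].
have := sup_product_ge Vr_gt0 Wr_gt0 I_ge0 JI QC x0.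
rewrite -lee_fin; apply: le_trans.
by apply: ereal_sup_ubound; exists t; rewrite //= in_itv/= t0.
Qed.

Let norm_I_ge_sup : (Q <= ((1 - 2^-1 `^ r) `^ (- r^-1))%:E * normI)%E.
Proof.
have d0 : 0 < 1 - 2^-1 `^ r by rewrite subr_gt0 half_powR_lt1.
have l0 : 0 < (1 - 2^-1 `^ r) `^ (- r^-1) by rewrite powR_gt0.
rewrite -lee_pdivrMl//; apply: norm_I_ge => C C0 H; rewrite lee_pdivrMl// -EFinM.
apply: (sup_product_le Vr_gt0 Wr_gt0 I_ge0 IJ); first by rewrite mulr_ge0// ltW.
move=> s s0; apply: ge_ereal_sup => _ [t /= + <-]; rewrite in_itv/= andbT => t0.
(* Both orders reduce to the diagonal estimate: for s <= t it is used at s, as [tlr] decreases; for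
   t < s it is used at t, as [Wr] increases. *)
rewrite lee_fin; have [st|ts] := leP s t.
  apply: le_trans (sup_le_of_norm C0 s0 H); apply: ler_pM.
  - by rewrite le_min !ltW// Vr_gt0.
  - exact: ltW (tlr_gt0 t0).
  - by rewrite ge_min lexx orbT.
  - exact: tlr_ni.
apply: (@le_trans _ _ (Vr t * tlr t)).
  by rewrite ler_wpM2r ?(ltW (tlr_gt0 t0))// ge_min lexx.
apply: (le_trans (sup_le_of_norm C0 t0 H)); apply: ler_wpM2l.
  by rewrite mulr_ge0// ltW.
apply: ler_powR_base; [exact: ltW|exact/ltW/psi1_head_gt0|].
exact: (head_nd measurable_psi1 (fun t _ => psi1_ge0 t) psi1_head_fin t0 (ltW ts)).
Qed.

Lemma norm_I_eqv_sup : eqv_upto equiv_const normI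
  (ereal_sup [set phi1 V th1%:E omega1 x * I x | x in `]0%R, +oo[])%E.
Proof.
have -> : (ereal_sup [set phi1 V th1%:E omega1 x * I x | x in `]0%R, +oo[])%E = Q.
  congr ereal_sup; apply: eq_imagel => x; rewrite /= in_itv/= andbT => x0.
  by rewrite phi1E.
apply: (eqv_upto_of_bounds equiv_const_ge1 upper_const_le _ norm_I_ge0
  (sup_product_ge0 Vr_gt0 Wr_gt0 I_ge0) norm_I_le_sup norm_I_ge_sup).
rewrite /equiv_const addrAC lerDr.
by rewrite !addr_ge0 ?mulr_ge0 ?powR_ge0.
Qed.

End case_sup.

(** * The case [theta2 < p1] *)

Section case_integral.
Hypothesis th2_p1 : th2 < p1.

Local Notation RR := (measurableTypeR R).
Local Notation rh := (rho p1 th2).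
Local Notation tail := (fun t => norm_on (lebesgue1 R) `]t, +oo[ th2%:E omega2).
Local Notation m := (stieltjes_measure (fun t => - (tail t `^ rh)))%E.
Local Notation I :=
  (fun x => (\int[m]_(t in `]0%R, +oo[) (Vcal V t x `^ rh)) `^ rh^-1)%E.
Let J (s : R) := (min_integral m rh Vr s `^ rh^-1)%E.

Let rh0 : 0 < rh. Proof. exact: rho_gt0. Qed.
Let rhV0 : 0 < rh^-1. Proof. by rewrite invr_gt0. Qed.

Let G (t : R) : \bar R := (- (tail t `^ rh))%E.

Let GE (t : R) : 0 < t -> G t = (- (tlr t `^ rh))%:E.
Proof. by move=> t0; rewrite /G /= norm_omega2E// poweR_EFin -EFinN. Qed.

Let tlr_powR_right_continuous (t : R) : 0 < t ->
  (tlr s `^ rh) @[s --> t^'+] --> tlr t `^ rh.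
Proof.
move=> t0; have -> : (fun s => tlr s `^ rh) = (@powR R ^~ (th2^-1 * rh)) \o tau.
  by apply/funext => s; rewrite /tlr /= -powRrM.
rewrite /tlr -powRrM; apply: cvg_comp.
  exact: (tailr_right_continuous measurable_psi2 (fun t _ => psi2_ge0 t)
    psi2_tail_fin).
by apply: (@continuous_powR R id); [exact: psi2_tail_gt0|move=> ?; exact].
Qed.

Let G_stieltjes : is_stieltjes G (stieltjes_measure G).
Proof.
apply: stieltjes_measureP.
- by move=> t t0; rewrite (GE t0).
- move=> s t; rewrite !in_itv/= !andbT => s0 t0 st.
  rewrite (GE s0) (GE t0) lee_fin lerN2.
  by apply: ler_powR_base; [exact: ltW|exact/ltW/tlr_gt0|exact: tlr_ni].
- move=> t t0; rewrite (GE t0).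
  apply: (@cvg_trans _ ((- (tlr s `^ rh))%:E @[s --> t^'+])).
    apply: near_eq_cvg; near=> s; rewrite GE//.
    by apply: lt_trans t0 _; near: s; exact: nbhs_right_gt.
  apply: cvg_EFin; first by near=> s.
  by apply: cvgN; exact: tlr_powR_right_continuous.
Unshelve. all: by end_near.
Qed.

Let mE (a b : R) : 0 < a -> a <= b ->
  m `]a, b]%classic = (tlr a `^ rh - tlr b `^ rh)%:E.
Proof.
move=> a0 ab; have b0 := lt_le_trans a0 ab.
have -> : m `]a, b]%classic = (G b - G a)%E by exact: G_stieltjes.
by rewrite (GE a0) (GE b0) -EFinB opprK addrC.
Qed.

Let h (x t : R) : R := (Vr t / (Vr t + Vr x)) `^ rh.

Let IE (x : R) : 0 < x ->
  I x = ((\int[m]_(t in `]0%R, +oo[) (h x t)%:E) `^ rh^-1)%E.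
Proof.
move=> x0; congr poweR; apply: eq_integral => t; rewrite inE/= in_itv/= andbT => t0.
by rewrite VcalE.
Qed.

Let Vsum_gt0 (t x : R) : 0 < t -> 0 < x -> 0 < Vr t + Vr x.
Proof. by move=> t0 x0; rewrite addr_gt0 ?Vr_gt0. Qed.

Let mh (x : R) : 0 < x ->
  measurable_fun (`]0%R, +oo[%classic : set RR) (fun t : RR => (h x t)%:E).
Proof.
move=> x0; apply: (monotone_measurable _ _).1; first exact: interval_is_interval.
left => s t; rewrite /= !in_itv/= !andbT => s0 t0 st; rewrite lee_fin.
have Vs := ltW (Vr_gt0 s0).
apply: ler_powR_base; [exact: ltW|by rewrite divr_ge0 ?(ltW (Vsum_gt0 _ _))|].
rewrite ler_pdivrMr ?Vsum_gt0// mulrAC ler_pdivlMr ?Vsum_gt0//.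
by rewrite !mulrDr mulrC lerD2l ler_wpM2r ?(ltW (Vr_gt0 x0))// Vr_nd.
Qed.

Let mmin := measurable_min_powR rh0 Vr_gt0 Vr_nd.

Let h_int_ge0 (x : R) : (0 <= \int[m]_(t in `]0%R, +oo[) (h x t)%:E)%E.
Proof. by apply: integral_ge0 => t _; rewrite lee_fin powR_ge0. Qed.

Let min_int_ge0 (x : R) : (0 <= min_integral m rh Vr x)%E.
Proof. by apply: integral_ge0 => t _; rewrite lee_fin powR_ge0. Qed.

Let scaleK (c : R) (i : \bar R) : 0 <= c -> (0 <= i)%E ->
  (c%:E * i `^ rh^-1 = ((c `^ rh)%:E * i) `^ rh^-1)%E.
Proof.
move=> c0 i0; rewrite poweRM ?lee_fin ?powR_ge0// poweR_EFin -powRrM.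
by rewrite mulfV ?gt_eqF// powRr1.
Qed.

(** With the constant under the integral, [IJ] and [JI] become the pointwise inequalities [harm_min]
    and [min_harm]. *)
Let scale_int (c x : R) : 0 <= c -> 0 < x ->
  ((c `^ rh)%:E * \int[m]_(t in `]0%R, +oo[) (h x t)%:E =
   \int[m]_(t in `]0%R, +oo[) ((c * (Vr t / (Vr t + Vr x))) `^ rh)%:E)%E.
Proof.
move=> c0 x0; rewrite -ge0_integralZl//.
- apply: eq_integral => t; rewrite inE/= in_itv/= andbT => t0.
  by rewrite -EFinM powRM// divr_ge0 ?(ltW (Vr_gt0 t0)) ?(ltW (Vsum_gt0 _ _)).
- exact: mh.
- by move=> t _; rewrite lee_fin powR_ge0.
- by rewrite lee_fin powR_ge0.
Qed.

Let mscale (c x : R) : 0 <= c -> 0 < x ->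
  measurable_fun (`]0%R, +oo[%classic : set RR)
    (fun t : RR => ((c * (Vr t / (Vr t + Vr x))) `^ rh)%:E).
Proof.
move=> c0 x0.
apply: (@eq_measurable_fun _ _ _ _ _ (fun t : RR => (c `^ rh)%:E * (h x t)%:E)%E).
  move=> t; rewrite inE/= in_itv/= andbT => t0.
  by rewrite -EFinM powRM// divr_ge0 ?(ltW (Vr_gt0 t0)) ?(ltW (Vsum_gt0 _ _)).
by apply: emeasurable_funM => //; exact: mh.
Qed.

Let I_ge0 (x : R) : 0 < x -> (0 <= I x)%E.
Proof. by move=> _; exact: poweR_ge0. Qed.

Let IJ (s x : R) : 0 < s -> 0 < x ->
  ((Vr s * (Vr x / (Vr x + Vr s)))%:E * I x <= J s)%E.
Proof.
move=> s0 x0; set c := Vr s * _.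
have c0 : 0 <= c.
  by rewrite mulr_ge0 ?divr_ge0 ?(ltW (Vr_gt0 _)) ?(ltW (Vsum_gt0 _ _)).
rewrite (IE x0) (scaleK c0 (h_int_ge0 x)) (scale_int c0 x0).
apply: lee_poweR; first exact: ltW.
  by apply: integral_ge0 => t _; rewrite lee_fin powR_ge0.
apply: ge0_le_integral => //.
- by move=> t _; rewrite lee_fin powR_ge0.
- exact: mscale.
- exact: mmin.
move=> t /=; rewrite in_itv/= andbT => t0; rewrite lee_fin.
apply: ler_powR_base; [exact: ltW| |exact: harm_min].
by rewrite mulr_ge0// divr_ge0 ?(ltW (Vr_gt0 _)) ?(ltW (Vsum_gt0 _ _)).
Qed.

Let JI (s : R) : 0 < s -> (J s <= (2 * Vr s)%:E * I s)%E.
Proof.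
move=> s0; have c0 : 0 <= 2 * Vr s by rewrite mulr_ge0 ?(ltW (Vr_gt0 _)).
rewrite (IE s0) (scaleK c0 (h_int_ge0 s)) (scale_int c0 s0).
apply: lee_poweR; first exact: ltW.
  exact: min_int_ge0.
apply: ge0_le_integral => //.
- by move=> t _; rewrite lee_fin powR_ge0.
- exact: mmin.
- exact: mscale.
move=> t /=; rewrite in_itv/= andbT => t0; rewrite lee_fin.
apply: ler_powR_base; [exact: ltW|by rewrite le_min !ltW// Vr_gt0|exact: min_harm].
Qed.

Let JK (s : R) : (J s `^ rh = min_integral m rh Vr s)%E.
Proof. exact: poweRK. Qed.

Let Q := ereal_sup [set harmonic_sup Vr Wr x * I x | x in `]0%R, +oo[]%E.

Let norm_I_le_integral (C : R) : 0 <= C -> (Q <= C%:E)%E ->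
  (normI <= (upper_const * 4 * C)%:E)%E.
Proof.
rewrite -(mulrA upper_const).
move=> C0 QC; pose K := upper_const * 4.
have K0 : 0 < K by rewrite !mulr_gt0 ?powR_gt0.
(* [norm_le_of_sum] asks for a positive constant while [C] may be 0; the slack [e / K] turns into
   [e] after multiplication by [K]. *)
apply/lee_addgt0Pr => e e0; pose C' := C + e / K.
have C'0 : 0 < C' by rewrite ltr_wpDl// divr_gt0.
have -> : ((upper_const * (4 * C))%:E + e%:E = (upper_const * (4 * C'))%:E)%E.
  by rewrite -EFinD /C' !(mulrA _ 4) -/K mulrDr (mulrC K (e / K)) divfK// gt_eqF.
apply: norm_I_le; first by rewrite !mulr_ge0 ?powR_ge0// ltW.
apply: norm_le_of_sum => //; first by rewrite mulr_gt0.
move=> x t N x0 t0 tS; rewrite -lee_fin.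
apply: (le_trans (sum_le_min_integral rh0 Vr_gt0 Vr_nd mE N x0 t0 tS)).
rewrite -JK -poweR_EFin; apply: lee_poweR; [exact: ltW|exact: poweR_ge0|].
apply: (sup_product_ge Vr_gt0 Wr_gt0 I_ge0 JI _ x0).
by apply: (le_trans QC); rewrite lee_fin lerDl ltW// divr_gt0.
Qed.

Let integral_const : R := ((1 + 2 `^ rh) * lower_const p1 p2 th2 r) `^ rh^-1.

(** The test sums along radii at which [Vr] halves are bounded uniformly in their length, so
    [min_integral_le] passes to the integral at the cost of [1 + 2 ^ rh]. *)
Let norm_I_ge_integral : (Q <= integral_const%:E * normI)%E.
Proof.
have d0 (e : R) : 0 < e -> 0 < 1 - 2^-1 `^ e by move=> e0; rewrite subr_gt0 half_powR_lt1.
have lc0 : 0 < lower_const p1 p2 th2 r.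
  apply: powR_gt0; apply: divr_gt0; first by apply: powR_gt0; exact: d0.
  apply: mulr_gt0; last exact: d0.
  by apply: mulr_gt0; [apply: powR_gt0; exact: d0|exact: divr_gt0].
have L0 : 0 < (1 + 2 `^ rh) * lower_const p1 p2 th2 r.
  by apply: mulr_gt0 => //; rewrite addr_gt0 ?powR_gt0.
have l0 : 0 < integral_const by rewrite powR_gt0.
rewrite -lee_pdivrMl//; apply: norm_I_ge => C C0 H; rewrite lee_pdivrMl// -EFinM.
apply: (sup_product_le Vr_gt0 Wr_gt0 I_ge0 IJ); first by rewrite mulr_ge0// ltW.
move=> x x0; have [s [sx s0 sS Vs]] := dyadic_volume x0.
have := min_integral_le rh0 Vr_gt0 Vr_nd tlr_gt0 mE s0 sS Vs
  (fun N => sum_le_of_norm N th2_p1 C0 s0 sS Vs H).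
rewrite sx => /(lee_poweR (ltW rhV0) (min_int_ge0 x)) /le_trans; apply.
have CW : 0 <= C * Wr x by rewrite mulr_ge0// ltW// Wr_gt0.
rewrite poweR_EFin lee_fin mulrA powRM ?powR_ge0 ?(ltW L0)//.
by rewrite -powRrM mulfV ?gt_eqF// powRr1// -mulrA.
Qed.

Lemma norm_I_eqv_integral : eqv_upto equiv_const normI
  (ereal_sup [set phi1 V th1%:E omega1 x * I x | x in `]0%R, +oo[])%E.
Proof.
have -> : (ereal_sup [set phi1 V th1%:E omega1 x * I x | x in `]0%R, +oo[])%E = Q.
  congr ereal_sup; apply: eq_imagel => x; rewrite /= in_itv/= andbT => x0.
  by rewrite phi1E.
apply: (eqv_upto_of_bounds equiv_const_ge1 upper_const_le _ norm_I_ge0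
  (sup_product_ge0 Vr_gt0 Wr_gt0 I_ge0) norm_I_le_integral norm_I_ge_integral).
by rewrite /equiv_const lerDr !addr_ge0 ?mulr_ge0 ?powR_ge0.
Qed.

End case_integral.

End weights.

Unset Implicit Arguments.

Theorem theorem2p9 (R : realType) (n : nat) (p1 p2 theta1 theta2 : R)
    (n_ge1 : (1 <= n)%N)
    (p1_gt0 : 0 < p1) (p2_gt0 : 0 < p2)
    (theta1_gt0 : 0 < theta1) (theta2_gt0 : 0 < theta2)
    (p2_lt_p1 : p2 < p1) (theta1_le_p2 : theta1 <= p2)
    (p2_lt_theta2 : p2 < theta2) :
  exists2 lambda : R, 1 <= lambda &
  forall (v1 v2 : leb_space R n -> \bar R) (omega1 omega2 : R -> \bar R),
  weight (lebesgue R n) v1 -> weight (lebesgue R n) v2 ->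
  cOmega theta1%:E omega1 -> Omega theta2%:E omega2 ->
  let V := Vtilde p1%:E p2%:E v1 v2 in
  let phi := phi1 V theta1%:E omega1 in
  let r12 := fine (to_exp p1%:E p2%:E) in
  let rho := fine (to_exp p1%:E theta2%:E) in
  let tail := fun t : R => norm_on (lebesgue1 R) `]t, +oo[ theta2%:E omega2 in
  let normI := norm_I (cLM p1%:E theta1%:E omega1 v1)
    (cLM_norm p1%:E theta1%:E omega1 v1) (LM_norm p2%:E theta2%:E omega2 v2) in
  admissible V ->
  Q_ (fun x => (V x `^ (1 / r12))%E) phi ->
  (p1 <= theta2 ->
    eqv_upto lambda normI
      (ereal_sup [set (phi x *
          ereal_sup [set Vcal V t x * tail t | t in `]0%R, +oo[])%E
        | x in `]0%R, +oo[])) /\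
  (theta2 < p1 ->
    eqv_upto lambda normI
      (ereal_sup [set (phi x *
          (\int[stieltjes_measure (fun t => - (tail t `^ rho))]_(t in `]0%R, +oo[)
             (Vcal V t x `^ rho)) `^ (1 / rho))%E
        | x in `]0%R, +oo[])).
Proof.
exists (equiv_const p1 p2 theta1 theta2); first exact: equiv_const_ge1.
move=> v1 v2 omega1 omega2 wv1 wv2 O1 O2 V phi r12 rho tail normI Vadm _.
split=> [pt|tp].
  exact: (norm_I_eqv_sup p1_gt0 p2_gt0 theta1_gt0 theta2_gt0 p2_lt_p1 theta1_le_p2
    p2_lt_theta2 wv1 wv2 O1 O2 Vadm pt).
have {rho}-> : rho = (theta2^-1 - p1^-1)^-1 by rewrite /rho to_expE.
rewrite div1r.
exact: (norm_I_eqv_integral p1_gt0 p2_gt0 theta1_gt0 theta2_gt0 p2_lt_p1 theta1_le_p2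
  p2_lt_theta2 wv1 wv2 O1 O2 Vadm tp).
Qed.
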